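(* Let $\{f_n\}\subset\mathcal{N}^*$ be a sequence of Nehari mappings with $$\lim_{n\to\infty}\delta_{f_n}=0 .$$ Then some subsequence of normalized mappings $f_{n_k}^{*}$ converges locally uniformly to $L$.
   Context: $\mathbb{D}$ is the open unit disk. The Nehari class $\mathcal{N}$ consists of the locally univalent analytic functions $f$ in $\mathbb{D}$ with $f(0)=0$, $f'(0)=1$ and $$(1-|z|^2)^2|Sf(z)|\leq 2,\qquad z\in\mathbb{D},$$ where $Sf=(f''/f')'-\frac12(f''/f')^2$ is the Schwarzian derivative. $\mathcal{N}^*$ is the subclass of those $f\in\mathcal{N}$ for which $f(\mathbb{D})$ is not the image of a parallel strip under a Möbius transformation. For $f\in\mathcal{N}$ let $a_2=f''(0)/2$ be its second Taylor coefficient; the normalized mapping is $f^{*}=\dfrac{f}{1+a_2f}$, which is analytic in $\mathbb{D}$ since $-1/a_2\notin f(\mathbb{D})$. For $f\in\mathcal{N}^*$ the value $-1/a_2$ lies outside the closure of $f(\mathbb{D})$, and for $a_2\neq0$ $$\delta_f=\inf_{z\in\mathbb{D}}\left|f(z)+\frac1{a_2}\right| ,$$ which is to be understood in terms of the spherical distance when $a_2=0$ (that is, as the spherical distance from $f(\mathbb{D})$ to $\infty$). Finally, $L(z)=\frac12\log\frac{1+z}{1-z}$, which maps $\mathbb{D}$ onto a parallel strip.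
   Formalization: The limit is L only up to a rotation, i.e. conj(c)L(cz) for some |c|=1; convergence to L itself fails, e.g. for rotated lens mappings in N* with a_2=0 and delta tending to 0, whose limit is -iL(iz)=arctan z. *)

(* Defs.v *)
(* Stdlib reals with Coquelicot's complex numbers. *)
From Stdlib Require Import Reals.
From Coquelicot Require Import Coquelicot.
Open Scope R_scope.

(* Functions on the disk are total functions [C -> C]; only their values on
   [disk] matter, since [disk] is open and [C_derive] is local. *)
Definition disk (z : C) : Prop := Cmod z < 1.

Definition analytic_on_disk (f : C -> C) : Prop :=
  forall z0 : C, disk z0 ->
  exists (a : nat -> C) (r : R), 0 < r /\
    forall z : C, Cmod (z - z0)%C < r ->
      @is_pseries C_AbsRing C_NormedModule a (z - z0)%C (f z).

Definition locally_univalent_on_disk (f : C -> C) : Prop :=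
  forall z0 : C, disk z0 ->
  exists r : R, 0 < r /\
    forall z w : C, disk z -> disk w ->
      Cmod (z - z0)%C < r -> Cmod (w - z0)%C < r -> f z = f w -> z = w.

Definition schwarzian (f : C -> C) (z : C) : C :=
  let p := fun w : C => (C_derive (C_derive f) w / C_derive f w)%C in
  (C_derive p z - / 2 * (p z) ^ 2)%C.

Definition nehari (f : C -> C) : Prop :=
  analytic_on_disk f /\ locally_univalent_on_disk f /\
  f 0%C = 0%C /\ C_derive f 0%C = 1%C /\
  forall z : C, disk z ->
    (1 - Cmod z ^ 2) ^ 2 * Cmod (schwarzian f z) <= 2.

(* The Riemann sphere: [Some z] is a finite point and [None] is infinity. *)
Definition sphere : Type := option C.

Definition mobius (a b c d : C) (p : sphere) : sphere :=
  match p with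
  | Some z =>
      if Ceq_dec (c * z + d)%C 0%C then None
      else Some ((a * z + b) / (c * z + d))%C
  | None => if Ceq_dec c 0%C then None else Some (a / c)%C
  end.

Definition is_mobius (T : sphere -> sphere) : Prop :=
  exists a b c d : C, (a * d - b * c)%C <> 0%C /\
    forall p : sphere, T p = mobius a b c d p.

(* Open strip between two parallel lines orthogonal to [u]. *)
Definition is_parallel_strip (S : C -> Prop) : Prop :=
  exists (u : C) (alpha beta : R), u <> 0%C /\ alpha < beta /\
    forall z : C, S z <-> alpha < Re (Cconj u * z)%C < beta.

(* Both images are compared as subsets of the sphere. *)
Definition mobius_image_of_strip (f : C -> C) : Prop :=
  exists (T : sphere -> sphere) (S : C -> Prop),
    is_mobius T /\ is_parallel_strip S /\
    forall p : sphere,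
      (exists z : C, disk z /\ Some (f z) = p) <->
      (exists s : C, S s /\ T (Some s) = p).

Definition nehari_star (f : C -> C) : Prop :=
  nehari f /\ ~ mobius_image_of_strip f.

Definition a2 (f : C -> C) : C := (C_derive (C_derive f) 0%C / 2)%C.

Definition normalized (f : C -> C) (z : C) : C := (f z / (1 + a2 f * f z))%C.

Definition chordal_dist (p q : sphere) : R :=
  match p, q with
  | Some z, Some w =>
      2 * Cmod (z - w)%C / (sqrt (1 + Cmod z ^ 2) * sqrt (1 + Cmod w ^ 2))
  | Some z, None | None, Some z => 2 / sqrt (1 + Cmod z ^ 2)
  | None, None => 0
  end.

(* Geodesic (great circle) distance on the unit sphere. *)
Definition spherical_dist (p q : sphere) : R := 2 * asin (chordal_dist p q / 2).

(* Both infima are over nonempty sets of nonnegative reals, so [Glb_Rbar] is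
   finite and [real] only forgets the extended real type. *)
Definition delta (f : C -> C) : R :=
  if Ceq_dec (a2 f) 0%C then
    real (Glb_Rbar (fun d : R =>
      exists z : C, disk z /\ d = spherical_dist (Some (f z)) None))
  else
    real (Glb_Rbar (fun d : R =>
      exists z : C, disk z /\ d = Cmod (f z + 1 / a2 f)%C)).

(* Principal argument, with values in (-PI, PI] for [w <> 0]. *)
Definition Carg (w : C) : R :=
  if Rlt_dec (Im w) 0 then - acos (Re w / Cmod w) else acos (Re w / Cmod w).

Definition Clog (w : C) : C := (ln (Cmod w), Carg w).

Definition L (z : C) : C := (/ 2 * Clog ((1 + z) / (1 - z)))%C.

(* The class of Nehari functions, [nehari_star], [delta] and the map
   [f |-> normalized f] are all compatible with the rotations
   [f |-> rotation c f], [Cmod c = 1], so extremal functions such as [L] are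
   determined only up to rotation. *)
Definition rotation (c : C) (f : C -> C) (z : C) : C := (Cconj c * f (c * z))%C.

Definition locally_uniformly_on_disk (F : nat -> C -> C) (g : C -> C) : Prop :=
  forall z0 : C, disk z0 ->
  exists r : R, 0 < r /\
    forall eps : R, 0 < eps ->
    exists N : nat, forall n : nat, (N <= n)%nat ->
      forall z : C, disk z -> Cmod (z - z0)%C < r ->
        Cmod (F n z - g z)%C < eps.

(* Main.v *)
(* Write g = f / (1 + a2 f), so g'(0) = 1 and g''(0) = 0. Along a radius put
   phi(t) = |g'|^(-1/2) (1 - t^2)^(-1/2). The Nehari bound makes phi convex in the
   hyperbolic parameter, with phi(0) = 1 and phi'(0) = 0; hence |g'| <= 1/(1 - t^2), and
   as soon as the slope of phi at r0 is at least e > 0 one gets |g| <= atanh r0 + 1/e on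
   the whole radius. Since f + 1/a2 = 1/(a2 (1 - a2 g)) and a2 is bounded, delta -> 0
   forces sup |g_n| -> oo, so on suitable radii with directions c_n the slopes tend to
   zero on compacts. The convexity defect also controls the argument of g', so
   g_n'(c_n t) -> 1/(1 - t^2) = L'(t) on [0, 1). Vitali's argument spreads this to the
   disk, and a limit of the c_n gives the rotation. *)
Require Import Defs.
From Stdlib Require Import Reals Lra Lia Psatz IndefiniteDescription.
From Coquelicot Require Import Coquelicot.
Open Scope R_scope.

(** * Complex derivatives *)

(** The Möbius map taking [f] to [g] keeps the Schwarzian [S], and [u = (g')^(-1/2)] solves
    [u'' + (S/2) u = 0]. For [g = L] on the real radius [u] is [sqrt(1 - t^2)], and [phi] is the
    quotient of [|u|] by this solution. In the parameter [x = atanh t] one has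
    [|g'| dt = dx / phi^2], so once the slope is at least [e] the rest of the radius contributes at
    most [1/e]. That [g] is defined at all needs proof: [nehari] states neither [f' <> 0] nor
    [1 + a2 f <> 0], and both are obtained from the differential equation by continuation along
    radii. The bound on [a2] comes from a crude lower bound for [|g|] on the circle of radius 1/10
    and the mean value property of [1/(1 - a2 g)]. Since the directions [c_n] vary, the functions
    compared are [g_n(c_n z)], turned so that the good radius is always the positive real one.
    Convergence is then known on one segment only, which is why Cauchy's formula and Taylor
    coefficients are developed. *)

Lemma Cmod_minus_sym (x y : C) : Cmod (x - y)%C = Cmod (y - x)%C.
Proof. rewrite <- Cmod_opp. f_equal. ring. Qed.

Lemma Cmod_sub_le (x y : C) : Cmod (x - y)%C <= Cmod x + Cmod y.
Proof. unfold Cminus. rewrite <- (Cmod_opp y). apply Cmod_triangle. Qed.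

Lemma Cmod_sub_ge (x y : C) : Cmod x - Cmod y <= Cmod (x - y)%C.
Proof.
  assert (H := Cmod_triangle (x - y)%C y).
  replace (x - y + y)%C with x in H by ring. lra.
Qed.

Lemma Cmod_neq_0 (x : C) : x <> 0%C -> 0 < Cmod x.
Proof. apply Cmod_gt_0. Qed.

Lemma neq_0_of_Cmod (x : C) : 0 < Cmod x -> x <> 0%C.
Proof. apply Cmod_gt_0. Qed.

Definition ccont (f : C -> C) (z : C) : Prop :=
  forall eps : R, 0 < eps -> exists d : R, 0 < d /\
    forall w : C, Cmod (w - z)%C < d -> Cmod (f w - f z)%C < eps.

(* Caratheodory's formulation: algebraic rules for derivatives reduce to
   algebraic rules for continuity. *)
Definition cder (f : C -> C) (z l : C) : Prop :=
  exists g : C -> C, g z = l /\ ccont g z /\ exists d : R, 0 < d /\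
    forall w : C, Cmod (w - z)%C < d -> (f w - f z = g w * (w - z))%C.

Lemma ccont_const (c z : C) : ccont (fun _ => c) z.
Proof.
  intros e He. exists 1. split; [lra|]. intros w _.
  replace (c - c)%C with (RtoC 0) by ring. rewrite Cmod_0. exact He.
Qed.

Lemma ccont_id (z : C) : ccont (fun w => w) z.
Proof. intros e He. exists e. split; auto. Qed.

Lemma ccont_plus (f g : C -> C) (z : C) :
  ccont f z -> ccont g z -> ccont (fun w => f w + g w)%C z.
Proof.
  intros Hf Hg e He.
  destruct (Hf (e/2)) as [d1 [H1 K1]]; [lra|].
  destruct (Hg (e/2)) as [d2 [H2 K2]]; [lra|].
  exists (Rmin d1 d2). split; [apply Rmin_glb_lt; auto|].
  intros w Hw.
  specialize (K1 w (Rlt_le_trans _ _ _ Hw (Rmin_l _ _))).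
  specialize (K2 w (Rlt_le_trans _ _ _ Hw (Rmin_r _ _))).
  replace (f w + g w - (f z + g z))%C with ((f w - f z) + (g w - g z))%C by ring.
  eapply Rle_lt_trans; [apply Cmod_triangle|]. lra.
Qed.

Lemma ccont_bound (f : C -> C) (z : C) : ccont f z ->
  exists d : R, 0 < d /\ forall w, Cmod (w - z)%C < d -> Cmod (f w) < Cmod (f z) + 1.
Proof.
  intros Hf. destruct (Hf 1) as [d [H K]]; [lra|].
  exists d. split; auto. intros w Hw. specialize (K w Hw).
  assert (H1 := Cmod_sub_ge (f w) (f z)). lra.
Qed.

Lemma ccont_mult (f g : C -> C) (z : C) :
  ccont f z -> ccont g z -> ccont (fun w => f w * g w)%C z.
Proof.
  intros Hf Hg e He.
  destruct (ccont_bound g z Hg) as [d0 [H0 K0]].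
  set (A := Cmod (f z) + 1). set (B := Cmod (g z) + 1).
  assert (HA : 0 < A) by (unfold A; generalize (Cmod_ge_0 (f z)); lra).
  assert (HB : 0 < B) by (unfold B; generalize (Cmod_ge_0 (g z)); lra).
  destruct (Hf (e / (2 * B))) as [d1 [H1 K1]]; [apply Rdiv_lt_0_compat; lra|].
  destruct (Hg (e / (2 * A))) as [d2 [H2 K2]]; [apply Rdiv_lt_0_compat; lra|].
  exists (Rmin d0 (Rmin d1 d2)). split; [repeat apply Rmin_glb_lt; auto|].
  intros w Hw.
  assert (Hw0 := Rlt_le_trans _ _ _ Hw (Rmin_l _ _)).
  assert (Hw' := Rlt_le_trans _ _ _ Hw (Rmin_r _ _)).
  specialize (K0 w Hw0).
  specialize (K1 w (Rlt_le_trans _ _ _ Hw' (Rmin_l _ _))).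
  specialize (K2 w (Rlt_le_trans _ _ _ Hw' (Rmin_r _ _))).
  replace (f w * g w - f z * g z)%C
    with ((f w - f z) * g w + f z * (g w - g z))%C by ring.
  eapply Rle_lt_trans; [apply Cmod_triangle|]. rewrite !Cmod_mult.
  assert (Cmod (f w - f z)%C * Cmod (g w) <= e / (2 * B) * B).
  { apply Rmult_le_compat; try apply Cmod_ge_0; unfold B in *; lra. }
  assert (Cmod (f z) * Cmod (g w - g z)%C < A * (e / (2 * A))).
  { apply Rle_lt_trans with (A * Cmod (g w - g z)%C).
    - apply Rmult_le_compat_r; [apply Cmod_ge_0|unfold A; lra].
    - apply Rmult_lt_compat_l; auto. }
  replace (e / (2 * B) * B) with (e / 2) in H by (field; lra).
  replace (A * (e / (2 * A))) with (e / 2) in H3 by (field; lra). lra.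
Qed.

Lemma ccont_neq (f : C -> C) (z : C) : ccont f z -> f z <> 0%C ->
  exists d : R, 0 < d /\ forall w, Cmod (w - z)%C < d -> Cmod (f z) / 2 < Cmod (f w).
Proof.
  intros Hf Hn. apply Cmod_neq_0 in Hn.
  destruct (Hf (Cmod (f z) / 2)) as [d [H K]]; [lra|].
  exists d. split; auto. intros w Hw. specialize (K w Hw).
  assert (H1 := Cmod_sub_ge (f z) (f w)). rewrite Cmod_minus_sym in H1. lra.
Qed.

Lemma ccont_inv (f : C -> C) (z : C) :
  ccont f z -> f z <> 0%C -> ccont (fun w => / f w)%C z.
Proof.
  intros Hf Hn e He.
  destruct (ccont_neq f z Hf Hn) as [d1 [H1 K1]].
  set (A := Cmod (f z)). assert (HA : 0 < A) by (apply Cmod_neq_0; auto).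
  destruct (Hf (e * A * A / 2)) as [d2 [H2 K2]].
  { assert (0 < e * A * A) by (repeat apply Rmult_lt_0_compat; auto). lra. }
  exists (Rmin d1 d2). split; [apply Rmin_glb_lt; auto|].
  intros w Hw.
  specialize (K1 w (Rlt_le_trans _ _ _ Hw (Rmin_l _ _))).
  specialize (K2 w (Rlt_le_trans _ _ _ Hw (Rmin_r _ _))).
  fold A in K1.
  assert (Hw0 : f w <> 0%C) by (apply neq_0_of_Cmod; lra).
  replace (/ f w - / f z)%C with ((f z - f w) / (f w * f z))%C by (field; auto).
  rewrite Cmod_div by (apply Cmult_neq_0; auto).
  rewrite Cmod_mult, Cmod_minus_sym. fold A.
  apply Rmult_lt_reg_r with (Cmod (f w) * A);
    [apply Rmult_lt_0_compat; lra|].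
  unfold Rdiv. rewrite Rmult_assoc, Rinv_l, Rmult_1_r
    by (apply Rgt_not_eq, Rmult_lt_0_compat; lra).
  eapply Rlt_le_trans; [exact K2|].
  replace (e * A * A / 2) with (e * (A / 2 * A)) by field.
  apply Rmult_le_compat_l; [lra|]. apply Rmult_le_compat_r; lra.
Qed.

Lemma ccont_comp (f g : C -> C) (z : C) :
  ccont f z -> ccont g (f z) -> ccont (fun w => g (f w)) z.
Proof.
  intros Hf Hg e He. destruct (Hg e He) as [d1 [H1 K1]].
  destruct (Hf d1 H1) as [d2 [H2 K2]]. exists d2. split; auto.
Qed.

Lemma cder_ccont (f : C -> C) (z l : C) : cder f z l -> ccont f z.
Proof.
  intros [g [_ [Hg [d [Hd K]]]]].
  assert (H : ccont (fun w => f z + g w * (w - z))%C z).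
  { apply ccont_plus; [apply ccont_const|]. apply ccont_mult; auto.
    apply ccont_plus; [apply ccont_id|apply ccont_const]. }
  intros e He. destruct (H e He) as [d1 [H1 K1]].
  exists (Rmin d d1). split; [apply Rmin_glb_lt; auto|]. intros w Hw.
  assert (Hw1 := Rlt_le_trans _ _ _ Hw (Rmin_l _ _)).
  specialize (K1 w (Rlt_le_trans _ _ _ Hw (Rmin_r _ _))). simpl in K1.
  rewrite (K w Hw1).
  replace (f z + g w * (w - z) - (f z + g z * (z - z)))%C
    with (g w * (w - z))%C in K1 by ring. exact K1.
Qed.

Lemma cder_const (c z : C) : cder (fun _ => c) z 0%C.
Proof.
  exists (fun _ => 0%C). split; [reflexivity|]. split; [apply ccont_const|].
  exists 1. split; [lra|]. intros. ring.
Qed.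

Lemma cder_id (z : C) : cder (fun w => w) z 1%C.
Proof.
  exists (fun _ => 1%C). split; [reflexivity|]. split; [apply ccont_const|].
  exists 1. split; [lra|]. intros. ring.
Qed.

Lemma cder_plus (f g : C -> C) (z l m : C) :
  cder f z l -> cder g z m -> cder (fun w => f w + g w)%C z (l + m)%C.
Proof.
  intros [p [Hp [Cp [d1 [D1 K1]]]]] [q [Hq [Cq [d2 [D2 K2]]]]].
  exists (fun w => p w + q w)%C. rewrite Hp, Hq. split; [reflexivity|].
  split; [apply ccont_plus; auto|].
  exists (Rmin d1 d2). split; [apply Rmin_glb_lt; auto|]. intros w Hw.
  specialize (K1 w (Rlt_le_trans _ _ _ Hw (Rmin_l _ _))).
  specialize (K2 w (Rlt_le_trans _ _ _ Hw (Rmin_r _ _))).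
  replace (f w + g w - (f z + g z))%C with ((f w - f z) + (g w - g z))%C by ring.
  rewrite K1, K2. ring.
Qed.

Lemma cder_mult (f g : C -> C) (z l m : C) :
  cder f z l -> cder g z m -> cder (fun w => f w * g w)%C z (l * g z + f z * m)%C.
Proof.
  intros Hf Hg. assert (Cg := cder_ccont _ _ _ Hg).
  destruct Hf as [p [Hp [Cp [d1 [D1 K1]]]]].
  destruct Hg as [q [Hq [Cq [d2 [D2 K2]]]]].
  exists (fun w => p w * g w + f z * q w)%C. rewrite Hp, Hq. split; [reflexivity|].
  split.
  { apply ccont_plus; apply ccont_mult; auto. apply ccont_const. }
  exists (Rmin d1 d2). split; [apply Rmin_glb_lt; auto|]. intros w Hw.
  specialize (K1 w (Rlt_le_trans _ _ _ Hw (Rmin_l _ _))).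
  specialize (K2 w (Rlt_le_trans _ _ _ Hw (Rmin_r _ _))).
  replace (f w * g w - f z * g z)%C
    with ((f w - f z) * g w + f z * (g w - g z))%C by ring.
  rewrite K1, K2. ring.
Qed.

Lemma cder_inv (f : C -> C) (z l : C) :
  cder f z l -> f z <> 0%C -> cder (fun w => / f w)%C z (- l / (f z * f z))%C.
Proof.
  intros Hf Hn. assert (Cf := cder_ccont _ _ _ Hf).
  destruct (ccont_neq f z Cf Hn) as [d2 [D2 K2]].
  destruct Hf as [p [Hp [Cp [d1 [D1 K1]]]]].
  exists (fun w => -(1) * p w * (/ f w * / f z))%C. rewrite Hp. split; [field; auto|].
  split.
  { repeat apply ccont_mult; auto; try apply ccont_const. apply ccont_inv; auto. }
  exists (Rmin d1 d2). split; [apply Rmin_glb_lt; auto|]. intros w Hw.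
  specialize (K1 w (Rlt_le_trans _ _ _ Hw (Rmin_l _ _))).
  specialize (K2 w (Rlt_le_trans _ _ _ Hw (Rmin_r _ _))).
  assert (Hw0 : f w <> 0%C).
  { apply neq_0_of_Cmod. generalize (Cmod_ge_0 (f z)). lra. }
  replace (/ f w - / f z)%C with (-(1) * (f w - f z) * (/ f w * / f z))%C
    by (field; auto).
  rewrite K1. ring.
Qed.

Lemma cder_scale (f : C -> C) (c z l : C) :
  cder f (c * z)%C l -> cder (fun w => f (c * w)%C) z (c * l)%C.
Proof.
  intros [p [Hp [Cp [d1 [D1 K1]]]]].
  exists (fun w => c * p (c * w)%C)%C. rewrite Hp. split; [reflexivity|].
  assert (Cc : ccont (fun w => c * w)%C z)
    by (apply ccont_mult; [apply ccont_const|apply ccont_id]).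
  split.
  { apply ccont_mult; [apply ccont_const|].
    apply (ccont_comp (fun w => c * w)%C p); auto. }
  destruct (Cc d1 D1) as [d2 [D2 K2]]. exists d2. split; auto.
  intros w Hw. rewrite (K1 _ (K2 w Hw)). ring.
Qed.

Lemma cder_eq (f : C -> C) (z l m : C) : l = m -> cder f z l -> cder f z m.
Proof. intros ->. auto. Qed.

Lemma cder_ext_loc (f g : C -> C) (r : R) (z l : C) :
  0 < r -> (forall w, Cmod (w - z)%C < r -> f w = g w) -> cder f z l -> cder g z l.
Proof.
  intros Hr Hfg [p [Hp [Cp [d1 [D1 K1]]]]].
  exists p. split; auto. split; auto. exists (Rmin r d1).
  split; [apply Rmin_glb_lt; auto|]. intros w Hw.
  rewrite <- !Hfg.
  - apply K1. eapply Rlt_le_trans; [exact Hw|apply Rmin_r].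
  - replace (z - z)%C with (RtoC 0) by ring. rewrite Cmod_0. auto.
  - eapply Rlt_le_trans; [exact Hw|apply Rmin_l].
Qed.

Lemma cder_C_derive (f : C -> C) (z l : C) : cder f z l -> C_derive f z = l.
Proof.
  intros [p [Hp [Cp [d1 [D1 K1]]]]]. apply is_C_derive_unique.
  split; [apply is_linear_scal_l|].
  intros x Hx.
  assert (Hxz : z = x).
  { exact (@is_filter_lim_locally_unique C_AbsRing (AbsRing_NormedModule C_AbsRing) z x Hx). }
  subst x. clear Hx. intros eps.
  destruct (Cp eps (cond_pos eps)) as [d2 [D2 K2]].
  exists (mkposreal _ (Rmin_glb_lt _ _ _ D1 D2)). intros w Hw.
  change (Cmod (w - z)%C < Rmin d1 d2) in Hw.
  change (Cmod ((f w - f z) - (w - z) * l)%C <= eps * Cmod (w - z)%C).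
  rewrite K1 by (eapply Rlt_le_trans; [exact Hw|apply Rmin_l]).
  replace (p w * (w - z) - (w - z) * l)%C with ((p w - p z) * (w - z))%C
    by (rewrite Hp; ring).
  rewrite Cmod_mult. apply Rmult_le_compat_r; [apply Cmod_ge_0|].
  left. apply K2. eapply Rlt_le_trans; [exact Hw|apply Rmin_r].
Qed.

(** The difference quotient, filled in with [l] at [z], is a continuous slope since the error
    divided by [|w - z|] is at most [K |w - z|]. Power series deliver their derivatives in this
    form. *)
Lemma cder_of_quadratic (f : C -> C) (z l : C) (r K : R) :
  0 < r ->
  (forall w, Cmod (w - z)%C < r ->
     Cmod (f w - f z - l * (w - z))%C <= K * Cmod (w - z)%C ^ 2) ->
  cder f z l.
Proof.
  intros Hr H.
  exists (fun w => if Ceq_dec w z then l else (f w - f z) / (w - z))%C.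
  split; [destruct (Ceq_dec z z); congruence|]. split.
  - intros e He.
    (* [K] has no assumed sign, and the radius divides by a positive majorant of it. *)
    assert (HK : 0 < Rabs K + 1) by (generalize (Rabs_pos K); lra).
    exists (Rmin r (e / (Rabs K + 1))). split.
    { apply Rmin_glb_lt; auto. apply Rdiv_lt_0_compat; auto. }
    intros w Hw. destruct (Ceq_dec z z) as [_|]; [|congruence].
    destruct (Ceq_dec w z) as [->|Hn].
    { replace (l - l)%C with (RtoC 0) by ring. rewrite Cmod_0; auto. }
    assert (Hn' : (w - z)%C <> 0%C).
    { intros E. apply Hn. replace w with ((w - z) + z)%C by ring. rewrite E. ring. }
    replace ((f w - f z) / (w - z) - l)%C
      with ((f w - f z - l * (w - z)) / (w - z))%C by (field; auto).
    rewrite Cmod_div by auto. assert (Hp := Cmod_neq_0 _ Hn').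
    specialize (H w (Rlt_le_trans _ _ _ Hw (Rmin_l _ _))).
    assert (Hw2 := Rlt_le_trans _ _ _ Hw (Rmin_r _ _)).
    set (m := Cmod (w - z)%C) in *.
    apply Rmult_lt_reg_r with m; auto.
    unfold Rdiv at 1. rewrite Rmult_assoc, Rinv_l, Rmult_1_r by lra.
    eapply Rle_lt_trans; [exact H|].
    replace (K * m ^ 2) with (K * m * m) by ring.
    apply Rmult_lt_compat_r; auto.
    apply Rle_lt_trans with ((Rabs K + 1) * m).
    + apply Rmult_le_compat_r; [lra|]. generalize (Rle_abs K); lra.
    + apply Rmult_lt_reg_r with (/ (Rabs K + 1)); [apply Rinv_0_lt_compat; auto|].
      replace ((Rabs K + 1) * m * / (Rabs K + 1)) with m by (field; lra). exact Hw2.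
  - exists r. split; auto. intros w Hw. destruct (Ceq_dec w z) as [->|Hn]; [ring|].
    field. intros E. apply Hn. replace w with ((w - z) + z)%C by ring. rewrite E. ring.
Qed.

(** * Power series *)

Lemma pow_n_Cpow (z : C) (k : nat) : @pow_n C_AbsRing z k = (z ^ k)%C.
Proof. induction k as [|k IH]; [reflexivity|]. simpl. rewrite IH. reflexivity. Qed.

Lemma is_series_eq {K : AbsRing} {V : NormedModule K} (u : nat -> V) (x y : V) :
  x = y -> is_series u x -> is_series u y.
Proof. intros ->. auto. Qed.

Lemma Cmod_series_le (u : nat -> C) (c : nat -> R) (l : C) (s : R) :
  @is_series C_AbsRing C_NormedModule u l ->
  (forall k, Cmod (u k) <= c k) -> is_series c s -> Cmod l <= s.
Proof.
  intros Hu Hc Hs.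
  assert (Hl : filterlim (fun n => Cmod (sum_n u n)) eventually (Rbar_locally (Cmod l))).
  { change (filterlim (fun n => @norm C_AbsRing C_NormedModule (sum_n u n)) eventually
      (locally (@norm C_AbsRing C_NormedModule l))).
    eapply filterlim_comp; [exact Hu|apply filterlim_norm]. }
  apply (is_lim_seq_le (fun n => Cmod (sum_n u n)) (sum_n c) (Finite (Cmod l)) (Finite s));
    [|exact Hl|exact Hs].
  intros n. unfold sum_n.
  eapply Rle_trans; [apply (@norm_sum_n_m C_AbsRing C_NormedModule)|].
  apply sum_n_m_le. intros k. apply Hc.
Qed.

(** Each term is a difference of two partial sums of a convergent, hence bounded, sequence. *)
Lemma pseries_bounded (a : nat -> C) (z l : C) :
  @is_pseries C_AbsRing C_NormedModule a z l ->
  exists M : R, forall k, Cmod (a k) * Cmod z ^ k <= M.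
Proof.
  intros H.
  set (u := fun k => @scal C_AbsRing C_NormedModule (@pow_n C_AbsRing z k) (a k)).
  destruct (@filterlim_bounded C_AbsRing C_NormedModule (sum_n u)) as [M HM].
  { exists l. exact H. }
  exists (M + M). intros k.
  assert (Hk : Cmod (u k) <= M + M).
  { destruct k as [|k].
    - assert (H0 := HM O). rewrite sum_O in H0. change (Cmod (u O) <= M) in H0.
      generalize (Cmod_ge_0 (u O)). lra.
    - assert (H1 := HM (S k)). assert (H0 := HM k). rewrite sum_Sn in H1.
      change (Cmod (sum_n u k + u (S k))%C <= M) in H1.
      change (Cmod (sum_n u k) <= M) in H0.
      replace (u (S k)) with ((sum_n u k + u (S k)) - sum_n u k)%C by ring.
      eapply Rle_trans; [apply Cmod_sub_le|]. lra. }
  change (Cmod (pow_n z k * a k)%C <= M + M) in Hk.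
  rewrite pow_n_Cpow, Cmod_mult, Cmod_pow in Hk. lra.
Qed.

Lemma CV_radius_ge (a : nat -> C) (s : R) (M : R) :
  (forall k, Cmod (a k) * s ^ k <= M) -> 0 <= s ->
  Rbar_le s (CV_radius (fun k => Cmod (a k))).
Proof.
  intros H Hs. apply CV_radius_bounded. exists M. intros n.
  rewrite Rabs_mult, (Rabs_pos_eq (Cmod _)), (Rabs_pos_eq (s ^ n)); auto.
  - apply pow_le; auto.
  - apply Cmod_ge_0.
Qed.

(* The right-hand sides are [k (k - 1) rho^(k-2)], shifted to avoid truncated subtraction. *)
Lemma Cpow_quadratic (w z : C) (rho : R) (k : nat) :
  Cmod w <= rho -> Cmod z <= rho ->
  Cmod (w ^ (S (S k)) - z ^ (S (S k)) - INR (S (S k)) * z ^ (S k) * (w - z))%C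
    <= INR (S k) * INR (S (S k)) * rho ^ k * Cmod (w - z)%C ^ 2.
Proof.
  intros Hw Hz. assert (Hr : 0 <= rho) by (generalize (Cmod_ge_0 w); lra).
  induction k as [|k IH].
  - replace (w ^ 2 - z ^ 2 - INR 2 * z ^ 1 * (w - z))%C with ((w - z) ^ 2)%C.
    + rewrite Cmod_pow. simpl. generalize (pow2_ge_0 (Cmod (w - z)%C)). simpl. lra.
    + simpl INR. rewrite RtoC_plus. ring.
  - set (D := (w ^ (S (S k)) - z ^ (S (S k)) - INR (S (S k)) * z ^ (S k) * (w - z))%C) in *.
    replace (w ^ (S (S (S k))) - z ^ (S (S (S k))) - INR (S (S (S k))) * z ^ (S (S k)) * (w - z))%C
      with (w * D + INR (S (S k)) * z ^ (S k) * (w - z) ^ 2)%C.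
    2:{ unfold D. rewrite (S_INR (S (S k))), RtoC_plus. simpl Cpow. ring. }
    eapply Rle_trans; [apply Cmod_triangle|]. rewrite !Cmod_mult, !Cmod_pow, Cmod_R.
    rewrite (Rabs_pos_eq (INR _)) by apply pos_INR.
    set (m := Cmod (w - z)%C) in *. assert (Hm : 0 <= m ^ 2) by apply pow2_ge_0.
    assert (H1 : Cmod w * Cmod D <= rho * (INR (S k) * INR (S (S k)) * rho ^ k * m ^ 2)).
    { apply Rmult_le_compat; auto using Cmod_ge_0. }
    assert (H2 : Cmod z ^ S k <= rho ^ S k).
    { apply pow_incr. split; auto using Cmod_ge_0. }
    assert (H3 : INR (S (S k)) * Cmod z ^ S k * m ^ 2 <= INR (S (S k)) * rho ^ S k * m ^ 2).
    { apply Rmult_le_compat_r; auto. apply Rmult_le_compat_l; auto using pos_INR. }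
    eapply Rle_trans; [apply Rplus_le_compat; [exact H1|exact H3]|].
    assert (H4 : 0 <= rho ^ S k * m ^ 2) by (apply Rmult_le_pos; auto; apply pow_le; auto).
    rewrite (S_INR (S (S k))), (S_INR (S k)).
    replace (rho * (INR (S k) * (INR (S k) + 1) * rho ^ k * m ^ 2) + (INR (S k) + 1) * rho ^ S k * m ^ 2)
      with ((INR (S k) + 1) * (INR (S k) + 1) * (rho ^ S k * m ^ 2)) by (simpl; ring).
    replace ((INR (S k) + 1) * (INR (S k) + 1 + 1) * rho ^ S k * m ^ 2)
      with ((INR (S k) + 1) * (INR (S k) + 1 + 1) * (rho ^ S k * m ^ 2)) by ring.
    apply Rmult_le_compat_r; auto. generalize (pos_INR (S k)). nra.
Qed.

(** By [Cpow_quadratic] the linearization error is dominated termwise by the twice derived series of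
    moduli at a radius [rho], so [cder_of_quadratic] applies with the sum of that series as its
    constant. *)
Lemma pseries_cder (f : C -> C) (z0 : C) (a : nat -> C) (r : R) :
  (forall z, Cmod (z - z0)%C < r ->
     @is_pseries C_AbsRing C_NormedModule a (z - z0)%C (f z)) ->
  forall z, Cmod (z - z0)%C < r -> exists l,
    @is_pseries C_AbsRing C_NormedModule (fun k => INR (S k) * a (S k))%C (z - z0)%C l /\
    cder f z l.
Proof.
  intros H z Hz.
  (* Boundedness of the terms at radius [s] gives absolute convergence at the smaller radius [rho],
     also for the first two derived series; points close to [z] stay within [rho] of [z0]. *)
  set (rho := (Cmod (z - z0)%C + r) / 2). set (s := (rho + r) / 2).
  assert (Hm := Cmod_ge_0 (z - z0)%C).
  assert (Hrho : Cmod (z - z0)%C < rho < s /\ s < r) by (unfold s, rho; lra).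
  assert (Hsm : Cmod (RtoC s) = s) by (rewrite Cmod_R; apply Rabs_pos_eq; lra).
  destruct (pseries_bounded a (RtoC s) (f (z0 + s)%C)) as [M HM].
  { replace (RtoC s) with ((z0 + s) - z0)%C at 1 by ring. apply H.
    replace ((z0 + s) - z0)%C with (RtoC s) by ring. lra. }
  rewrite Hsm in HM.
  assert (Hcv : Rbar_lt rho (CV_radius (fun k => Cmod (a k)))).
  { eapply Rbar_lt_le_trans; [|apply (CV_radius_ge a s M HM); lra]. simpl; lra. }
  set (b := fun k => Cmod (a k)) in *.
  assert (Habs : Rabs rho = rho) by (apply Rabs_pos_eq; lra).
  assert (E1 : ex_series (fun k => INR (S k) * b (S k) * rho ^ k)).
  { eapply ex_series_ext; [|apply (CV_disk_inside (PS_derive b) rho)].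
    - intros k. unfold PS_derive. apply Rabs_pos_eq. repeat apply Rmult_le_pos;
      [apply pos_INR|apply Cmod_ge_0|apply pow_le; lra].
    - rewrite CV_radius_derive, Habs. exact Hcv. }
  assert (E2 : ex_series (fun k => INR (S k) * INR (S (S k)) * b (S (S k)) * rho ^ k)).
  { eapply ex_series_ext; [|apply (CV_disk_inside (PS_derive (PS_derive b)) rho)].
    - intros k. unfold PS_derive. rewrite Rabs_pos_eq; [unfold b; match goal with |- ?x = ?y => change (@eq R x y) end; ring|].
      repeat apply Rmult_le_pos;
      [apply pos_INR|apply pos_INR|apply Cmod_ge_0|apply pow_le; lra].
    - rewrite !CV_radius_derive, Habs. exact Hcv. }
  set (w := (z - z0)%C) in *.
  assert (Ex : @ex_series C_AbsRing C_NormedModule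
     (fun k => @scal C_AbsRing C_NormedModule (@pow_n C_AbsRing w k) (INR (S k) * a (S k))%C)).
  { apply (@ex_series_le C_AbsRing C_CompleteNormedModule) with (2 := E1).
    intros k. change (Cmod (pow_n w k * (INR (S k) * a (S k)))%C <= INR (S k) * b (S k) * rho ^ k).
    rewrite pow_n_Cpow, !Cmod_mult, Cmod_pow, Cmod_R, (Rabs_pos_eq (INR _)) by apply pos_INR.
    fold (b (S k)). rewrite Rmult_comm.
    apply Rmult_le_compat_l; [apply Rmult_le_pos; [apply pos_INR|apply Cmod_ge_0]|].
    apply pow_incr; split; lra. }
  destruct Ex as [l Hl]. exists l. split; [exact Hl|].
  destruct E2 as [K HK].
  apply cder_of_quadratic with (r := rho - Cmod w) (K := K); [lra|].
  intros y Hy. set (v := (y - z0)%C).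
  assert (Hv : Cmod v < rho).
  { unfold v. replace (y - z0)%C with ((y - z) + w)%C by (unfold w; ring).
    eapply Rle_lt_trans; [apply Cmod_triangle|]. lra. }
  assert (Sy := H y). fold v in Sy. specialize (Sy ltac:(lra)).
  assert (Sz := H z Hz). fold w in Sz.
  assert (Hyz : (y - z = v - w)%C) by (unfold v, w; ring). rewrite Hyz.
  (* shifting the derived series by one turns [l * (v - w)] into a series
     comparable term by term with those of [f y] and [f z] *)
  assert (Sl : @is_series C_AbsRing C_NormedModule
     (fun k => match k with O => RtoC 0 | S j => (w ^ j * (INR (S j) * a (S j)) * (v - w))%C end)
     (l * (v - w))%C).
  { apply is_series_decr_1.
    apply is_series_eq with ((v - w) * l)%C.
    { change ((v - w) * l = l * (v - w) + - (0))%C. ring. }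
    eapply is_series_ext; [|apply (is_series_scal_l (K := C_AbsRing) (v - w)%C _ _ Hl)].
    intros k. change ((v - w) * (pow_n w k * (INR (S k) * a (S k))) =
       w ^ k * (INR (S k) * a (S k)) * (v - w))%C. rewrite pow_n_Cpow. ring. }
  assert (Sd := is_series_minus _ _ _ _ (is_series_minus _ _ _ _ Sy Sz) Sl).
  (* The constant and linear terms have no linearization error, so the dominating series starts at
     index 2. *)
  set (c := fun k => match k with S (S j) => INR (S j) * INR (S (S j)) * b (S (S j)) * rho ^ j
                | _ => 0 end).
  assert (Sc : is_series c K).
  { apply is_series_decr_1, is_series_decr_1. apply is_series_eq with K.
    { change (K = K + - 0 + - 0). rewrite Ropp_0, !Rplus_0_r. reflexivity. }
    exact HK. }
  apply (is_series_scal_r (Cmod (v - w)%C ^ 2)) in Sc.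
  eapply (Cmod_series_le _ _ _ _ Sd); [|exact Sc].
  intros k.
  change (Cmod ((@pow_n C_AbsRing v k * a k - @pow_n C_AbsRing w k * a k) -
     match k with O => RtoC 0 | S j => (w ^ j * (INR (S j) * a (S j)) * (v - w))%C end)%C
     <= c k * Cmod (v - w)%C ^ 2).
  rewrite (pow_n_Cpow v k), (pow_n_Cpow w k). destruct k as [|[|k]].
  - match goal with |- Cmod ?x <= _ => replace x with (RtoC 0) by (simpl; ring) end.
    rewrite Cmod_0. unfold c. lra.
  - match goal with |- Cmod ?x <= _ =>
      replace x with (RtoC 0) by (cbn [Cpow INR]; ring) end.
    rewrite Cmod_0. unfold c. lra.
  - replace (v ^ S (S k) * a (S (S k)) - w ^ S (S k) * a (S (S k)) -
      w ^ S k * (INR (S (S k)) * a (S (S k))) * (v - w))%C with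
      (a (S (S k)) * (v ^ S (S k) - w ^ S (S k) - INR (S (S k)) * w ^ S k * (v - w)))%C by ring.
    rewrite Cmod_mult. fold (b (S (S k))).
    eapply Rle_trans; [apply Rmult_le_compat_l; [apply Cmod_ge_0|];
       apply (Cpow_quadratic v w rho k); lra|].
    unfold c. right. ring.
Qed.

Lemma disk_ball (z : C) : disk z -> forall w, Cmod (w - z)%C < 1 - Cmod z -> disk w.
Proof.
  intros Hz w Hw. unfold disk in *. assert (H := Cmod_sub_ge w z). lra.
Qed.

Lemma analytic_cder (f : C -> C) (z : C) :
  analytic_on_disk f -> disk z -> cder f z (C_derive f z).
Proof.
  intros Hf Hz. destruct (Hf z Hz) as [a [r [Hr H]]].
  destruct (pseries_cder f z a r H z) as [l [_ Hl]].
  { replace (z - z)%C with (RtoC 0) by ring. rewrite Cmod_0. auto. }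
  rewrite (cder_C_derive _ _ _ Hl). exact Hl.
Qed.

Lemma analytic_C_derive (f : C -> C) :
  analytic_on_disk f -> analytic_on_disk (C_derive f).
Proof.
  intros Hf z Hz. destruct (Hf z Hz) as [a [r [Hr H]]].
  exists (fun k => INR (S k) * a (S k))%C, r. split; auto. intros w Hw.
  destruct (pseries_cder f z a r H w Hw) as [l [Sl Hl]].
  rewrite (cder_C_derive _ _ _ Hl). exact Sl.
Qed.

(** * Complex functions of a real variable *)

Definition rder (F : R -> C) (t : R) (l : C) : Prop :=
  is_derive (fun s => Re (F s)) t (Re l) /\ is_derive (fun s => Im (F s)) t (Im l).

Lemma real_caratheodory (u : R -> R) (t l : R) :
  is_derive u t l <-> exists q : R -> R, q t = l /\
    (forall e, 0 < e -> exists d, 0 < d /\ forall s, Rabs (s - t) < d -> Rabs (q s - l) < e) /\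
    exists d, 0 < d /\ forall s, Rabs (s - t) < d -> u s - u t = q s * (s - t).
Proof.
  rewrite is_derive_Reals. split.
  - intros H. exists (fun s => if Req_EM_T s t then l else (u s - u t) / (s - t)).
    split; [destruct (Req_EM_T t t); congruence|]. split.
    + intros e He. destruct (H e He) as [d Hd]. exists d. split; [apply cond_pos|].
      intros s Hs. destruct (Req_EM_T s t) as [->|Hn].
      { unfold Rminus. rewrite Rplus_opp_r, Rabs_R0; auto. }
      specialize (Hd (s - t)). replace (t + (s - t)) with s in Hd by ring.
      apply Hd; auto. lra.
    + exists 1. split; [lra|]. intros s _. destruct (Req_EM_T s t) as [->|Hn]; [ring|].
      field. lra.
  - intros [q [Hq [Cq [d0 [D0 K0]]]]] e He. destruct (Cq e He) as [d [D K]].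
    exists (mkposreal _ (Rmin_glb_lt _ _ _ D0 D)). simpl. intros h Hn Hh.
    specialize (K0 (t + h)). specialize (K (t + h)).
    replace (t + h - t) with h in * by ring.
    rewrite K0 by (eapply Rlt_le_trans; [exact Hh|apply Rmin_l]).
    replace (q (t + h) * h / h) with (q (t + h)) by (field; auto).
    apply K. eapply Rlt_le_trans; [exact Hh|apply Rmin_r].
Qed.

Lemma Re_minus (x y : C) : Re (x - y)%C = Re x - Re y.
Proof. reflexivity. Qed.
Lemma Im_minus (x y : C) : Im (x - y)%C = Im x - Im y.
Proof. reflexivity. Qed.

Lemma im_le_Cmod (z : C) : Rabs (Im z) <= Cmod z.
Proof.
  eapply Rle_trans; [|apply Rmax_Cmod]. apply Rmax_r.
Qed.

Lemma Cmod_lt_of_parts (z : C) (e : R) :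
  Rabs (Re z) < e -> Rabs (Im z) < e -> Cmod z < 2 * e.
Proof.
  intros H1 H2. replace z with (RtoC (Re z) + Ci * RtoC (Im z))%C
    by (destruct z; unfold Cplus, Cmult, Ci; simpl; f_equal; ring).
  eapply Rle_lt_trans; [apply Cmod_triangle|].
  rewrite Cmod_mult, Cmod_Ci, !Cmod_R. lra.
Qed.

Lemma rder_comp (f : C -> C) (p : R -> C) (t : R) (l m : C) :
  rder p t m -> cder f (p t) l -> rder (fun s => f (p s)) t (l * m)%C.
Proof.
  intros [H1 H2] [g [Hg [Cg [d0 [D0 K0]]]]].
  apply real_caratheodory in H1. apply real_caratheodory in H2.
  destruct H1 as [q1 [Q1 [C1 [e1 [E1 L1]]]]].
  destruct H2 as [q2 [Q2 [C2 [e2 [E2 L2]]]]].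
  set (Q := fun s => (q1 s, q2 s) : C).
  assert (HQ : forall s, Rabs (s - t) < Rmin e1 e2 -> (p s - p t = Q s * RtoC (s - t))%C).
  { intros s Hs.
    specialize (L1 s (Rlt_le_trans _ _ _ Hs (Rmin_l _ _))).
    specialize (L2 s (Rlt_le_trans _ _ _ Hs (Rmin_r _ _))).
    rewrite <- Re_minus in L1. rewrite <- Im_minus in L2.
    apply injective_projections; simpl; unfold Re, Im in *; simpl in *; lra. }
  assert (CQ : forall e, 0 < e -> exists d, 0 < d /\ forall s, Rabs (s - t) < d ->
     Cmod (Q s - m)%C < e).
  { intros e He. destruct (C1 (e/2)) as [a1 [A1 B1]]; [lra|].
    destruct (C2 (e/2)) as [a2 [A2 B2]]; [lra|].
    exists (Rmin a1 a2). split; [apply Rmin_glb_lt; auto|]. intros s Hs.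
    replace e with (2 * (e / 2)) by field. apply Cmod_lt_of_parts.
    - apply B1. eapply Rlt_le_trans; [exact Hs|apply Rmin_l].
    - apply B2. eapply Rlt_le_trans; [exact Hs|apply Rmin_r]. }
  assert (Cp : forall e, 0 < e -> exists d, 0 < d /\ forall s, Rabs (s - t) < d ->
     Cmod (p s - p t)%C < e).
  { intros e He. destruct (CQ 1) as [a1 [A1 B1]]; [lra|].
    assert (HB : 0 < Cmod m + 1) by (generalize (Cmod_ge_0 m); lra).
    exists (Rmin (Rmin e1 e2) (Rmin a1 (e / (Cmod m + 1)))). split.
    { repeat apply Rmin_glb_lt; auto. apply Rdiv_lt_0_compat; auto. }
    intros s Hs.
    assert (Hs1 := Rlt_le_trans _ _ _ Hs (Rmin_l _ _)).
    assert (Hs2 := Rlt_le_trans _ _ _ Hs (Rmin_r _ _)).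
    rewrite HQ, Cmod_mult, Cmod_R by auto.
    specialize (B1 s (Rlt_le_trans _ _ _ Hs2 (Rmin_l _ _))).
    assert (Hs3 := Rlt_le_trans _ _ _ Hs2 (Rmin_r _ _)).
    assert (Cmod (Q s) <= Cmod m + 1) by (generalize (Cmod_sub_ge (Q s) m); lra).
    apply Rle_lt_trans with ((Cmod m + 1) * Rabs (s - t)).
    - apply Rmult_le_compat_r; auto. apply Rabs_pos.
    - replace e with ((Cmod m + 1) * (e / (Cmod m + 1))) by (field; lra).
      apply Rmult_lt_compat_l; auto. }
  (* The slope of a composite is the product of the slopes; the real and imaginary parts of [G] are
     the two real slopes wanted. *)
  set (G := fun s => (g (p s) * Q s)%C).
  assert (CG : forall e, 0 < e -> exists d, 0 < d /\ forall s, Rabs (s - t) < d ->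
     Cmod (G s - l * m)%C < e).
  { intros e He.
    assert (HB : 0 < Cmod m + 1) by (generalize (Cmod_ge_0 m); lra).
    assert (HL : 0 < Cmod l + 1) by (generalize (Cmod_ge_0 l); lra).
    destruct (CQ 1) as [a1 [A1 B1]]; [lra|].
    destruct (CQ (e / (2 * (Cmod l + 1)))) as [a2 [A2 B2]]; [apply Rdiv_lt_0_compat; lra|].
    destruct (Cg (e / (2 * (Cmod m + 1)))) as [b [B Hb]]; [apply Rdiv_lt_0_compat; lra|].
    destruct (Cp b B) as [a3 [A3 B3]].
    exists (Rmin a1 (Rmin a2 a3)). split; [repeat apply Rmin_glb_lt; auto|].
    intros s Hs.
    assert (Hs2 := Rlt_le_trans _ _ _ Hs (Rmin_r _ _)).
    specialize (B1 s (Rlt_le_trans _ _ _ Hs (Rmin_l _ _))).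
    specialize (B2 s (Rlt_le_trans _ _ _ Hs2 (Rmin_l _ _))).
    specialize (B3 s (Rlt_le_trans _ _ _ Hs2 (Rmin_r _ _))).
    specialize (Hb _ B3). rewrite Hg in Hb.
    unfold G. replace (g (p s) * Q s - l * m)%C
      with ((g (p s) - l) * Q s + l * (Q s - m))%C by ring.
    eapply Rle_lt_trans; [apply Cmod_triangle|]. rewrite !Cmod_mult.
    assert (X : Cmod (Q s) <= Cmod m + 1) by (generalize (Cmod_sub_ge (Q s) m); lra).
    assert (Y1 : Cmod (g (p s) - l)%C * Cmod (Q s) <= e / (2 * (Cmod m + 1)) * (Cmod m + 1)).
    { apply Rmult_le_compat; auto using Cmod_ge_0. lra. }
    assert (Y2 : Cmod l * Cmod (Q s - m)%C < (Cmod l + 1) * (e / (2 * (Cmod l + 1)))).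
    { apply Rle_lt_trans with ((Cmod l + 1) * Cmod (Q s - m)%C).
      - apply Rmult_le_compat_r; [apply Cmod_ge_0|lra].
      - apply Rmult_lt_compat_l; auto. }
    replace (e / (2 * (Cmod m + 1)) * (Cmod m + 1)) with (e / 2) in Y1 by (field; lra).
    replace ((Cmod l + 1) * (e / (2 * (Cmod l + 1)))) with (e / 2) in Y2 by (field; lra).
    lra. }
  destruct (Cp d0 D0) as [a [A B]].
  assert (HF : forall s, Rabs (s - t) < Rmin a (Rmin e1 e2) ->
     (f (p s) - f (p t) = G s * RtoC (s - t))%C).
  { intros s Hs. rewrite K0.
    - rewrite HQ; [unfold G; ring|]. eapply Rlt_le_trans; [exact Hs|apply Rmin_r].
    - apply B. eapply Rlt_le_trans; [exact Hs|apply Rmin_l]. }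
  assert (Gt : G t = (l * m)%C).
  { unfold G, Q. rewrite Hg, Q1, Q2. destruct m; reflexivity. }
  split; apply real_caratheodory; [exists (fun s => Re (G s))|exists (fun s => Im (G s))];
    (split; [rewrite Gt; reflexivity|]; split;
     [intros e He; destruct (CG e He) as [d [D K]]; exists d; split; auto; intros s Hs;
      eapply Rle_lt_trans; [|apply (K s Hs)]
     |exists (Rmin a (Rmin e1 e2)); split; [repeat apply Rmin_glb_lt; auto|];
      intros s Hs]).
  - rewrite <- Re_minus. apply re_le_Cmod.
  - rewrite <- Re_minus, (HF s Hs). unfold Re; simpl; ring.
  - rewrite <- Im_minus. apply im_le_Cmod.
  - rewrite <- Im_minus, (HF s Hs). unfold Im; simpl; ring.
Qed.

Lemma rder_affine (z w : C) (t : R) : rder (fun s => z + s * w)%C t w.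
Proof.
  split; unfold Re, Im; simpl; auto_derive; auto; ring.
Qed.

Lemma rder_ray (f : C -> C) (c : C) (t : R) (l : C) :
  cder f (c * t)%C l -> rder (fun s => f (c * s)%C) t (c * l)%C.
Proof.
  intros H. rewrite (Cmult_comm c l).
  apply (rder_comp f (fun s => c * s)%C t l c); [|exact H].
  split; unfold Re, Im; simpl; auto_derive; auto; ring.
Qed.

Lemma is_derive_nondecreasing (g dg : R -> R) (a b : R) : a <= b ->
  (forall t, a <= t <= b -> is_derive g t (dg t)) ->
  (forall t, a <= t <= b -> 0 <= dg t) -> g a <= g b.
Proof.
  intros Hab Hd Hp.
  destruct (MVT_gen g a b dg) as [c [Hc E]].
  - intros x Hx. apply Hd. rewrite Rmin_left, Rmax_right in Hx by lra. lra.
  - intros x Hx. rewrite Rmin_left, Rmax_right in Hx by lra.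
    apply derivable_continuous_pt. exists (dg x). apply is_derive_Reals, Hd. lra.
  - rewrite Rmin_left, Rmax_right in Hc by lra.
    assert (0 <= dg c * (b - a)) by (apply Rmult_le_pos; [apply Hp|]; lra). lra.
Qed.

(** Project on the unit vector [(u1, u2)] in the direction of [F b - F a]: the projection of [F]
    grows no faster than [B], by Cauchy-Schwarz, and its total increment is the modulus on the
    left. *)
Lemma mean_value_ineq (F dF : R -> C) (B dB : R -> R) (a b : R) : a <= b ->
  (forall t, a <= t <= b -> rder F t (dF t)) ->
  (forall t, a <= t <= b -> is_derive B t (dB t)) ->
  (forall t, a <= t <= b -> Cmod (dF t) <= dB t) ->
  Cmod (F b - F a)%C <= B b - B a.
Proof.
  intros Hab HF HB Hle.
  destruct (Ceq_dec (F b - F a)%C 0%C) as [E|Hn].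
  { rewrite E, Cmod_0.
    enough (B a <= B b) by lra.
    apply is_derive_nondecreasing with dB; auto.
    intros t Ht. eapply Rle_trans; [apply Cmod_ge_0|apply Hle; auto]. }
  set (D := (F b - F a)%C) in *. assert (Hm := Cmod_neq_0 _ Hn). set (m := Cmod D) in *.
  set (u1 := Re D / m). set (u2 := Im D / m).
  assert (Hm2 : m * m = Re D * Re D + Im D * Im D).
  { generalize (Cmod2_alt D). fold m. simpl. lra. }
  assert (H := is_derive_nondecreasing (fun t => B t - (u1 * Re (F t) + u2 * Im (F t)))
    (fun t => dB t - (u1 * Re (dF t) + u2 * Im (dF t))) a b Hab).
  assert (K : u1 * (Re (F b) - Re (F a)) + u2 * (Im (F b) - Im (F a)) = m).
  { rewrite <- Re_minus, <- Im_minus. fold D. unfold u1, u2.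
    apply Rmult_eq_reg_r with m; [|lra]. rewrite Hm2. field. lra. }
  lapply H; [clear H; intros H; lapply H|].
  - intros; lra.
  - intros t Ht. specialize (Hle t Ht).
    assert (X : u1 * Re (dF t) + u2 * Im (dF t) <= Cmod (dF t)).
    { assert (Y : u1 * u1 + u2 * u2 = 1).
      { unfold u1, u2. apply Rmult_eq_reg_r with (m * m); [|nra]. rewrite Hm2 at 2.
        field. lra. }
      apply Rsqr_incr_0_var; [|apply Cmod_ge_0]. unfold Rsqr.
      replace (Cmod (dF t) * Cmod (dF t)) with (Cmod (dF t) ^ 2) by ring.
      rewrite Cmod2_alt.
      generalize (pow2_ge_0 (u1 * Im (dF t) - u2 * Re (dF t))).
      replace (Re (dF t) ^ 2 + Im (dF t) ^ 2)
        with ((u1 * u1 + u2 * u2) * (Re (dF t) ^ 2 + Im (dF t) ^ 2)) by (rewrite Y; ring).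
      simpl. lra. }
    lra.
  - intros t Ht. destruct (HF t Ht) as [H1 H2]. specialize (HB t Ht).
    apply (is_derive_minus (K := R_AbsRing) (V := R_NormedModule)); [exact HB|].
    apply (is_derive_plus (K := R_AbsRing) (V := R_NormedModule)).
    + apply (is_derive_scal (fun s => Re (F s)) t u1 _ H1).
    + apply (is_derive_scal (fun s => Im (F s)) t u2 _ H2).
Qed.

(** * The radial Riccati equation *)

(* The modulus [n] and the logarithmic derivative [p + i q] of a zero-free
   function whose Schwarzian has real part [s], along a radius. *)
Definition radial_ode (T : R) (n p q s : R -> R) : Prop :=
  T < 1 /\ n 0 = 1 /\ p 0 = 0 /\
  forall t, 0 <= t <= T -> 0 < n t /\ is_derive n t (p t * n t) /\
    is_derive p t (s t + (p t ^ 2 - q t ^ 2) / 2) /\ s t <= 2 / (1 - t ^ 2) ^ 2.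

(** With [n = |A|] this is [|u| / y], where [u = A^(-1/2)] and [y = sqrt(1 - t^2)] solves the
    extremal equation [y'' + y / (1 - t^2)^2 = 0]. *)
Definition phi (n : R -> R) (t : R) : R := / sqrt (n t * (1 - t ^ 2)).

(** The derivative of [phi] with respect to the hyperbolic parameter [atanh t], that is
    [(1 - t^2) phi']. *)
Definition slope (n p : R -> R) (t : R) : R :=
  (1 - t ^ 2) * phi n t * (- p t / 2 + t / (1 - t ^ 2)).

Lemma one_minus_sq_pos (t T : R) : 0 <= t <= T -> T < 1 -> 0 < 1 - t ^ 2.
Proof. nra. Qed.

Lemma phi_pos (n : R -> R) (t : R) : 0 < n t -> 0 < 1 - t ^ 2 -> 0 < phi n t.
Proof.
  intros H1 H2. apply Rinv_0_lt_compat, sqrt_lt_R0, Rmult_lt_0_compat; auto.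
Qed.

Lemma phi_sqr (n : R -> R) (t : R) : 0 < n t -> 0 < 1 - t ^ 2 ->
  phi n t ^ 2 * (n t * (1 - t ^ 2)) = 1.
Proof.
  intros H1 H2. assert (H : 0 < n t * (1 - t ^ 2)) by (apply Rmult_lt_0_compat; auto).
  unfold phi. assert (Hs := sqrt_lt_R0 _ H).
  rewrite <- (sqrt_sqrt (n t * (1 - t ^ 2))) at 2 by lra. field. lra.
Qed.

Lemma is_derive_phi (T : R) (n p q s : R -> R) (t : R) :
  radial_ode T n p q s -> 0 <= t <= T ->
  is_derive (phi n) t (slope n p t / (1 - t ^ 2)).
Proof.
  intros [HT [_ [_ H]]] Ht. destruct (H t Ht) as [Hn [Dn _]].
  assert (H1 := one_minus_sq_pos t T Ht HT).
  assert (H2 : 0 < n t * (1 - t ^ 2)) by (apply Rmult_lt_0_compat; auto).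
  assert (Hs := sqrt_lt_R0 _ H2).
  unfold slope, phi. auto_derive.
  - replace (n t * (1 + - (t * (t * 1)))) with (n t * (1 - t ^ 2)) by ring.
    split; [exists (p t * n t); exact Dn|]. split; [exact H2|]. split; [lra|exact I].
  - replace (Derive (fun x => n x) t) with (p t * n t)
      by (symmetry; apply is_derive_unique; exact Dn).
    replace (n t * (1 + - (t * (t * 1)))) with (n t * (1 - t ^ 2)) by ring.
    set (r := sqrt (n t * (1 - t ^ 2))) in *.
    assert (E : r * r = n t * (1 - t ^ 2)) by (apply sqrt_sqrt; lra).
    assert (En : n t = r * r / (1 - t ^ 2)) by (rewrite E; field; lra).
    rewrite En. field. split; [lra|]. apply Rgt_not_eq; auto.
Qed.

(** All terms in [p] cancel. What remains is the gap [1/(1 - t^2)^2 - s/2], nonnegative by the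
    Nehari bound, and [q^2/4], where [q] is the rate of change of the argument. This makes [phi]
    convex in the hyperbolic parameter. *)
Lemma is_derive_slope (T : R) (n p q s : R -> R) (t : R) :
  radial_ode T n p q s -> 0 <= t <= T ->
  is_derive (slope n p) t
    (phi n t * (1 - t ^ 2) * (q t ^ 2 / 4 + 1 / (1 - t ^ 2) ^ 2 - s t / 2)).
Proof.
  intros HO Ht. assert (Dphi := is_derive_phi T n p q s t HO Ht).
  destruct HO as [HT [_ [_ H]]]. destruct (H t Ht) as [Hn [_ [Dp _]]].
  assert (H1 := one_minus_sq_pos t T Ht HT).
  unfold slope. auto_derive.
  - split; [eexists; exact Dphi|]. split; [eexists; exact Dp|]. split; [|exact I].
    simpl in *; lra.
  - replace (Derive (fun x => phi n x) t) with (slope n p t / (1 - t ^ 2))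
      by (symmetry; apply is_derive_unique; exact Dphi).
    replace (Derive (fun x => p x) t) with (s t + (p t ^ 2 - q t ^ 2) / 2)
      by (symmetry; apply is_derive_unique; exact Dp). unfold slope.
    field. simpl in *; lra.
Qed.

(** Keeping the [q^2] term, and not merely the sign, is what later lets a small slope control the
    argument of [g']. *)
Lemma slope_derivative_ge (T : R) (n p q s : R -> R) (t : R) :
  radial_ode T n p q s -> 0 <= t <= T ->
  phi n t * (1 - t ^ 2) * (q t ^ 2 / 4) <=
  phi n t * (1 - t ^ 2) * (q t ^ 2 / 4 + 1 / (1 - t ^ 2) ^ 2 - s t / 2).
Proof.
  intros [HT [_ [_ H]]] Ht. destruct (H t Ht) as [Hn [_ [_ Hs]]].
  assert (H1 := one_minus_sq_pos t T Ht HT).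
  apply Rmult_le_compat_l; [left; apply Rmult_lt_0_compat; auto using phi_pos|].
  unfold Rdiv in *. lra.
Qed.

Lemma slope_increasing (T : R) (n p q s : R -> R) (a b : R) :
  radial_ode T n p q s -> 0 <= a <= b -> b <= T -> slope n p a <= slope n p b.
Proof.
  intros HO Ha Hb.
  eapply is_derive_nondecreasing; [lra| |].
  - intros t Ht. eapply is_derive_slope; [exact HO|lra].
  - intros t Ht. cbv beta.
    eapply Rle_trans; [|apply (slope_derivative_ge T n p q s t HO); lra].
    destruct HO as [HT [_ [_ H]]]. destruct (H t) as [Hn _]; [lra|].
    assert (H1 : 0 < 1 - t ^ 2) by (apply one_minus_sq_pos with T; lra).
    apply Rmult_le_pos; [left; apply Rmult_lt_0_compat; auto using phi_pos|].
    generalize (pow2_ge_0 (q t)); lra.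
Qed.

Lemma slope_ge_0 (T : R) (n p q s : R -> R) (t : R) :
  radial_ode T n p q s -> 0 <= t <= T -> 0 <= slope n p t.
Proof.
  intros HO Ht. replace 0 with (slope n p 0).
  - eapply slope_increasing; [exact HO| |]; lra.
  - destruct HO as [_ [_ [Hp _]]]. unfold slope. rewrite Hp. field.
Qed.

Lemma phi_increasing (T : R) (n p q s : R -> R) (a b : R) :
  radial_ode T n p q s -> 0 <= a <= b -> b <= T -> phi n a <= phi n b.
Proof.
  intros HO Ha Hb.
  eapply is_derive_nondecreasing; [lra| |].
  - intros t Ht. eapply is_derive_phi; [exact HO|lra].
  - intros t Ht. cbv beta. apply Rmult_le_pos; [eapply slope_ge_0; [exact HO|lra]|].
    left. apply Rinv_0_lt_compat. destruct HO as [HT _].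
    apply one_minus_sq_pos with T; lra.
Qed.

Lemma phi_ge_1 (T : R) (n p q s : R -> R) (t : R) :
  radial_ode T n p q s -> 0 <= t <= T -> 1 <= phi n t.
Proof.
  intros HO Ht. replace 1 with (phi n 0).
  - eapply phi_increasing; [exact HO| |]; lra.
  - destruct HO as [_ [Hn _]]. unfold phi. rewrite Hn.
    replace (1 * (1 - 0 ^ 2)) with 1 by ring. rewrite sqrt_1. field.
Qed.

(** The left side is [phi^(-2)], and [phi >= 1]. *)
Lemma modulus_le (T : R) (n p q s : R -> R) (t : R) :
  radial_ode T n p q s -> 0 <= t <= T -> n t * (1 - t ^ 2) <= 1.
Proof.
  intros HO Ht. assert (H1 := phi_ge_1 _ _ _ _ _ t HO Ht).
  destruct HO as [HT [_ [_ H]]]. destruct (H t Ht) as [Hn _].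
  assert (H2 := one_minus_sq_pos t T Ht HT).
  assert (H3 : 0 < n t * (1 - t ^ 2)) by (apply Rmult_lt_0_compat; auto).
  assert (H4 := phi_sqr n t Hn H2). assert (1 <= phi n t ^ 2) by nra. nra.
Qed.

(** * Growth and near-extremality derived from convexity *)

Definition atanh (t : R) : R := / 2 * ln ((1 + t) / (1 - t)).

Lemma is_derive_atanh (t : R) : -1 < t < 1 -> is_derive atanh t (1 / (1 - t ^ 2)).
Proof.
  intros Ht. unfold atanh. auto_derive.
  - split; [lra|]. split; [|exact I]. apply Rmult_lt_0_compat; [lra|].
    apply Rinv_0_lt_compat; lra.
  - field. repeat split; try lra. nra.
Qed.

Lemma atanh_0 : atanh 0 = 0.
Proof. unfold atanh. replace ((1 + 0) / (1 - 0)) with 1 by field. rewrite ln_1. ring. Qed.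

(* Where the slope is at least [e], the primitive of [n] is dominated by [-1/(e phi)]. *)
Lemma primitive_le (T : R) (n p q s : R -> R) (F A : R -> C) (r0 e : R) :
  radial_ode T n p q s -> 0 <= r0 < 1 -> 0 <= T -> 0 < e -> F 0 = 0%C ->
  (forall t, 0 <= t <= T -> rder F t (A t)) ->
  (forall t, 0 <= t <= T -> Cmod (A t) <= n t) ->
  (r0 <= T -> e <= slope n p r0) ->
  Cmod (F T) <= atanh r0 + / e.
Proof.
  intros HO Hr0 HT0 He HF0 HF HA Hsl.
  assert (HT : T < 1) by apply HO.
  assert (Hn : forall t, 0 <= t <= T -> 0 < n t) by (intros t Ht; apply HO; auto).
  assert (Hle : 0 < / e) by (apply Rinv_0_lt_compat; auto).
  (* Up to [r0] only the general bound [n <= 1/(1 - t^2)] is available; it integrates to [atanh]. *)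
  assert (Hfirst : forall r, 0 <= r <= T -> Cmod (F r) <= atanh r).
  { intros r Hr. replace (F r) with (F r - F 0)%C by (rewrite HF0; ring).
    replace (atanh r) with (atanh r - atanh 0) by (rewrite atanh_0; ring).
    apply mean_value_ineq with (dF := A) (dB := fun t => 1 / (1 - t ^ 2)); [lra| | |].
    - intros t Ht. apply HF. lra.
    - intros t Ht. apply is_derive_atanh. lra.
    - intros t Ht. assert (Ht' : 0 <= t <= T) by lra.
      assert (H1 := one_minus_sq_pos t T Ht' HT).
      assert (H2 := modulus_le _ _ _ _ _ t HO Ht').
      eapply Rle_trans; [apply HA; lra|].
      apply Rmult_le_reg_r with (1 - t ^ 2); auto.
      replace (1 / (1 - t ^ 2) * (1 - t ^ 2)) with 1 by (field; lra). exact H2. }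
  destruct (Rle_lt_dec T r0) as [Hcase|Hcase].
  - assert (atanh T <= atanh r0).
    { eapply is_derive_nondecreasing; [exact Hcase| |].
      - intros t Ht. apply is_derive_atanh. lra.
      - intros t Ht. cbv beta. apply Rmult_le_pos; [lra|]. left.
        apply Rinv_0_lt_compat. nra. }
    generalize (Hfirst T). lra.
  (* Past [r0] the slope stays at least [e], and [n = 1/(phi^2 (1 - t^2))] is at most
     [phi' / (e phi^2)] because [phi' = slope / (1 - t^2)]. *)
  - assert (H : Cmod (F T - F r0)%C <= - / (e * phi n T) - - / (e * phi n r0)).
    { apply mean_value_ineq with (a := r0) (F := F) (dF := A) (B := fun t => - / (e * phi n t))
        (dB := fun t => slope n p t / (1 - t ^ 2) / (e * phi n t ^ 2)); [lra| | |].
      - intros t Ht. apply HF. lra.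
      - intros t Ht. assert (Ht' : 0 <= t <= T) by lra.
        assert (D := is_derive_phi _ _ _ _ _ t HO Ht').
        assert (Hp := phi_ge_1 _ _ _ _ _ t HO Ht').
        auto_derive.
        + split; [eexists; exact D|]. split; [|exact I].
          apply Rgt_not_eq, Rmult_lt_0_compat; lra.
        + replace (Derive (fun x => phi n x) t) with (slope n p t / (1 - t ^ 2))
            by (symmetry; apply is_derive_unique; exact D).
          field. assert (H1 := one_minus_sq_pos t T Ht' HT). repeat split; try lra.
      - intros t Ht. assert (Ht' : 0 <= t <= T) by lra.
        assert (H1 := one_minus_sq_pos t T Ht' HT).
        assert (Hp := phi_ge_1 _ _ _ _ _ t HO Ht').
        assert (H2 := phi_sqr n t (Hn t Ht') H1).
        assert (H3 : e <= slope n p t).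
        { eapply Rle_trans; [apply Hsl; lra|]. eapply slope_increasing; [exact HO| |]; lra. }
        assert (X : 0 < phi n t ^ 2 * (1 - t ^ 2)) by (apply Rmult_lt_0_compat; nra).
        eapply Rle_trans; [apply HA; auto|].
        replace (n t) with (/ (phi n t ^ 2 * (1 - t ^ 2))).
        2:{ apply Rmult_eq_reg_l with (phi n t ^ 2 * (1 - t ^ 2)); [|lra].
            rewrite Rinv_r by lra. lra. }
        replace (slope n p t / (1 - t ^ 2) / (e * phi n t ^ 2))
          with ((slope n p t / e) * / (phi n t ^ 2 * (1 - t ^ 2))) by (field; repeat split; lra).
        rewrite <- (Rmult_1_l (/ (phi n t ^ 2 * (1 - t ^ 2)))) at 1.
        apply Rmult_le_compat_r; [left; apply Rinv_0_lt_compat; lra|].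
        apply Rmult_le_reg_r with e; auto. field_simplify; lra. }
    assert (Hp := phi_ge_1 _ _ _ _ _ r0 HO ltac:(lra)).
    assert (HpT := phi_ge_1 _ _ _ _ _ T HO ltac:(lra)).
    assert (/ (e * phi n r0) <= / e).
    { apply Rinv_le_contravar; auto. nra. }
    assert (0 < / (e * phi n T)) by (apply Rinv_0_lt_compat; nra).
    assert (H2 := Hfirst r0 ltac:(lra)).
    assert (H3 := Cmod_sub_ge (F T) (F r0)). lra.
Qed.

Lemma rder_mult_real (A : R -> C) (g : R -> R) (t : R) (l : C) (m : R) :
  rder A t l -> is_derive g t m ->
  rder (fun s => A s * RtoC (g s))%C t (l * RtoC (g t) + A t * RtoC m)%C.
Proof.
  intros [H1 H2] Hg. split.
  - apply (is_derive_ext (fun s => Re (A s) * g s)).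
    { intros s. unfold Re, Im. simpl. ring. }
    replace (Re (l * g t + A t * m)%C) with (Re l * g t + Re (A t) * m)
      by (unfold Re, Im; simpl; ring).
    apply (is_derive_mult (fun s => Re (A s)) g t _ _ H1 Hg). intros; apply Rmult_comm.
  - apply (is_derive_ext (fun s => Im (A s) * g s)).
    { intros s. unfold Re, Im. simpl. ring. }
    replace (Im (l * g t + A t * m)%C) with (Im l * g t + Im (A t) * m)
      by (unfold Re, Im; simpl; ring).
    apply (is_derive_mult (fun s => Im (A s)) g t _ _ H2 Hg). intros; apply Rmult_comm.
Qed.

(** The product [G = A (1 - t^2)] starts at 1 and has logarithmic derivative [-2 phi'/phi + i q].
    Since [|G| <= 1], its variation is controlled by the growth of [phi] and by the integral of
    [|q|]; the convexity defect bounds only the integral of [q^2], whence the free parameter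
    [al]. *)
Lemma near_extremal (T : R) (n p q s : R -> R) (A P : R -> C) (al : R) :
  radial_ode T n p q s -> 0 < al -> A 0 = 1%C ->
  (forall t, 0 <= t <= T -> rder A t (P t * A t)%C /\ Cmod (A t) = n t /\
     Re (P t) = p t /\ Im (P t) = q t) ->
  forall t, 0 <= t <= T ->
  Cmod (A t * RtoC (1 - t ^ 2) - 1)%C <=
    2 * slope n p T / (1 - T ^ 2) + al + slope n p T / (al * (1 - T ^ 2)).
Proof.
  intros HO Hal HA0 HA t Ht.
  assert (HT : T < 1) by apply HO.
  assert (HT1 : 0 < 1 - T ^ 2) by (apply one_minus_sq_pos with T; lra).
  set (G := fun s => (A s * RtoC (1 - s ^ 2))%C).
  set (B := fun s => 2 * phi n s + al * s + slope n p s / (al * (1 - T ^ 2))).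
  assert (HG : Cmod (G t - G 0)%C <= B t - B 0).
  { apply mean_value_ineq with
      (dF := fun s => ((P s - RtoC (2 * s / (1 - s ^ 2))) * G s)%C)
      (dB := fun s0 => 2 * (slope n p s0 / (1 - s0 ^ 2)) + al +
         phi n s0 * (1 - s0 ^ 2) * (q s0 ^ 2 / 4 + 1 / (1 - s0 ^ 2) ^ 2 - s s0 / 2)
           / (al * (1 - T ^ 2))); [lra| | |].
    - intros x Hx. assert (Hx' : 0 <= x <= T) by lra.
      assert (H1 := one_minus_sq_pos x T Hx' HT).
      destruct (HA x Hx') as [[D1 D2] _].
      unfold G.
      replace ((P x - RtoC (2 * x / (1 - x ^ 2))) * (A x * RtoC (1 - x ^ 2)))%C
        with (P x * A x * RtoC (1 - x ^ 2) + A x * RtoC (- (2 * x)))%C.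
      + apply (rder_mult_real A (fun y => 1 - y ^ 2) x (P x * A x)%C (- (2 * x))); [split; auto|]. auto_derive; [exact I|ring].
      + assert (E : RtoC (2 * x) = (RtoC (2 * x / (1 - x ^ 2)) * RtoC (1 - x ^ 2))%C)
          by (rewrite <- RtoC_mult; f_equal; field; lra).
        rewrite RtoC_opp, E. ring.
    - intros x Hx. assert (Hx' : 0 <= x <= T) by lra.
      assert (D1 := is_derive_phi _ _ _ _ _ x HO Hx').
      assert (D2 := is_derive_slope _ _ _ _ _ x HO Hx').
      assert (H1 := one_minus_sq_pos x T Hx' HT).
      unfold B. auto_derive.
      + split; [eexists; exact D1|]. split; [eexists; exact D2|exact I].
      + replace (Derive (fun x => phi n x) x) with (slope n p x / (1 - x ^ 2))
            by (symmetry; apply is_derive_unique; exact D1).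
        replace (Derive (fun x => slope n p x) x)
          with (phi n x * (1 - x ^ 2) * (q x ^ 2 / 4 + 1 / (1 - x ^ 2) ^ 2 - s x / 2))
          by (symmetry; apply is_derive_unique; exact D2).
        field. repeat split; lra.
    - intros x Hx. assert (Hx' : 0 <= x <= T) by lra.
      assert (H1 := one_minus_sq_pos x T Hx' HT).
      destruct (HA x Hx') as [_ [Hn [Hp Hq]]].
      assert (Hm := modulus_le _ _ _ _ _ x HO Hx').
      assert (Hphi := phi_ge_1 _ _ _ _ _ x HO Hx').
      assert (Hsl := slope_ge_0 _ _ _ _ _ x HO Hx').
      assert (HE := slope_derivative_ge _ _ _ _ _ x HO Hx').
      assert (Hnp : 0 < n x) by (apply HO; auto).
      assert (HGle : Cmod (G x) <= 1).
      { unfold G. rewrite Cmod_mult, Cmod_R, Hn, Rabs_pos_eq by lra. exact Hm. }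
      rewrite Cmod_mult.
      (* This is [phi'/phi], at most [phi'] because [phi >= 1]. *)
      set (kk := - p x / 2 + x / (1 - x ^ 2)).
      assert (Ek : slope n p x / (1 - x ^ 2) = phi n x * kk) by (unfold slope, kk; field; lra).
      assert (Hk : 0 <= kk).
      { assert (0 <= slope n p x / (1 - x ^ 2)).
        { apply Rmult_le_pos; auto. left; apply Rinv_0_lt_compat; auto. }
        rewrite Ek in H. nra. }
      assert (HP : Cmod (P x - RtoC (2 * x / (1 - x ^ 2)))%C <= 2 * kk + Rabs (q x)).
      { replace (P x - RtoC (2 * x / (1 - x ^ 2)))%C with (RtoC (- 2 * kk) + Ci * RtoC (q x))%C.
        - eapply Rle_trans; [apply Cmod_triangle|]. rewrite Cmod_mult, Cmod_Ci, !Cmod_R.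
          rewrite Rabs_left1 by lra. lra.
        - rewrite <- Hq. unfold kk. rewrite <- Hp. destruct (P x) as [x1 x2].
          apply injective_projections; unfold Re, Im; simpl; field; simpl in *; lra. }
      (* The arithmetic-geometric mean inequality trades [|q|] for [q^2], which the derivative of
         the slope dominates. *)
      assert (Hq2 : Rabs (q x) <= al + q x ^ 2 / (4 * al)).
      { apply Rmult_le_reg_r with (4 * al); [lra|].
        replace ((al + q x ^ 2 / (4 * al)) * (4 * al)) with (4 * al * al + q x ^ 2) by (field; lra).
        rewrite <- (pow2_abs (q x)). generalize (pow2_ge_0 (2 * al - Rabs (q x))). simpl. lra. }
      assert (HE2 : q x ^ 2 / (4 * al) <=
        phi n x * (1 - x ^ 2) * (q x ^ 2 / 4 + 1 / (1 - x ^ 2) ^ 2 - s x / 2)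
           / (al * (1 - T ^ 2))).
      { apply Rle_trans with (phi n x * (1 - x ^ 2) * (q x ^ 2 / 4) / (al * (1 - T ^ 2))).
        - apply Rmult_le_reg_r with (al * (1 - T ^ 2)); [apply Rmult_lt_0_compat; lra|].
          unfold Rdiv at 2. rewrite Rmult_assoc, Rinv_l, Rmult_1_r
            by (apply Rgt_not_eq, Rmult_lt_0_compat; lra).
          replace (q x ^ 2 / (4 * al) * (al * (1 - T ^ 2)))
             with (1 * (1 - T ^ 2) * (q x ^ 2 / 4)) by (field; lra).
          apply Rmult_le_compat_r; [generalize (pow2_ge_0 (q x)); lra|].
          apply Rmult_le_compat; try lra. nra.
        - apply Rmult_le_compat_r; auto. left. apply Rinv_0_lt_compat, Rmult_lt_0_compat; lra. }
      rewrite Ek.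
      apply Rle_trans with ((2 * kk + Rabs (q x)) * 1).
      + apply Rmult_le_compat; auto using Cmod_ge_0.
      + nra. }
  replace (G 0) with (RtoC 1) in HG.
  2:{ unfold G. rewrite HA0. replace (1 - 0 ^ 2) with 1 by ring. ring. }
  eapply Rle_trans; [exact HG|].
  assert (HphiT : phi n t - phi n 0 <= slope n p T / (1 - T ^ 2) * t).
  (* Both [slope] and [1/(1 - x^2)] increase, so [phi'] is largest at [T]. *)
  { assert (H := is_derive_nondecreasing
      (fun x => slope n p T / (1 - T ^ 2) * x - phi n x)
      (fun x => slope n p T / (1 - T ^ 2) - slope n p x / (1 - x ^ 2)) 0 t (proj1 Ht)).
    lapply H; [clear H; intros H; lapply H|].
    - lra.
    - intros x Hx. assert (Hx' : 0 <= x <= T) by lra.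
      assert (H1 := one_minus_sq_pos x T Hx' HT).
      enough (slope n p x / (1 - x ^ 2) <= slope n p T / (1 - T ^ 2)) by lra.
      apply Rmult_le_compat.
      + eapply slope_ge_0; [exact HO|lra].
      + left; apply Rinv_0_lt_compat; auto.
      + eapply slope_increasing; [exact HO| |]; lra.
      + apply Rinv_le_contravar; auto. nra.
    - intros x Hx. assert (Hx' : 0 <= x <= T) by lra.
      assert (D1 := is_derive_phi _ _ _ _ _ x HO Hx').
      auto_derive; [repeat split; eexists; exact D1|].
      replace (Derive (fun x => phi n x) x) with (slope n p x / (1 - x ^ 2))
            by (symmetry; apply is_derive_unique; exact D1). field. assert (H1 := one_minus_sq_pos x T Hx' HT). split; lra. }
  assert (HslT : 0 <= slope n p T / (1 - T ^ 2)).
  { apply Rmult_le_pos; [eapply slope_ge_0; [exact HO|lra]|].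
    left; apply Rinv_0_lt_compat; auto. }
  assert (Hs0 : 0 <= slope n p 0) by (eapply slope_ge_0; [exact HO|lra]).
  assert (Hst : slope n p t <= slope n p T) by (eapply slope_increasing; [exact HO| |]; lra).
  assert (Hd : 0 < / (al * (1 - T ^ 2))) by (apply Rinv_0_lt_compat, Rmult_lt_0_compat; lra).
  unfold B. unfold Rdiv in *.
  assert (slope n p t * / (al * (1 - T ^ 2)) <= slope n p T * / (al * (1 - T ^ 2)))
    by (apply Rmult_le_compat_r; lra).
  assert (0 <= slope n p 0 * / (al * (1 - T ^ 2))) by (apply Rmult_le_pos; lra).
  assert (slope n p T * / (1 - T ^ 2) * t <= slope n p T * / (1 - T ^ 2)) by nra.
  assert (al * t <= al) by nra. lra.
Qed.

(** * Non-vanishing along a radius *)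

Lemma Cmod_sqrt (z : C) : Cmod z = sqrt (Re z * Re z + Im z * Im z).
Proof. unfold Cmod, Re, Im. f_equal. ring. Qed.

Lemma Cmod_sqr (z : C) : Cmod z * Cmod z = Re z * Re z + Im z * Im z.
Proof. generalize (Cmod2_alt z). simpl. lra. Qed.

Lemma is_derive_Cmod (A : R -> C) (t : R) (P : C) :
  A t <> 0%C -> rder A t (P * A t)%C ->
  is_derive (fun s => Cmod (A s)) t (Re P * Cmod (A t)).
Proof.
  intros Hn [H1 H2]. assert (Hm := Cmod_neq_0 _ Hn).
  apply (is_derive_ext (fun s => sqrt (Re (A s) * Re (A s) + Im (A s) * Im (A s)))).
  { intros s. symmetry. apply Cmod_sqrt. }
  set (a := fun s => Re (A s)) in *. set (b := fun s => Im (A s)) in *.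
  assert (Hs := Cmod_sqr (A t)). rewrite Cmod_sqrt in Hm, Hs |- *.
  fold (a t) (b t) in *.
  change (is_derive (fun s => sqrt (a s * a s + b s * b s)) t
    (Re P * sqrt (a t * a t + b t * b t))).
  auto_derive.
  - split; [eexists; exact H1|]. split; [eexists; exact H1|].
    split; [eexists; exact H2|]. split; [eexists; exact H2|]. split; [|exact I].
    rewrite <- Hs. apply Rmult_lt_0_compat; auto.
  - replace (Derive (fun x => a x) t) with (Re (P * A t)%C)
      by (symmetry; apply is_derive_unique; exact H1).
    replace (Derive (fun x => b x) t) with (Im (P * A t)%C)
      by (symmetry; apply is_derive_unique; exact H2).
    set (r := sqrt (a t * a t + b t * b t)) in *.
    replace (Re (P * A t)%C) with (Re P * a t - Im P * b t) by (unfold a, b, Re, Im; simpl; ring).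
    replace (Im (P * A t)%C) with (Re P * b t + Im P * a t) by (unfold a, b, Re, Im; simpl; ring).
    apply Rmult_eq_reg_r with r; [|lra].
    replace (Re P * r * r) with (Re P * (r * r)) by ring. rewrite Hs. field. lra.
Qed.

(* [(1 + |P|^2/4) / |A|] is [|u|^2 + |u'|^2] for the solution [u = A^(-1/2)] of
   [u'' + (S/2) u = 0]; Gronwall bounds it, so [A] cannot tend to zero. *)
Lemma energy_bound (T sigma : R) (A P S : R -> C) : 0 <= sigma ->
  (forall t, 0 <= t <= T -> A t <> 0%C /\ rder A t (P t * A t)%C /\
     rder P t (S t + / 2 * P t ^ 2)%C /\ Cmod (S t) <= sigma) ->
  forall t, 0 <= t <= T ->
  (1 + Cmod (P t) ^ 2 / 4) / Cmod (A t) <=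
    (1 + Cmod (P 0) ^ 2 / 4) / Cmod (A 0) * exp ((1 + sigma / 2) * t).
Proof.
  intros Hsig H t Ht. set (K := 1 + sigma / 2).
  set (p := fun s => Re (P s)). set (q := fun s => Im (P s)).
  set (n := fun s => Cmod (A s)).
  set (h := fun s => (1 + (p s * p s + q s * q s) / 4) / n s).
  assert (Eh : forall s, (1 + Cmod (P s) ^ 2 / 4) / Cmod (A s) = h s).
  { intros s. unfold h, p, q. rewrite <- Cmod_sqr. unfold n. simpl. now rewrite Rmult_1_r. }
  rewrite !Eh.
  (* Gronwall with integrating factor: [h exp(-K s)] decreases, stated through its negative. *)
  assert (HD := is_derive_nondecreasing (fun s => - (h s * exp (- (K * s))))
    (fun s => (K * h s - (- p s + (p s * Re (S s) + q s * Im (S s)) / 2) / n s) * exp (- (K * s)))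
    0 t (proj1 Ht)).
  lapply HD; [clear HD; intros HD; lapply HD; [clear HD; intros HD|]|].
  - assert (E0 : exp (- (K * 0)) = 1) by (rewrite Rmult_0_r, Ropp_0; apply exp_0).
    rewrite E0 in HD. rewrite exp_Ropp in HD.
    assert (HE := exp_pos (K * t)).
    apply Rmult_le_reg_r with (/ exp (K * t)); [apply Rinv_0_lt_compat; auto|].
    rewrite Rmult_assoc, Rinv_r by lra. lra.
  - intros s Hs. destruct (H s) as [Hn [_ [_ HS]]]; [lra|].
    apply Rmult_le_pos; [|left; apply exp_pos].
    assert (Hm := Cmod_neq_0 _ Hn). fold (n s) in Hm.
    replace (K * h s - (- p s + (p s * Re (S s) + q s * Im (S s)) / 2) / n s)
      with ((K * (1 + (p s * p s + q s * q s) / 4) - (- p s + (p s * Re (S s) + q s * Im (S s)) / 2))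
            / n s) by (unfold h; field; lra).
    apply Rmult_le_pos; [|left; apply Rinv_0_lt_compat; auto].
    set (m := Cmod (P s)).
    assert (Hm0 : 0 <= m) by apply Cmod_ge_0.
    assert (Em : p s * p s + q s * q s = m * m) by (unfold m, p, q; rewrite Cmod_sqr; ring).
    rewrite Em.
    assert (X : p s * Re (S s) + q s * Im (S s) <= m * sigma).
    { apply Rle_trans with (m * Cmod (S s)); [|apply Rmult_le_compat_l; auto].
      replace (p s * Re (S s) + q s * Im (S s)) with (Re (Cconj (P s) * S s)%C)
        by (unfold p, q, Re, Im; simpl; ring).
      eapply Rle_trans; [apply Rle_abs|]. eapply Rle_trans; [apply re_le_Cmod|].
      rewrite Cmod_mult, Cmod_conj. apply Rle_refl. }
    assert (Y : - p s <= m).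
    { eapply Rle_trans; [|apply re_le_Cmod]. rewrite <- Rabs_Ropp. apply Rle_abs. }
    (* This absorbs both linear terms, [m] and [m sigma / 2], and is the origin of
       [K = 1 + sigma/2]. *)
    assert (Z : m <= 1 + m * m / 4) by (generalize (pow2_ge_0 (m - 2)); simpl; lra).
    unfold K. nra.
  - intros s Hs. destruct (H s) as [Hn [HA [[H1 H2] _]]]; [lra|].
    assert (Dn := is_derive_Cmod A s (P s) Hn HA).
    assert (Hm := Cmod_neq_0 _ Hn).
    fold (n s) (p s) in *. fold p in H1. fold q in H2. fold n in Dn.
    unfold h. auto_derive.
    + repeat split; try (first [eexists; exact Dn|eexists; exact H1|eexists; exact H2]); lra.
    + replace (Derive (fun x => n x) s) with (p s * n s)
        by (symmetry; apply is_derive_unique; exact Dn).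
      replace (Derive (fun x => p x) s) with (Re (S s) + / 2 * (p s * p s - q s * q s)).
      2:{ symmetry; apply is_derive_unique. eapply eq_rect; [exact H1|].
          unfold p, q, Re, Im. simpl. field. }
      replace (Derive (fun x => q x) s) with (Im (S s) + p s * q s).
      2:{ symmetry; apply is_derive_unique. eapply eq_rect; [exact H2|].
          unfold p, q, Re, Im. simpl. field. }
      field. lra.
Qed.

Lemma rder_cont (X : R -> C) (t : R) (l : C) : rder X t l ->
  forall e, 0 < e -> exists d, 0 < d /\ forall s, Rabs (s - t) < d -> Cmod (X s - X t)%C < e.
Proof.
  intros [H1 H2] e He.
  assert (C1 : continuity_pt (fun s => Re (X s)) t).
  { apply derivable_continuous_pt. eexists. apply is_derive_Reals. exact H1. }
  assert (C2 : continuity_pt (fun s => Im (X s)) t).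
  { apply derivable_continuous_pt. eexists. apply is_derive_Reals. exact H2. }
  assert (He2 : 0 < e / 2) by lra.
  destruct (proj1 (continuity_pt_locally _ _) C1 (mkposreal _ He2)) as [d1 K1].
  destruct (proj1 (continuity_pt_locally _ _) C2 (mkposreal _ He2)) as [d2 K2].
  exists (Rmin d1 d2). split; [apply Rmin_glb_lt; apply cond_pos|].
  intros s Hs. replace e with (2 * (e / 2)) by field. apply Cmod_lt_of_parts.
  - apply K1. eapply Rlt_le_trans; [exact Hs|apply Rmin_l].
  - apply K2. eapply Rlt_le_trans; [exact Hs|apply Rmin_r].
Qed.

(** Take the supremum [r] of the zero-free initial segments. The hypothesis keeps [X] away from zero
    below [r], so by continuity [X r] is nonzero, and by continuity again the segment extends past
    [r] unless the target is reached. It is applied both to [f'] and to [1 + a2 f]. *)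
Lemma zero_free_continuation (X dX : R -> C) :
  (forall t, 0 <= t < 1 -> rder X t (dX t)) -> X 0 <> 0%C ->
  (forall r, 0 < r < 1 -> (forall t, 0 <= t < r -> X t <> 0%C) ->
     exists m, 0 < m /\ forall t, 0 <= t < r -> m <= Cmod (X t)) ->
  forall t, 0 <= t < 1 -> X t <> 0%C.
Proof.
  intros HX H0 Hm t0 Ht0 E.
  set (D := fun r => 0 <= r <= t0 /\ forall t, 0 <= t <= r -> X t <> 0%C).
  destruct (completeness D) as [r [Hub Hlub]].
  - exists t0. intros r [Hr _]. lra.
  - exists 0. split; [lra|]. intros t Ht. replace t with 0 by lra. exact H0.
  - assert (Hr0 : 0 <= r).
    { apply Hub. split; [lra|]. intros t Ht. replace t with 0 by lra. exact H0. }
    assert (Hrt : r <= t0) by (apply Hlub; intros x [Hx _]; lra).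
    assert (Hbelow : forall t, 0 <= t < r -> X t <> 0%C).
    { intros t Ht Et. assert (r <= t); [|lra]. apply Hlub. intros x [Hx Hx'].
      destruct (Rle_lt_dec x t); auto. exfalso. apply (Hx' t); auto. lra. }
    assert (Hr : X r <> 0%C).
    { intros Er. destruct (Req_dec r 0) as [->|Hne]; [auto|].
      destruct (Hm r) as [m [Hm0 Hml]]; [lra|auto|].
      destruct (rder_cont X r (dX r) (HX r ltac:(lra)) m Hm0) as [d [Hd K]].
      set (t := Rmax 0 (r - d / 2)).
      assert (Ht : 0 <= t < r) by (split; [apply Rmax_l|apply Rmax_lub_lt; lra]).
      specialize (K t). rewrite Er in K.
      replace (X t - 0)%C with (X t) in K by ring.
      assert (Rabs (t - r) < d).
      { rewrite Rabs_left by lra. assert (r - d / 2 <= t) by apply Rmax_r. lra. }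
      specialize (K H). specialize (Hml t Ht). lra. }
    assert (Hm' := Cmod_neq_0 _ Hr).
    destruct (rder_cont X r (dX r) (HX r ltac:(lra)) _ Hm') as [d [Hd K]].
    destruct (Req_dec r t0) as [->|Hne]; [auto|].
    set (r' := Rmin t0 (r + d / 2)).
    assert (Hr' : r < r') by (apply Rmin_glb_lt; lra).
    assert (r' <= r); [|lra]. apply Hub. split.
    + split; [lra|apply Rmin_l].
    + intros t Ht Et. destruct (Rlt_le_dec t r) as [Htr|Htr]; [apply (Hbelow t); [lra|auto]|].
      assert (r' <= r + d / 2) by apply Rmin_r.
      specialize (K t). rewrite Et in K. rewrite Rabs_pos_eq in K by lra.
      specialize (K ltac:(lra)).
      replace (0 - X r)%C with (- X r)%C in K by ring. rewrite Cmod_opp in K. lra.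
Qed.

(** * Nehari functions along radii *)

Lemma polar (z : C) : exists c, Cmod c = 1 /\ z = (c * RtoC (Cmod z))%C.
Proof.
  destruct (Ceq_dec z 0%C) as [->|Hn].
  - exists 1%C. rewrite Cmod_1, Cmod_0. split; [reflexivity|ring].
  - assert (Hm := Cmod_neq_0 _ Hn). assert (Hc : RtoC (Cmod z) <> 0%C).
    { intros E. apply RtoC_inj in E. lra. }
    exists (z / Cmod z)%C. split; [|field; auto].
    rewrite Cmod_div, Cmod_R, Rabs_pos_eq by (auto; lra). field. lra.
Qed.

Lemma Cmod_ray (c : C) (t : R) : Cmod c = 1 -> 0 <= t -> Cmod (c * t)%C = t.
Proof. intros Hc Ht. rewrite Cmod_mult, Hc, Cmod_R, Rabs_pos_eq; lra. Qed.

Lemma disk_ray (c : C) (t : R) : Cmod c = 1 -> 0 <= t < 1 -> disk (c * t)%C.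
Proof. intros Hc Ht. unfold disk. rewrite Cmod_ray; lra. Qed.

Lemma disk_0 : disk 0%C.
Proof. unfold disk. rewrite Cmod_0. lra. Qed.

(** Convertible to the local [p] in [schwarzian], so the Schwarzian can be rewritten through it by
    [change]. *)
Definition preschwarzian (f : C -> C) (w : C) : C :=
  (C_derive (C_derive f) w / C_derive f w)%C.

Lemma cder_preschwarzian (f : C -> C) (z : C) :
  analytic_on_disk f -> disk z -> C_derive f z <> 0%C ->
  cder (preschwarzian f) z (schwarzian f z + / 2 * preschwarzian f z ^ 2)%C.
Proof.
  intros Hf Hz Hn.
  assert (H1 := analytic_C_derive f Hf). assert (H2 := analytic_C_derive _ H1).
  assert (D := cder_mult _ _ z _ _ (analytic_cder _ z H2 Hz)
     (cder_inv _ z _ (analytic_cder _ z H1 Hz) Hn)).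
  eapply cder_eq; [|exact D].
  change (schwarzian f z) with
    (C_derive (preschwarzian f) z - / 2 * preschwarzian f z ^ 2)%C.
  rewrite (cder_C_derive (preschwarzian f) z _ D). ring.
Qed.

Lemma nehari_schwarzian_le (f : C -> C) (c : C) (t : R) : nehari f -> Cmod c = 1 ->
  0 <= t < 1 -> Cmod (c ^ 2 * schwarzian f (c * t))%C <= 2 / (1 - t ^ 2) ^ 2.
Proof.
  intros [_ [_ [_ [_ H]]]] Hc Ht. specialize (H (c * t)%C (disk_ray c t Hc Ht)).
  rewrite Cmod_ray in H by lra. rewrite Cmod_mult, Cmod_pow, Hc, pow1, Rmult_1_l.
  assert (0 < 1 - t ^ 2) by nra.
  assert (0 < (1 - t ^ 2) ^ 2) by (apply pow_lt; auto).
  apply Rmult_le_reg_l with ((1 - t ^ 2) ^ 2); auto.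
  replace ((1 - t ^ 2) ^ 2 * (2 / (1 - t ^ 2) ^ 2)) with 2 by (field; lra). exact H.
Qed.

(** Below [r] the Schwarzian is bounded by [sigma], so [energy_bound] for [A = f'] gives a bound on
    [1/|f'|] independent of [t]. It is applied on each [[0, t]] with [t < r], where [f'] is known to
    be zero-free. *)
Lemma nehari_derivative_ge (f : C -> C) (c : C) (r : R) : nehari f -> Cmod c = 1 -> 0 < r < 1 ->
  (forall t, 0 <= t < r -> C_derive f (c * t)%C <> 0%C) ->
  exists m, 0 < m /\ forall t, 0 <= t < r -> m <= Cmod (C_derive f (c * t)%C).
Proof.
  intros Hf Hc Hr Hnz. assert (Ha : analytic_on_disk f) by apply Hf.
  set (P := fun t : R => (c * preschwarzian f (c * t))%C).
  set (sigma := 2 / (1 - r ^ 2) ^ 2).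
  set (h := 1 + Cmod (P 0) ^ 2 / 4). set (K := 1 + sigma / 2).
  assert (Hr2 : 0 < 1 - r ^ 2) by nra.
  assert (Hsig : 0 < sigma) by (apply Rdiv_lt_0_compat; [lra|apply pow_lt; auto]).
  assert (Hh : 1 <= h) by (unfold h; generalize (pow2_ge_0 (Cmod (P 0))); lra).
  assert (He := exp_pos (K * r)).
  exists (/ (h * exp (K * r))). split; [apply Rinv_0_lt_compat; nra|].
  intros t Ht.
  assert (E := energy_bound t sigma (fun s => C_derive f (c * s)%C) P
    (fun s => c ^ 2 * schwarzian f (c * s))%C (Rlt_le _ _ Hsig)).
  lapply E; [clear E; intros E|].
  - specialize (E t ltac:(lra)). cbv beta in E.
    assert (Hm := Cmod_neq_0 _ (Hnz t Ht)). set (m := Cmod (C_derive f (c * t)%C)) in *.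
    replace (C_derive f (c * 0)%C) with (RtoC 1) in E.
    2:{ rewrite Cmult_0_r. symmetry. apply Hf. }
    rewrite Cmod_1 in E. fold h K in E.
    assert (E1 : / m <= (1 + Cmod (P t) ^ 2 / 4) / m).
    { rewrite <- (Rmult_1_l (/ m)) at 1. apply Rmult_le_compat_r;
      [left; apply Rinv_0_lt_compat; auto|]. generalize (pow2_ge_0 (Cmod (P t))); lra. }
    assert (E2 : exp (K * t) <= exp (K * r)).
    { destruct (Req_dec t r) as [->|]; [lra|]. left. apply exp_increasing.
      apply Rmult_lt_compat_l; [unfold K; lra|lra]. }
    assert (E3 : / m <= h * exp (K * r)).
    { eapply Rle_trans; [exact E1|]. eapply Rle_trans; [exact E|].
      unfold Rdiv. rewrite Rinv_1, Rmult_1_r. apply Rmult_le_compat_l; lra. }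
    rewrite <- (Rinv_inv m). apply Rinv_le_contravar; auto. apply Rinv_0_lt_compat; auto.
  - intros s Hs. assert (Hd : disk (c * s)%C) by (apply disk_ray; auto; lra).
    assert (Hn := Hnz s ltac:(lra)).
    assert (Ha1 := analytic_C_derive f Ha).
    split; [exact Hn|]. split; [|split].
    + assert (D := rder_ray _ c s _ (analytic_cder _ _ Ha1 Hd)).
      replace (P s * C_derive f (c * s))%C with (c * C_derive (C_derive f) (c * s))%C
        by (unfold P, preschwarzian; field; auto). apply D.
    + assert (D := cder_mult _ _ _ _ _ (cder_const c (c * s)%C) (cder_preschwarzian f _ Ha Hd Hn)).
      apply rder_ray in D.
      eapply eq_rect; [exact D|]. unfold P. ring.
    + eapply Rle_trans; [apply nehari_schwarzian_le; auto; lra|].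
      unfold sigma. apply Rmult_le_compat_l; [lra|]. apply Rinv_le_contravar.
      * apply pow_lt; auto.
      * apply pow_incr. nra.
Qed.

(** Continuation of [f'(0) = 1] along the radius through [z], by the Schwarzian bound. *)
Lemma nehari_derivative_neq_0 (f : C -> C) (z : C) :
  nehari f -> disk z -> C_derive f z <> 0%C.
Proof.
  intros Hf Hz. destruct (polar z) as [c [Hc ->]].
  unfold disk in Hz. set (t := Cmod z) in *. assert (Ht : 0 <= t) by apply Cmod_ge_0.
  apply (zero_free_continuation (fun t => C_derive f (c * t)%C)
    (fun t => c * C_derive (C_derive f) (c * t))%C); auto.
  - intros s Hs. apply rder_ray, analytic_cder; [apply analytic_C_derive, Hf|].
    apply disk_ray; auto.
  - rewrite Cmult_0_r. replace (C_derive f 0) with (RtoC 1) by (symmetry; apply Hf).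
    intros E. apply RtoC_inj in E. lra.
  - intros r Hr Hnz. apply nehari_derivative_ge; auto.
Qed.

(** * The normalized mapping and its differential equations *)

Definition denominator (f : C -> C) (z : C) : C := (1 + a2 f * f z)%C.

Definition normalized_derivative (f : C -> C) (z : C) : C :=
  (C_derive f z / (denominator f z * denominator f z))%C.

(** The logarithmic derivative of [normalized_derivative f], itself the derivative of [normalized f]
    wherever the denominator is nonzero. *)
Definition normalized_preschwarzian (f : C -> C) (z : C) : C :=
  (preschwarzian f z - 2 * a2 f * C_derive f z / denominator f z)%C.

Lemma cder_denominator (f : C -> C) (z : C) : nehari f -> disk z ->
  cder (denominator f) z (a2 f * C_derive f z)%C.
Proof.
  intros Hf Hz. eapply cder_eq;
  [|apply (cder_plus _ _ _ _ _ (cder_const 1%C z)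
      (cder_mult _ _ _ _ _ (cder_const (a2 f) z) (analytic_cder f z (proj1 Hf) Hz)))]. ring.
Qed.

Lemma cder_normalized (f : C -> C) (z : C) : nehari f -> disk z -> denominator f z <> 0%C ->
  cder (normalized f) z (normalized_derivative f z).
Proof.
  intros Hf Hz Hn.
  eapply cder_eq; [|exact (cder_mult _ _ _ _ _ (analytic_cder f z (proj1 Hf) Hz)
     (cder_inv _ _ _ (cder_denominator f z Hf Hz) Hn))].
  unfold normalized_derivative. unfold denominator in *. field. auto.
Qed.

Lemma cder_normalized_derivative (f : C -> C) (z : C) :
  nehari f -> disk z -> denominator f z <> 0%C ->
  cder (normalized_derivative f) z (normalized_preschwarzian f z * normalized_derivative f z)%C.
Proof.
  intros Hf Hz Hn. assert (D := cder_denominator f z Hf Hz).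
  assert (H1 := analytic_C_derive f (proj1 Hf)).
  assert (Hnz := nehari_derivative_neq_0 f z Hf Hz).
  eapply cder_eq; [|exact (cder_mult _ _ _ _ _ (analytic_cder _ z H1 Hz)
     (cder_inv _ _ _ (cder_mult _ _ _ _ _ D D) (Cmult_neq_0 _ _ Hn Hn)))].
  unfold normalized_preschwarzian, normalized_derivative, preschwarzian. field. auto.
Qed.

(** Möbius invariance of the Schwarzian, in Riccati form: the same [schwarzian f] appears as for
    [preschwarzian f]. *)
Lemma cder_normalized_preschwarzian (f : C -> C) (z : C) :
  nehari f -> disk z -> denominator f z <> 0%C ->
  cder (normalized_preschwarzian f) z
    (schwarzian f z + / 2 * normalized_preschwarzian f z ^ 2)%C.
Proof.
  intros Hf Hz Hn. assert (D := cder_denominator f z Hf Hz).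
  assert (Hnz := nehari_derivative_neq_0 f z Hf Hz).
  assert (H1 := analytic_C_derive f (proj1 Hf)).
  assert (Dq := cder_mult _ _ _ _ _ (cder_mult _ _ _ _ _ (cder_const (- (2 * a2 f))%C z)
     (analytic_cder _ z H1 Hz)) (cder_inv _ _ _ D Hn)).
  assert (Ds := cder_plus _ _ _ _ _ (cder_preschwarzian f z (proj1 Hf) Hz Hnz) Dq).
  apply (cder_ext_loc _ (normalized_preschwarzian f) 1) in Ds;
    [|lra|intros w _; unfold normalized_preschwarzian, Cdiv; ring].
  eapply cder_eq; [|exact Ds].
  unfold normalized_preschwarzian, preschwarzian. field. auto.
Qed.

Lemma Re_riccati (x y : C) :
  Re (x + / 2 * y ^ 2)%C = Re x + (Re y ^ 2 - Im y ^ 2) / 2.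
Proof. unfold Re, Im. simpl. field. Qed.

(** Non-vanishing of the denominator is a hypothesis here because this lemma is used to prove it, in
    [denominator_neq_0]; [radial_ode_of_nehari] is the unconditional form. *)
Lemma normalized_radial_ode (f : C -> C) (c : C) (T : R) : nehari f -> Cmod c = 1 -> T < 1 ->
  (forall t, 0 <= t <= T -> denominator f (c * t)%C <> 0%C) ->
  radial_ode T (fun t => Cmod (normalized_derivative f (c * t)%C))
    (fun t => Re (c * normalized_preschwarzian f (c * t))%C)
    (fun t => Im (c * normalized_preschwarzian f (c * t))%C)
    (fun t => Re (c ^ 2 * schwarzian f (c * t))%C) /\
  forall t, 0 <= t <= T ->
    rder (fun s => normalized_derivative f (c * s)%C) t
     (c * normalized_preschwarzian f (c * t) * normalized_derivative f (c * t))%C /\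
    rder (fun s => c * normalized_preschwarzian f (c * s))%C t
      (c ^ 2 * schwarzian f (c * t) + / 2 * (c * normalized_preschwarzian f (c * t)) ^ 2)%C.
Proof.
  intros Hf Hc HT Hn.
  assert (H0 : f 0%C = 0%C) by apply Hf. assert (H1 : C_derive f 0%C = 1%C) by apply Hf.
  assert (HR : forall t, 0 <= t <= T ->
    rder (fun s => normalized_derivative f (c * s)%C) t
     (c * normalized_preschwarzian f (c * t) * normalized_derivative f (c * t))%C /\
    rder (fun s => c * normalized_preschwarzian f (c * s))%C t
      (c ^ 2 * schwarzian f (c * t) + / 2 * (c * normalized_preschwarzian f (c * t)) ^ 2)%C).
  { intros t Ht. assert (Hd : disk (c * t)%C) by (apply disk_ray; auto; lra). split.
    - rewrite <- Cmult_assoc. apply rder_ray. apply cder_normalized_derivative; auto.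
    - assert (D := cder_mult _ _ _ _ _ (cder_const c (c * t)%C)
        (cder_normalized_preschwarzian f _ Hf Hd (Hn t Ht))).
      apply rder_ray in D.
      eapply eq_rect; [exact D|]. ring. }
  split; [|exact HR].
  split; [exact HT|]. split; [|split].
  - rewrite Cmult_0_r. unfold normalized_derivative, denominator. rewrite H0, H1.
    replace (1 / ((1 + a2 f * 0) * (1 + a2 f * 0)))%C with (RtoC 1).
    + apply Cmod_1.
    + replace (1 + a2 f * 0)%C with (RtoC 1) by ring. field.
  (* With [f'(0) = 1], the value [f''(0) - 2 a2] is zero: this is what the normalization
     achieves. *)
  - rewrite Cmult_0_r. unfold normalized_preschwarzian, preschwarzian, denominator. rewrite H0, H1.
    replace (1 + a2 f * 0)%C with (RtoC 1) by ring.
    replace (C_derive (C_derive f) 0 / 1 - 2 * a2 f * 1 / 1)%C with (RtoC 0).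
    + rewrite Cmult_0_r. reflexivity.
    + unfold a2. field.
  - intros t Ht. destruct (HR t Ht) as [D1 D2].
    assert (Hd : disk (c * t)%C) by (apply disk_ray; auto; lra).
    assert (Hnz : normalized_derivative f (c * t)%C <> 0%C).
    { apply Cmult_neq_0; [apply nehari_derivative_neq_0; auto|].
      apply neq_0_of_Cmod. rewrite Cmod_inv by (apply Cmult_neq_0; auto).
      apply Rinv_0_lt_compat, Cmod_neq_0, Cmult_neq_0; auto. }
    split; [apply Cmod_neq_0; exact Hnz|]. split.
    + apply (is_derive_Cmod (fun s => normalized_derivative f (c * s)%C) t
        (c * normalized_preschwarzian f (c * t))%C Hnz D1).
    + split.
      * rewrite <- Re_riccati. apply (proj1 D2).
      * eapply Rle_trans; [apply Rle_abs|]. eapply Rle_trans; [apply re_le_Cmod|].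
        apply nehari_schwarzian_le; auto. lra.
Qed.

(** As long as the denominator [d] is nonzero, [modulus_le] for [g' = f'/d^2] reads
    [|d|^2 >= |f'| (1 - s^2)]. The right side has a positive lower bound below [r], so [d] cannot
    approach zero. *)
Lemma denominator_neq_0 (f : C -> C) (z : C) :
  nehari f -> disk z -> denominator f z <> 0%C.
Proof.
  intros Hf Hz. destruct (polar z) as [c [Hc ->]].
  unfold disk in Hz. set (t := Cmod z) in *. assert (Ht : 0 <= t) by apply Cmod_ge_0.
  apply (zero_free_continuation (fun t => denominator f (c * t)%C)
    (fun t => c * (a2 f * C_derive f (c * t)))%C); auto.
  - intros s Hs. apply rder_ray, cder_denominator; auto. apply disk_ray; auto.
  - rewrite Cmult_0_r. unfold denominator. replace (f 0%C) with (RtoC 0) by (symmetry; apply Hf).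
    rewrite Cmult_0_r, Cplus_0_r. intros E. apply RtoC_inj in E. lra.
  - intros r Hr Hnz.
    destruct (nehari_derivative_ge f c r Hf Hc Hr) as [m [Hm Hml]].
    { intros s Hs. apply nehari_derivative_neq_0; auto. apply disk_ray; auto; lra. }
    assert (Hr2 : 0 < 1 - r ^ 2) by nra.
    assert (Hpos : 0 < m * (1 - r ^ 2)) by (apply Rmult_lt_0_compat; auto).
    exists (sqrt (m * (1 - r ^ 2))). split; [apply sqrt_lt_R0; auto|].
    intros s Hs.
    assert (Hnz' : forall x, 0 <= x <= s -> denominator f (c * x)%C <> 0%C)
      by (intros x Hx; apply Hnz; lra).
    destruct (normalized_radial_ode f c s Hf Hc ltac:(lra) Hnz') as [HO _].
    assert (HM := modulus_le _ _ _ _ _ s HO ltac:(lra)). cbv beta in HM.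
    assert (Hd := Cmod_neq_0 _ (Hnz s Hs)).
    unfold normalized_derivative in HM.
    rewrite Cmod_div, Cmod_mult in HM by (apply Cmult_neq_0; apply Hnz; auto).
    specialize (Hml s Hs). set (d := Cmod (denominator f (c * s)%C)) in *.
    set (e := Cmod (C_derive f (c * s)%C)) in *.
    rewrite <- (sqrt_square d) by lra. apply sqrt_le_1_alt.
    assert (X : e * (1 - s ^ 2) <= d * d).
    { replace (e * (1 - s ^ 2)) with (e / (d * d) * (1 - s ^ 2) * (d * d)) by (field; lra).
      assert (0 < d * d) by nra. apply Rle_trans with (1 * (d * d)); [|lra].
      apply Rmult_le_compat_r; [lra|exact HM]. }
    eapply Rle_trans; [|exact X]. apply Rmult_le_compat; try lra. nra.
Qed.

(** * Cauchy's formula *)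

(** Continuity of the derivative is included so that one may differentiate under the integral sign
    in the proof of Cauchy's formula. *)
Definition C1_on_disk (h h' : C -> C) : Prop :=
  forall z, disk z -> cder h z (h' z) /\ ccont h' z.

(** Integration in the angle, not a contour integral: as [dw = i w dt], a factor [w] is carried by
    the integrands, for instance by [cauchy_kernel]. *)
Definition is_CInt (g : R -> C) (l : C) : Prop :=
  is_RInt (fun t => Re (g t)) 0 (2 * PI) (Re l) /\
  is_RInt (fun t => Im (g t)) 0 (2 * PI) (Im l).

Definition CInt (g : R -> C) : C :=
  (RInt (fun t => Re (g t)) 0 (2 * PI), RInt (fun t => Im (g t)) 0 (2 * PI)).

Lemma is_CInt_eq (g : R -> C) (l m : C) : l = m -> is_CInt g l -> is_CInt g m.
Proof. intros ->. auto. Qed.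

Lemma is_CInt_plus (g1 g2 : R -> C) (l1 l2 : C) :
  is_CInt g1 l1 -> is_CInt g2 l2 -> is_CInt (fun t => g1 t + g2 t)%C (l1 + l2)%C.
Proof.
  intros [H1 H2] [H3 H4]. split.
  - apply (is_RInt_plus (V := R_NormedModule) _ _ _ _ _ _ H1 H3).
  - apply (is_RInt_plus (V := R_NormedModule) _ _ _ _ _ _ H2 H4).
Qed.

Lemma is_CInt_scal (c : C) (g : R -> C) (l : C) :
  is_CInt g l -> is_CInt (fun t => c * g t)%C (c * l)%C.
Proof.
  intros [H1 H2]. split.
  - apply (is_RInt_ext (fun t => minus (scal (Re c) (Re (g t))) (scal (Im c) (Im (g t))))).
    { intros t _. unfold minus, plus, opp, scal, Re, Im; simpl. unfold mult; simpl. ring. }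
    replace (Re (c * l)%C) with (minus (scal (Re c) (Re l)) (scal (Im c) (Im l)))
      by (unfold minus, plus, opp, scal, Re, Im; simpl; unfold mult; simpl; ring).
    apply (is_RInt_minus (V := R_NormedModule)); apply (is_RInt_scal (V := R_NormedModule)); auto.
  - apply (is_RInt_ext (fun t => plus (scal (Re c) (Im (g t))) (scal (Im c) (Re (g t))))).
    { intros t _. unfold plus, scal, Re, Im; simpl. unfold mult; simpl. ring. }
    replace (Im (c * l)%C) with (plus (scal (Re c) (Im l)) (scal (Im c) (Re l)))
      by (unfold plus, scal, Re, Im; simpl; unfold mult; simpl; ring).
    apply (is_RInt_plus (V := R_NormedModule)); apply (is_RInt_scal (V := R_NormedModule)); auto.
Qed.

Lemma is_CInt_ext (g1 g2 : R -> C) (l : C) :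
  (forall t, g1 t = g2 t) -> is_CInt g1 l -> is_CInt g2 l.
Proof.
  intros H [H1 H2]. split; eapply is_RInt_ext; [|exact H1| |exact H2];
  intros t _; cbv beta; rewrite H; reflexivity.
Qed.

Lemma is_CInt_unique (g : R -> C) (l : C) : is_CInt g l -> CInt g = l.
Proof.
  intros [H1 H2]. unfold CInt. rewrite (is_RInt_unique _ _ _ _ H1), (is_RInt_unique _ _ _ _ H2).
  destruct l; reflexivity.
Qed.

Lemma two_PI_pos : 0 < 2 * PI.
Proof. generalize PI_RGT_0. lra. Qed.

(** Multiplication by the unit number [u = conj l / |l|] makes the integral real and positive, so
    comparing real parts suffices. *)
Lemma is_CInt_bound (g : R -> C) (l : C) (M : R) :
  is_CInt g l -> (forall t, Cmod (g t) <= M) -> Cmod l <= 2 * PI * M.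
Proof.
  intros H HM. assert (HP := two_PI_pos).
  assert (HM0 : 0 <= M) by (generalize (Cmod_ge_0 (g 0)) (HM 0); lra).
  destruct (Ceq_dec l 0%C) as [->|Hl]; [rewrite Cmod_0; nra|].
  assert (Hm := Cmod_neq_0 _ Hl).
  set (u := (Cconj l / Cmod l)%C).
  assert (Hc : RtoC (Cmod l) <> 0%C) by (intros E; apply RtoC_inj in E; lra).
  assert (Hu : Cmod u = 1).
  { unfold u. rewrite Cmod_div, Cmod_conj, Cmod_R, Rabs_pos_eq by (auto; lra). field. lra. }
  assert (Hul : (u * l)%C = RtoC (Cmod l)).
  { unfold u. replace (Cconj l / Cmod l * l)%C with (l * Cconj l / Cmod l)%C by (field; auto).
    rewrite <- Cmod2_conj, RtoC_pow. field. auto. }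
  destruct (is_CInt_scal u g l H) as [H1 _]. rewrite Hul in H1. change (Re (RtoC (Cmod l))) with (Cmod l) in H1.
  assert (H2 : is_RInt (fun _ => M) 0 (2 * PI) ((2 * PI - 0) * M))
    by apply (is_RInt_const (V := R_NormedModule)).
  assert (H3 := is_RInt_le _ _ _ _ _ _ (Rlt_le _ _ HP) H1 H2). rewrite Rminus_0_r in H3.
  apply H3. intros x _. cbv beta.
  eapply Rle_trans; [apply Rle_abs|]. eapply Rle_trans; [apply re_le_Cmod|].
  rewrite Cmod_mult, Hu, Rmult_1_l. apply HM.
Qed.

Lemma continuous_of_parts (G : R -> C) (t : R) :
  (forall e, 0 < e -> exists d, 0 < d /\ forall s, Rabs (s - t) < d -> Cmod (G s - G t)%C < e) ->
  continuous (fun s => Re (G s)) t /\ continuous (fun s => Im (G s)) t.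
Proof.
  intros H. split; apply continuity_pt_filterlim, continuity_pt_locally; intros e;
  destruct (H e (cond_pos e)) as [d [Hd K]]; exists (mkposreal d Hd); intros s Hs;
  specialize (K s Hs); eapply Rle_lt_trans; try exact K.
  - rewrite <- Re_minus. apply re_le_Cmod.
  - rewrite <- Im_minus. apply im_le_Cmod.
Qed.

Lemma continuous_ccont (F : C -> C) (p : R -> C) (t : R) (l : C) :
  rder p t l -> ccont F (p t) ->
  continuous (fun s => Re (F (p s))) t /\ continuous (fun s => Im (F (p s))) t.
Proof.
  intros Hp HF. apply (continuous_of_parts (fun s => F (p s))).
  intros e He. destruct (HF e He) as [d1 [H1 K1]].
  destruct (rder_cont p t l Hp d1 H1) as [d [Hd K]]. exists d. auto.
Qed.

Definition circle (r : R) (t : R) : C := (r * cos t, r * sin t).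

Lemma rder_circle (r t : R) : rder (circle r) t (Ci * circle r t)%C.
Proof. split; unfold Re, Im; simpl; auto_derive; auto; ring. Qed.

Lemma Cmod_circle (r t : R) : 0 <= r -> Cmod (circle r t) = r.
Proof.
  intros Hr. unfold Cmod, circle; simpl.
  replace (r * cos t * (r * cos t * 1) + r * sin t * (r * sin t * 1))
    with (r * r * (Rsqr (sin t) + Rsqr (cos t))) by (unfold Rsqr; ring).
  rewrite sin2_cos2, Rmult_1_r. apply sqrt_square; auto.
Qed.

Lemma circle_neq_0 (r t : R) : 0 < r -> circle r t <> 0%C.
Proof. intros Hr. apply neq_0_of_Cmod. rewrite Cmod_circle; lra. Qed.

Lemma circle_period (r : R) : circle r (2 * PI) = circle r 0.
Proof. unfold circle. rewrite cos_2PI, sin_2PI, cos_0, sin_0. reflexivity. Qed.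

Lemma is_CInt_circle (F : C -> C) (r : R) :
  (forall t, ccont F (circle r t)) ->
  is_CInt (fun t => F (circle r t)) (CInt (fun t => F (circle r t))).
Proof.
  intros H. split; unfold CInt; simpl; apply (RInt_correct (V := R_CompleteNormedModule));
  apply (ex_RInt_continuous (V := R_CompleteNormedModule)); intros t _;
  apply (continuous_ccont F (circle r) t _ (rder_circle r t) (H t)).
Qed.

(** Up to the factor [i] the integrand is the angular derivative of [G] on a closed circle. *)
Lemma is_CInt_derive (G : C -> C) (G' : C -> C) (r : R) :
  (forall t, cder G (circle r t) (G' (circle r t))) ->
  (forall t, ccont G' (circle r t)) ->
  is_CInt (fun t => G' (circle r t) * circle r t)%C 0%C.
Proof.
  intros HG HG'.
  assert (H : is_CInt (fun t => G' (circle r t) * (Ci * circle r t))%C 0%C).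
  { assert (HD : forall t, rder (fun t => G (circle r t)) t (G' (circle r t) * (Ci * circle r t))%C).
    { intros t. apply rder_comp; auto. apply rder_circle. }
    assert (HC : forall t, ccont (fun w => G' w * (Ci * w))%C (circle r t)).
    { intros t. repeat apply ccont_mult; auto using ccont_const, ccont_id. }
    split.
    - replace (Re 0%C) with (minus (Re (G (circle r (2 * PI)))) (Re (G (circle r 0)))).
      + apply (is_RInt_derive (V := R_CompleteNormedModule) (fun t => Re (G (circle r t)))
          (fun t => Re (G' (circle r t) * (Ci * circle r t))%C)).
        * intros t _. apply HD.
        * intros t _. apply (continuous_ccont _ (circle r) t _ (rder_circle r t) (HC t)).
      + rewrite circle_period. unfold minus, plus, opp; simpl. ring.
    - replace (Im 0%C) with (minus (Im (G (circle r (2 * PI)))) (Im (G (circle r 0)))).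
      + apply (is_RInt_derive (V := R_CompleteNormedModule) (fun t => Im (G (circle r t)))
          (fun t => Im (G' (circle r t) * (Ci * circle r t))%C)).
        * intros t _. apply HD.
        * intros t _. apply (continuous_ccont _ (circle r) t _ (rder_circle r t) (HC t)).
      + rewrite circle_period. unfold minus, plus, opp; simpl. ring. }
  apply (is_CInt_scal (- Ci)%C) in H.
  eapply is_CInt_eq; [|eapply is_CInt_ext; [|exact H]].
  - ring.
  - intros t. cbv beta.
    replace (- Ci * (G' (circle r t) * (Ci * circle r t)))%C
      with (- (Ci * Ci) * (G' (circle r t) * circle r t))%C by ring.
    replace (Ci * Ci)%C with (- (1))%C by (unfold Ci, Cmult, Copp; simpl; apply injective_projections; simpl; ring).
    ring.
Qed.

(** The margin beyond [0, 1] allows differentiation in [lam] at the endpoints too. It is chosen so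
    that [|1 - lam| + |lam| < 2 - r], while [(2 - r) r < 1]. *)
Lemma homotopy_in_disk (z w : C) (r lam : R) : 0 < r < 1 -> Cmod z < r -> Cmod w = r ->
  - ((1 - r) / 2) < lam < 1 + (1 - r) / 2 -> disk (z + lam * (w - z))%C.
Proof.
  intros Hr Hz Hw Hl. unfold disk.
  replace (z + lam * (w - z))%C with (RtoC (1 - lam) * z + lam * w)%C
    by (rewrite RtoC_minus; ring).
  eapply Rle_lt_trans; [apply Cmod_triangle|]. rewrite !Cmod_mult, !Cmod_R, Hw.
  assert (H0 := Cmod_ge_0 z).
  assert (H : Rabs (1 - lam) + Rabs lam < 1 + (1 - r)).
  { unfold Rabs. destruct (Rcase_abs (1 - lam)), (Rcase_abs lam); lra. }
  assert (Rabs (1 - lam) * Cmod z <= Rabs (1 - lam) * r)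
    by (apply Rmult_le_compat_l; [apply Rabs_pos|lra]).
  apply Rle_lt_trans with ((Rabs (1 - lam) + Rabs lam) * r); [lra|]. nra.
Qed.

(* A pair of real variables is encoded as one complex variable, so that joint
   continuity is [ccont]. *)
Lemma continuity_2d_pt_ccont (G : R -> R -> C) (x y : R) :
  ccont (fun zeta => G (Re zeta) (Im zeta)) (x, y) ->
  continuity_2d_pt (fun u v => Re (G u v)) x y.
Proof.
  intros H e. destruct (H e (cond_pos e)) as [d [Hd K]].
  assert (Hd2 : 0 < d / 2) by lra. exists (mkposreal _ Hd2). simpl. intros u v Hu Hv.
  specialize (K (u, v)). simpl in K. eapply Rle_lt_trans; [|apply K].
  - rewrite <- Re_minus. apply re_le_Cmod.
  - replace d with (2 * (d / 2)) by field. apply Cmod_lt_of_parts; simpl; auto.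
Qed.

Lemma ccont_Re (z : C) : ccont (fun w => RtoC (Re w)) z.
Proof.
  intros e He. exists e. split; auto. intros w Hw. rewrite <- RtoC_minus, Cmod_R, <- Re_minus.
  eapply Rle_lt_trans; [apply re_le_Cmod|exact Hw].
Qed.

Lemma ccont_Im (p : R -> C) (z l : C) : rder p (Im z) l -> ccont (fun w => p (Im w)) z.
Proof.
  intros Hp e He. destruct (rder_cont p _ _ Hp e He) as [d [Hd K]].
  exists d. split; auto. intros w Hw. apply K. rewrite <- Im_minus.
  eapply Rle_lt_trans; [apply im_le_Cmod|exact Hw].
Qed.

Lemma rder_scal (c : C) (F : R -> C) (t : R) (l : C) : rder F t l ->
  rder (fun s => c * F s)%C t (c * l)%C.
Proof.
  intros H. apply (rder_comp (fun w => c * w)%C F t c l H).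
  eapply cder_eq; [|apply (cder_mult _ _ _ _ _ (cder_const c (F t)) (cder_id (F t)))].
  ring.
Qed.

Definition cauchy_kernel (z w : C) : C := (w / (w - z))%C.

Lemma ccont_cauchy_kernel (z w : C) : w <> z -> ccont (cauchy_kernel z) w.
Proof.
  intros H. apply ccont_mult; [apply ccont_id|]. apply ccont_inv.
  - apply ccont_plus; [apply ccont_id|apply ccont_const].
  - intros E. apply H. replace w with ((w - z) + z)%C by ring. rewrite E. ring.
Qed.

(* The integral of [h (z + lam (w - z)) w / (w - z)] over the circle does not
   depend on [lam] in [0, 1]: its derivative in [lam] is the integral of a
   tangential derivative. *)
Lemma cauchy_homotopy_Re (h h' : C -> C) (kappa z : C) (r : R) :
  C1_on_disk h h' -> 0 < r < 1 -> Cmod z < r ->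
  RInt (fun t => Re (kappa * (h (circle r t) * cauchy_kernel z (circle r t)))%C) 0 (2 * PI) =
  RInt (fun t => Re (kappa * (h z * cauchy_kernel z (circle r t)))%C) 0 (2 * PI).
Proof.
  intros Hh Hr Hz.
  assert (Hwz : forall t, circle r t <> z).
  { intros t E. rewrite <- E, Cmod_circle in Hz; lra. }
  assert (Hwz' : forall t, (circle r t - z)%C <> 0%C).
  { intros t E. apply (Hwz t). replace (circle r t) with ((circle r t - z) + z)%C by ring.
    rewrite E. ring. }
  set (gam := fun lam t => (z + RtoC lam * (circle r t - z))%C).
  set (phi2 := fun lam t => Re (kappa * (h (gam lam t) * cauchy_kernel z (circle r t)))%C).
  (* The [lam]-derivative of the integrand: the factor [w - z] from the chain rule cancels the pole
     of the kernel. *)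
  set (psi := fun lam t => (kappa * (h' (gam lam t) * circle r t))%C).
  set (eta := (1 - r) / 2). assert (Heta : 0 < eta) by (unfold eta; lra).
  assert (Hgam : forall lam t, - eta < lam < 1 + eta -> disk (gam lam t)).
  { intros lam t Hl. apply homotopy_in_disk with r; auto. apply Cmod_circle; lra. }
  assert (D1 : forall lam t, - eta < lam < 1 + eta ->
     is_derive (fun u => phi2 u t) lam (Re (psi lam t))).
  { intros lam t Hl. unfold phi2, psi.
    assert (D := rder_scal (kappa * cauchy_kernel z (circle r t))%C _ _ _
      (rder_comp h (fun u => gam u t) lam _ _
      (rder_affine z (circle r t - z)%C lam) (proj1 (Hh _ (Hgam lam t Hl))))).
    destruct D as [D _].
    replace (kappa * (h' (gam lam t) * circle r t))%C with
      (kappa * cauchy_kernel z (circle r t) * (h' (gam lam t) * (circle r t - z)))%C.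
    - eapply is_derive_ext; [|exact D]. intros u. cbv beta. f_equal. ring.
    - unfold cauchy_kernel. field. auto. }
  assert (Cpsi : forall lam t, - eta < lam < 1 + eta ->
    ccont (fun zeta => psi (Re zeta) (Im zeta)) (lam, t)).
  { intros lam t Hl. unfold psi.
    assert (Cc : ccont (fun zeta => circle r (Im zeta)) (lam, t))
      by (apply (ccont_Im (circle r) _ _ (rder_circle r _))).
    assert (Cg : ccont (fun zeta => gam (Re zeta) (Im zeta)) (lam, t)).
    { unfold gam. apply ccont_plus; [apply ccont_const|]. apply ccont_mult; [apply ccont_Re|].
      apply ccont_plus; [exact Cc|apply ccont_const]. }
    apply ccont_mult; [apply ccont_const|]. apply ccont_mult; [|exact Cc].
    apply (ccont_comp (fun zeta => gam (Re zeta) (Im zeta)) h'); [exact Cg|].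
    apply Hh, Hgam; auto. }
  assert (EI : forall lam, - eta < lam < 1 + eta -> ex_RInt (phi2 lam) 0 (2 * PI)).
  { intros lam Hl. apply (ex_RInt_continuous (V := R_CompleteNormedModule)). intros t _.
    apply (continuous_ccont (fun w => kappa * (h (z + RtoC lam * (w - z)) * cauchy_kernel z w))%C
       (circle r) t _ (rder_circle r t)).
    apply ccont_mult; [apply ccont_const|]. apply ccont_mult; [|apply ccont_cauchy_kernel; auto].
    apply (ccont_comp (fun w => z + RtoC lam * (w - z))%C h).
    - apply ccont_plus; [apply ccont_const|]. apply ccont_mult; [apply ccont_const|].
      apply ccont_plus; [apply ccont_id|apply ccont_const].
    - apply (cder_ccont _ _ _ (proj1 (Hh _ (Hgam lam t Hl)))). }
  assert (Loc : forall lam, - eta < lam < 1 + eta ->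
    locally lam (fun u => - eta < u < 1 + eta)).
  { intros lam Hl. apply (open_and _ _ (open_gt (- eta)) (open_lt (1 + eta))). exact Hl. }
  assert (DI : forall lam, 0 <= lam <= 1 ->
     is_derive (fun u => RInt (phi2 u) 0 (2 * PI)) lam
        (RInt (fun t => Re (psi lam t)) 0 (2 * PI))).
  { intros lam Hl. assert (Hl' : - eta < lam < 1 + eta) by lra.
    assert (DP := is_derive_RInt_param phi2 0 (2 * PI) lam).
    replace (RInt (fun t => Re (psi lam t)) 0 (2 * PI))
      with (RInt (fun t => Derive (fun u => phi2 u t) lam) 0 (2 * PI)).
    - apply DP.
      + eapply filter_imp; [|apply (Loc lam Hl')]. intros u Hu t _.
        exists (Re (psi u t)). apply D1; auto.
      + intros t _. apply continuity_2d_pt_ext_loc with (f := fun u v => Re (psi u v)).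
        * destruct (Loc lam Hl') as [d Hd]. exists d. intros u v Hu _.
          symmetry. apply is_derive_unique, D1, Hd. exact Hu.
        * apply continuity_2d_pt_ccont, Cpsi; auto.
      + eapply filter_imp; [|apply (Loc lam Hl')]. intros u Hu. apply EI; auto.
    - apply RInt_ext. intros t _. apply is_derive_unique, D1; auto. }
  (* For [lam <> 0], [psi] is [kappa / lam] times [w] times the [w]-derivative of
     [h (z + lam (w - z))], so its integral vanishes. The mean value theorem asks for this only in
     the open interval. *)
  assert (Z : forall lam, 0 < lam < 1 -> RInt (fun t => Re (psi lam t)) 0 (2 * PI) = 0).
  { intros lam Hl. assert (Hl' : - eta < lam < 1 + eta) by lra.
    assert (HI := is_CInt_derive (fun w => h (z + RtoC lam * (w - z)))%C
      (fun w => RtoC lam * h' (z + RtoC lam * (w - z)))%C r).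
    assert (Hl0 : RtoC lam <> 0%C) by (intros E; apply RtoC_inj in E; lra).
    lapply HI; [clear HI; intros HI; lapply HI; [clear HI; intros HI|]|].
    - apply (is_CInt_scal (kappa / lam)%C) in HI.
      assert (HI2 : is_CInt (fun t => psi lam t) 0%C).
      { eapply is_CInt_eq; [|eapply is_CInt_ext; [|exact HI]]; [ring|].
        intros t. unfold psi, gam. field. auto. }
      apply is_RInt_unique. apply HI2.
    - intros t. apply ccont_mult; [apply ccont_const|].
      apply (ccont_comp (fun w => z + RtoC lam * (w - z))%C h').
      + apply ccont_plus; [apply ccont_const|]. apply ccont_mult; [apply ccont_const|].
        apply ccont_plus; [apply ccont_id|apply ccont_const].
      + apply (proj2 (Hh _ (Hgam lam t Hl'))).
    - intros t.
      assert (D := cder_scale (fun y => h (z - lam * z + y))%C lam (circle r t)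
         (h' (gam lam t))).
      apply (cder_ext_loc (fun w => h (z - lam * z + lam * w))%C _ 1);
        [lra|intros w _; f_equal; ring|].
      apply D.
      destruct (proj1 (Hh _ (Hgam lam t Hl'))) as [g [Hg [Cg [d [Hd K]]]]].
      assert (Eg : forall y, (z - lam * z + y - gam lam t = y - lam * circle r t)%C)
        by (intros y; unfold gam; ring).
      assert (Eg2 : (z - lam * z + lam * circle r t)%C = gam lam t) by (unfold gam; ring).
      exists (fun y => g (z - lam * z + y)%C). split; [rewrite Eg2; exact Hg|]. split.
      + apply (ccont_comp (fun y => z - lam * z + y)%C g).
        * apply ccont_plus; [apply ccont_const|apply ccont_id].
        * rewrite Eg2. exact Cg.
      + exists d. split; auto. intros y Hy. rewrite Eg2, K; rewrite Eg; auto. }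
  destruct (MVT_cor2 (fun u => RInt (phi2 u) 0 (2 * PI))
    (fun u => RInt (fun t => Re (psi u t)) 0 (2 * PI)) 0 1) as [c [E Hc]].
  - lra.
  - intros c Hc. apply is_derive_Reals, DI. exact Hc.
  - rewrite (Z c Hc), Rmult_0_l in E.
    apply Rminus_diag_uniq in E. unfold phi2, gam in E.
    transitivity (RInt (fun t => Re (kappa * (h (z + RtoC 1 * (circle r t - z)) *
       cauchy_kernel z (circle r t)))%C) 0 (2 * PI)); [|etransitivity; [exact E|]].
    + apply RInt_ext. intros t _. do 4 f_equal. ring.
    + apply RInt_ext. intros t _. do 4 f_equal. ring.
Qed.

(** * Taylor coefficients and Vitali's theorem *)

Lemma cauchy_homotopy (h h' : C -> C) (z : C) (r : R) :
  C1_on_disk h h' -> 0 < r < 1 -> Cmod z < r ->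
  CInt (fun t => h (circle r t) * cauchy_kernel z (circle r t))%C =
  CInt (fun t => h z * cauchy_kernel z (circle r t))%C.
Proof.
  intros Hh Hr Hz. unfold CInt. f_equal.
  - assert (E := cauchy_homotopy_Re h h' 1%C z r Hh Hr Hz).
    etransitivity; [|etransitivity; [exact E|]];
    apply RInt_ext; intros t _; f_equal; ring.
  (* The factor [kappa = -i] turns imaginary parts into real parts. *)
  - assert (E := cauchy_homotopy_Re h h' (- Ci)%C z r Hh Hr Hz).
    assert (X : forall x : C, Im x = Re (- Ci * x)%C).
    { intros x. unfold Re, Im; simpl. ring. }
    etransitivity; [|etransitivity; [exact E|]];
    apply RInt_ext; intros t _; [apply X|symmetry; apply X].
Qed.

Fixpoint csum (u : nat -> C) (N : nat) : C :=
  match N with O => 0%C | S n => (csum u n + u n)%C end.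

(** For analytic [h] this is [2 pi] times the Taylor coefficient of index [k] at 0. *)
Definition circle_moment (h : C -> C) (r : R) (k : nat) : C :=
  CInt (fun t => h (circle r t) * (/ circle r t) ^ k)%C.

Lemma ccont_pow (f : C -> C) (z : C) (k : nat) : ccont f z -> ccont (fun w => f w ^ k)%C z.
Proof.
  intros Hf. induction k as [|k IH]; [apply (ccont_const 1%C)|].
  apply (ccont_mult f (fun w => f w ^ k)%C z Hf IH).
Qed.

Lemma ccont_inv_pow (r t : R) (k : nat) : 0 < r -> ccont (fun w => (/ w) ^ k)%C (circle r t).
Proof.
  intros Hr. apply ccont_pow, ccont_inv; [apply ccont_id|apply circle_neq_0; auto].
Qed.

Lemma Cmod_cauchy_kernel_le (z : C) (r t : R) : 0 < r -> Cmod z < r ->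
  Cmod (cauchy_kernel z (circle r t)) <= / (1 - Cmod z / r).
Proof.
  intros Hr Hz. assert (Hc := Cmod_circle r t (Rlt_le _ _ Hr)).
  assert (H1 := Cmod_sub_ge (circle r t) z). rewrite Hc in H1.
  assert (Hn : (circle r t - z)%C <> 0%C) by (apply neq_0_of_Cmod; lra).
  unfold cauchy_kernel. rewrite Cmod_div, Hc by auto.
  replace (/ (1 - Cmod z / r)) with (r / (r - Cmod z)) by (field; lra).
  apply Rmult_le_compat_l; [lra|]. apply Rinv_le_contravar; lra.
Qed.

(** Finite geometric expansion with exact remainder, from the identity
    [w/(w - z) = 1 + (z/w) (w/(w - z))]. *)
Lemma cauchy_kernel_expansion (h : C -> C) (z : C) (r : R) :
  0 < r -> Cmod z < r -> (forall t, ccont h (circle r t)) ->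
  forall N, is_CInt
    (fun t => h (circle r t) * (z / circle r t) ^ N * cauchy_kernel z (circle r t))%C
    (CInt (fun t => h (circle r t) * cauchy_kernel z (circle r t))%C -
      csum (fun k => circle_moment h r k * z ^ k)%C N)%C.
Proof.
  intros Hr Hz Hh N.
  assert (Hwz : forall t, circle r t <> z).
  { intros t E. rewrite <- E, Cmod_circle in Hz; lra. }
  induction N as [|N IH].
  - eapply is_CInt_eq; [|eapply is_CInt_ext;
      [|apply (is_CInt_circle (fun w => h w * cauchy_kernel z w)%C r)]].
    + simpl. ring.
    + intros t. simpl. ring.
    + intros t. apply ccont_mult; auto. apply ccont_cauchy_kernel; auto.
  - assert (HM : is_CInt (fun t => h (circle r t) * (/ circle r t) ^ N)%C (circle_moment h r N)).
    { apply (is_CInt_circle (fun w => h w * (/ w) ^ N)%C r). intros t. apply ccont_mult; auto.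
      apply ccont_inv_pow; auto. }
    apply (is_CInt_scal (- z ^ N)%C) in HM.
    eapply is_CInt_eq; [|eapply is_CInt_ext; [|exact (is_CInt_plus _ _ _ _ IH HM)]].
    + simpl. ring.
    + intros t. cbv beta. assert (Hw := circle_neq_0 r t Hr).
      assert (Hn : (circle r t - z)%C <> 0%C).
      { intros E. apply (Hwz t). replace (circle r t) with ((circle r t - z) + z)%C by ring.
        rewrite E. ring. }
      set (w := circle r t) in *.
      replace (- z ^ N * (h w * (/ w) ^ N))%C with (- (h w * (z / w) ^ N))%C
        by (unfold Cdiv; rewrite Cpow_mult_l; ring).
      cbn [Cpow]. unfold cauchy_kernel. field. auto.
Qed.

Lemma circle_moment_one_S (r : R) (k : nat) : 0 < r ->
  circle_moment (fun _ => 1%C) r (S k) = 0%C.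
Proof.
  intros Hr. apply is_CInt_unique.
  assert (Hk : RtoC (INR (S k)) <> 0%C).
  { intros E. apply RtoC_inj in E. generalize (pos_INR k). rewrite S_INR in E. lra. }
  assert (Cpow_der : forall (n : nat) (w : C), cder (fun w => w ^ (S n))%C w (INR (S n) * w ^ n)%C).
  { induction n as [|n IH]; intros w.
    - eapply cder_eq; [|apply (cder_mult _ _ _ _ _ (cder_id w) (cder_const 1%C w))].
      simpl. ring.
    - eapply cder_eq; [|apply (cder_mult _ _ _ _ _ (cder_id w) (IH w))].
      rewrite (S_INR (S n)), RtoC_plus. cbn [Cpow]. ring. }
  assert (H := is_CInt_derive (fun w => / w ^ (S k))%C
    (fun w => - (INR (S k)) * ((/ w) ^ (S k) * / w))%C r).
  lapply H; [clear H; intros H; lapply H; [clear H; intros H|]|].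
  - apply (is_CInt_scal (- / INR (S k))%C) in H.
    eapply is_CInt_eq; [|eapply is_CInt_ext; [|exact H]]; [ring|].
    intros t. cbv beta. assert (Hw := circle_neq_0 r t Hr). field. auto.
  - intros t. apply ccont_mult; [apply ccont_const|]. apply ccont_mult.
    + apply ccont_inv_pow; auto.
    + apply ccont_inv; [apply ccont_id|apply circle_neq_0; auto].
  - intros t. assert (Hw := circle_neq_0 r t Hr).
    assert (Hp : forall n, (circle r t ^ n)%C <> 0%C) by (intros n; apply Cpow_nz; auto).
    eapply cder_eq; [|apply (cder_inv _ _ _ (Cpow_der k (circle r t)) (Hp (S k)))].
    rewrite Cpow_inv by auto. cbn [Cpow]. field. auto.
Qed.

Lemma circle_moment_one_0 (r : R) : circle_moment (fun _ => 1%C) r 0 = RtoC (2 * PI).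
Proof.
  apply is_CInt_unique. split.
  - apply (is_RInt_ext (fun _ => 1)); [intros t _; simpl; ring|].
    replace (Re (RtoC (2 * PI))) with (scal (2 * PI - 0) 1)
      by (unfold scal; simpl; unfold mult; simpl; ring).
    apply (is_RInt_const (V := R_NormedModule)).
  - apply (is_RInt_ext (fun _ => 0)); [intros t _; simpl; ring|].
    replace (Im (RtoC (2 * PI))) with (scal (2 * PI - 0) 0)
      by (unfold scal; simpl; unfold mult; simpl; ring).
    apply (is_RInt_const (V := R_NormedModule)).
Qed.

Lemma Cmod_remainder_le (h : C -> C) (z : C) (r t M : R) (N : nat) :
  0 < r -> Cmod z < r -> Cmod (h (circle r t)) <= M ->
  Cmod (h (circle r t) * (z / circle r t) ^ N * cauchy_kernel z (circle r t))%C <=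
    M * (Cmod z / r) ^ N * / (1 - Cmod z / r).
Proof.
  intros Hr Hz HM. assert (Hw := circle_neq_0 r t Hr).
  rewrite !Cmod_mult, Cmod_pow, Cmod_div, Cmod_circle by (auto; lra).
  assert (Hq : 0 <= (Cmod z / r) ^ N).
  { apply pow_le, Rmult_le_pos; [apply Cmod_ge_0|left; apply Rinv_0_lt_compat; auto]. }
  apply Rmult_le_compat; [apply Rmult_le_pos; auto using Cmod_ge_0|apply Cmod_ge_0| |
    apply Cmod_cauchy_kernel_le; auto].
  apply Rmult_le_compat_r; auto.
Qed.

Lemma csum_moment_one (r : R) (z : C) (N : nat) : 0 < r ->
  csum (fun k => circle_moment (fun _ => 1%C) r k * z ^ k)%C (S N) = RtoC (2 * PI).
Proof.
  intros Hr. induction N as [|N IH].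
  - cbn [csum Cpow]. rewrite circle_moment_one_0. ring.
  - cbn [csum] in *. rewrite IH, circle_moment_one_S by auto. ring.
Qed.

Definition taylor_coef (h : C -> C) (r : R) (k : nat) : C :=
  (circle_moment h r k / RtoC (2 * PI))%C.

Lemma csum_scal (c : C) (u : nat -> C) (N : nat) :
  csum (fun k => c * u k)%C N = (c * csum u N)%C.
Proof. induction N as [|N IH]; simpl; [ring|]. rewrite IH. ring. Qed.

Lemma csum_ext (u v : nat -> C) (N : nat) : (forall k, u k = v k) -> csum u N = csum v N.
Proof. intros H. induction N as [|N IH]; simpl; congruence. Qed.

Lemma two_PI_neq_0 : RtoC (2 * PI) <> 0%C.
Proof. intros E. apply RtoC_inj in E. generalize two_PI_pos. lra. Qed.

Lemma Cmod_two_PI : Cmod (RtoC (2 * PI)) = 2 * PI.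
Proof. rewrite Cmod_R. apply Rabs_pos_eq. generalize two_PI_pos. lra. Qed.

(** The integral [k0] of the kernel is never evaluated. The expansion is applied to [h] and to the
    constant 1: the first gives [h z * k0] close to [2 pi] times the Taylor sum, the second gives
    [k0] close to [2 pi]. These two errors account for the factor 2. *)
Lemma taylor_remainder (h h' : C -> C) (r M : R) (z : C) (N : nat) :
  C1_on_disk h h' -> 0 < r < 1 -> Cmod z < r -> (forall w, Cmod w <= r -> Cmod (h w) <= M) ->
  Cmod (h z - csum (fun k => taylor_coef h r k * z ^ k)%C (S N))%C <=
    2 * (M * (Cmod z / r) ^ S N * / (1 - Cmod z / r)).
Proof.
  intros Hh Hr Hz HM. assert (Hr0 : 0 < r) by lra.
  assert (Hcc : forall t, ccont h (circle r t)).
  { intros t. apply (cder_ccont _ _ _ (proj1 (Hh (circle r t) ltac:(unfold disk; rewrite Cmod_circle; lra)))). }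
  assert (HMc : forall t, Cmod (h (circle r t)) <= M)
    by (intros t; apply HM; rewrite Cmod_circle; lra).
  set (B := (Cmod z / r) ^ S N * / (1 - Cmod z / r)).
  assert (E1 := cauchy_kernel_expansion h z r Hr0 Hz Hcc (S N)).
  assert (E2 := cauchy_kernel_expansion (fun _ => 1%C) z r Hr0 Hz (fun t => ccont_const _ _) (S N)).
  rewrite csum_moment_one in E2 by auto.
  rewrite (cauchy_homotopy h h' z r Hh Hr Hz) in E1.
  assert (HK : is_CInt (fun t => cauchy_kernel z (circle r t)) (CInt (fun t => cauchy_kernel z (circle r t)))).
  { apply is_CInt_circle. intros t. apply ccont_cauchy_kernel.
    intros E. rewrite <- E, Cmod_circle in Hz; lra. }
  rewrite (is_CInt_unique _ _ (is_CInt_scal (h z) _ _ HK)) in E1.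
  replace (CInt (fun t => 1 * cauchy_kernel z (circle r t))%C)
    with (CInt (fun t => cauchy_kernel z (circle r t))) in E2.
  2:{ symmetry. apply is_CInt_unique. eapply is_CInt_ext; [|exact HK]. intros t. cbv beta. ring. }
  set (k0 := CInt (fun t => cauchy_kernel z (circle r t))) in *.
  apply is_CInt_bound with (M := M * B) in E1.
  2:{ intros t. unfold B. rewrite <- Rmult_assoc. apply Cmod_remainder_le; auto. }
  apply is_CInt_bound with (M := 1 * B) in E2.
  2:{ intros t. unfold B. rewrite <- Rmult_assoc.
      apply (Cmod_remainder_le (fun _ => 1%C)); auto. rewrite Cmod_1. lra. }
  assert (Es : csum (fun k => circle_moment h r k * z ^ k)%C (S N) =
    (RtoC (2 * PI) * csum (fun k => taylor_coef h r k * z ^ k)%C (S N))%C).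
  { rewrite <- csum_scal. apply csum_ext. intros k. unfold taylor_coef. field. apply two_PI_neq_0. }
  rewrite Es in E1. set (s := csum (fun k => taylor_coef h r k * z ^ k)%C (S N)) in *.
  assert (HP := two_PI_pos).
  apply Rmult_le_reg_l with (2 * PI); auto.
  rewrite <- Cmod_two_PI at 1. rewrite <- Cmod_mult.
  replace (RtoC (2 * PI) * (h z - s))%C
    with ((h z * k0 - RtoC (2 * PI) * s) - h z * (k0 - RtoC (2 * PI)))%C by ring.
  eapply Rle_trans; [apply Cmod_sub_le|]. rewrite Cmod_mult.
  assert (HM1 := HM z ltac:(lra)).
  assert (Cmod (h z) * Cmod (k0 - RtoC (2 * PI))%C <= M * (2 * PI * (1 * B)))
    by (apply Rmult_le_compat; auto using Cmod_ge_0).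
  rewrite (Rmult_assoc M). fold B. lra.
Qed.

(** The mean value property, since the kernel centred at 0 is identically 1. It is used on the
    denominator to bound [a2]. *)
Lemma center_le_circle (h h' : C -> C) (r M : R) :
  C1_on_disk h h' -> 0 < r < 1 -> (forall w, Cmod w = r -> Cmod (h w) <= M) ->
  Cmod (h 0%C) <= M.
Proof.
  intros Hh Hr HM. assert (HP := two_PI_pos).
  assert (Hk : forall t, cauchy_kernel 0 (circle r t) = 1%C).
  { intros t. assert (Hw := circle_neq_0 r t (proj1 Hr)). unfold cauchy_kernel.
    replace (circle r t - 0)%C with (circle r t) by ring. field. exact Hw. }
  assert (E := cauchy_homotopy h h' 0%C r Hh Hr ltac:(rewrite Cmod_0; lra)).
  assert (HC : is_CInt (fun t => h 0%C * cauchy_kernel 0 (circle r t))%C (h 0%C * RtoC (2 * PI))%C).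
  { apply is_CInt_scal. apply (is_CInt_ext (fun t => 1 * (/ circle r t) ^ 0)%C).
    - intros t. rewrite Hk. simpl. ring.
    - rewrite <- (circle_moment_one_0 r).
      apply (is_CInt_circle (fun w => 1 * (/ w) ^ 0)%C r). intros t.
      apply ccont_mult; [apply ccont_const|apply ccont_inv_pow; lra]. }
  rewrite (is_CInt_unique _ _ HC) in E.
  assert (HD : is_CInt (fun t => h (circle r t) * cauchy_kernel 0 (circle r t))%C
    (h 0%C * RtoC (2 * PI))%C).
  { rewrite <- E. apply (is_CInt_circle (fun w => h w * cauchy_kernel 0 w)%C r). intros t.
    apply ccont_mult.
    - apply (cder_ccont _ _ _ (proj1 (Hh (circle r t) ltac:(unfold disk; rewrite Cmod_circle; lra)))).
    - apply ccont_cauchy_kernel, circle_neq_0; lra. }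
  apply is_CInt_bound with (M := M) in HD.
  - rewrite Cmod_mult, Cmod_two_PI in HD. nra.
  - intros t. rewrite Hk, Cmult_1_r. apply HM. apply Cmod_circle; lra.
Qed.

Lemma Cmod_csum_le (u : nat -> C) (c : R) (N : nat) :
  (forall k, (k < N)%nat -> Cmod (u k) <= c) -> Cmod (csum u N) <= INR N * c.
Proof.
  intros H. induction N as [|N IH].
  - simpl. rewrite Cmod_0. lra.
  - rewrite S_INR. simpl csum. eapply Rle_trans; [apply Cmod_triangle|].
    assert (H1 := H N ltac:(lia)). assert (H2 := IH ltac:(intros k Hk; apply H; lia)). lra.
Qed.

(* Vitali: a bounded sequence tending to zero on a radius tends to zero on the
   disk, since each Taylor coefficient tends to zero. *)
Lemma vitali (h h' : nat -> C -> C) (r M : R) :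
  (forall n, C1_on_disk (h n) (h' n)) -> 0 < r < 1 -> 0 < M ->
  (forall n w, Cmod w <= r -> Cmod (h n w) <= M) ->
  (forall t eps, 0 < t < r -> 0 < eps -> exists N, forall n, (N <= n)%nat -> Cmod (h n (RtoC t)) < eps) ->
  forall rho eps, 0 < rho < r -> 0 < eps ->
  exists N, forall n, (N <= n)%nat -> forall z, Cmod z <= rho -> Cmod (h n z) < eps.
Proof.
  intros Hh Hr HM0 HM Hray.
  assert (Hcoef : forall K eps, 0 < eps -> exists N, forall n, (N <= n)%nat ->
    forall k, (k < K)%nat -> Cmod (taylor_coef (h n) r k) < eps).
  { induction K as [|K IH]; intros eps He.
    - exists O. intros; lia.
    (* Coefficient [K] is isolated by evaluating at one small [t]. For [t <= r/2] the Taylor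
       remainder is at most [D t^(K+1)], hence at most [(eps/2) t^K]. Only after [t] is fixed is [n]
       taken large. *)
    - set (D := 4 * M / r ^ S K). assert (HrK : 0 < r ^ S K) by (apply pow_lt; lra).
      assert (HD : 0 < D) by (apply Rdiv_lt_0_compat; lra).
      set (t := Rmin (r / 2) (eps / (2 * D))).
      assert (Ht0 : 0 < t) by (apply Rmin_glb_lt; [lra|apply Rdiv_lt_0_compat; lra]).
      assert (Ht1 : t <= r / 2) by apply Rmin_l.
      assert (Ht2 : D * t <= eps / 2).
      { apply Rle_trans with (D * (eps / (2 * D))).
        - apply Rmult_le_compat_l; [lra|apply Rmin_r].
        - right. field. lra. }
      assert (HtK : 0 < t ^ K) by (apply pow_lt; auto).
      assert (HK1 : 0 < INR (S K)) by (apply lt_0_INR; lia).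
      (* The [K] earlier terms together contribute at most [eps t^K / 8], as does [h n t]; the cap
         by [eps] covers the earlier coefficients themselves. *)
      set (e1 := Rmin eps (eps * t ^ K / (8 * INR (S K)))).
      assert (He1 : 0 < e1).
      { apply Rmin_glb_lt; auto. apply Rdiv_lt_0_compat; [apply Rmult_lt_0_compat; auto|lra]. }
      destruct (IH e1 He1) as [N1 H1].
      destruct (Hray t (eps * t ^ K / 8)) as [N2 H2];
        [lra|assert (0 < eps * t ^ K) by (apply Rmult_lt_0_compat; auto); lra|].
      exists (max N1 N2). intros n Hn k Hk.
      specialize (H1 n ltac:(lia)). specialize (H2 n ltac:(lia)).
      destruct (Nat.eq_dec k K) as [->|Hne].
      2:{ eapply Rlt_le_trans; [apply H1; lia|apply Rmin_l]. }
      assert (Hmt : Cmod (RtoC t) = t) by (rewrite Cmod_R; apply Rabs_pos_eq; lra).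
      assert (E := taylor_remainder (h n) (h' n) r M (RtoC t) K (Hh n) Hr ltac:(lra) (HM n)).
      rewrite Hmt in E. cbn [csum] in E.
      set (a := taylor_coef (h n) r) in *.
      set (s := csum (fun k => a k * RtoC t ^ k)%C K) in *.
      assert (Hs : Cmod s <= INR K * e1).
      { apply Cmod_csum_le. intros j Hj. rewrite Cmod_mult, Cmod_pow, Hmt.
        specialize (H1 j Hj).
        assert (0 <= t ^ j <= 1).
        { split; [apply pow_le; lra|]. rewrite <- (pow1 j). apply pow_incr. lra. }
        generalize (Cmod_ge_0 (a j)). nra. }
      assert (Hs2 : INR K * e1 <= eps * t ^ K / 8).
      { apply Rle_trans with (INR (S K) * (eps * t ^ K / (8 * INR (S K)))).
        - apply Rmult_le_compat; [apply pos_INR|lra| |apply Rmin_r]. rewrite S_INR; lra.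
        - right. field. lra. }
      assert (Hq : t / r <= 1 / 2).
      { apply Rmult_le_reg_r with r; [lra|]. unfold Rdiv. rewrite Rmult_assoc, Rinv_l by lra. lra. }
      assert (Hrem : 2 * (M * (t / r) ^ S K * / (1 - t / r)) <= D * t * t ^ K).
      { apply Rle_trans with (2 * (M * (t / r) ^ S K * 2)).
        - apply Rmult_le_compat_l; [lra|]. apply Rmult_le_compat_l.
          + apply Rmult_le_pos; [lra|]. apply pow_le. apply Rmult_le_pos; [lra|].
            left; apply Rinv_0_lt_compat; lra.
          + replace 2 with (/ (1 / 2)) by field. apply Rinv_le_contravar; lra.
        - right. unfold D. unfold Rdiv at 1. rewrite Rpow_mult_distr, pow_inv.
          rewrite <- (tech_pow_Rmult t K). field. lra. }
      assert (Hak : Cmod (a K) * t ^ K < eps * t ^ K).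
      { replace (Cmod (a K) * t ^ K) with (Cmod (a K * RtoC t ^ K)%C)
          by (rewrite Cmod_mult, Cmod_pow, Hmt; reflexivity).
        replace (a K * RtoC t ^ K)%C
          with (h n (RtoC t) - s - (h n (RtoC t) - (s + a K * RtoC t ^ K)))%C by ring.
        eapply Rle_lt_trans; [apply Cmod_sub_le|].
        assert (X := Cmod_sub_le (h n (RtoC t)) s).
        assert (D * t * t ^ K <= eps / 2 * t ^ K) by (apply Rmult_le_compat_r; lra).
        assert (0 < eps * t ^ K) by (apply Rmult_lt_0_compat; auto). lra. }
      apply Rmult_lt_reg_r with (t ^ K); auto. }
  intros rho eps Hrho He.
  set (q := rho / r).
  assert (Hq0 : 0 < q) by (apply Rdiv_lt_0_compat; lra).
  assert (Hq1 : q < 1).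
  { apply Rmult_lt_reg_r with r; [lra|]. unfold q, Rdiv. rewrite Rmult_assoc, Rinv_l by lra. lra. }
  (* This threshold makes the remainder [2 M q^K / (1 - q)] at most [eps/4]. *)
  destruct (pow_lt_1_zero q) with (y := eps * (1 - q) / (8 * M)) as [K0 HK0].
  { rewrite Rabs_pos_eq; lra. }
  { apply Rdiv_lt_0_compat; [apply Rmult_lt_0_compat; lra|lra]. }
  set (K := S K0).
  assert (HK1 : 0 < INR K) by (apply lt_0_INR; unfold K; lia).
  destruct (Hcoef K (eps / (4 * INR K))) as [N HN]; [apply Rdiv_lt_0_compat; lra|].
  exists N. intros n Hn z Hz. specialize (HN n Hn).
  assert (Hz0 := Cmod_ge_0 z).
  assert (E := taylor_remainder (h n) (h' n) r M z K0 (Hh n) Hr ltac:(lra) (HM n)).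
  fold K in E. set (s := csum (fun k => taylor_coef (h n) r k * z ^ k)%C K) in *.
  assert (Hs : Cmod s <= INR K * (eps / (4 * INR K))).
  { apply Cmod_csum_le. intros j Hj. rewrite Cmod_mult, Cmod_pow.
    specialize (HN j Hj).
    assert (0 <= Cmod z ^ j <= 1).
    { split; [apply pow_le; lra|]. rewrite <- (pow1 j). apply pow_incr. lra. }
    generalize (Cmod_ge_0 (taylor_coef (h n) r j)). nra. }
  replace (INR K * (eps / (4 * INR K))) with (eps / 4) in Hs by (field; lra).
  assert (Hzq : 0 <= Cmod z / r <= q).
  { split; [apply Rmult_le_pos; [lra|left; apply Rinv_0_lt_compat; lra]|].
    apply Rmult_le_compat_r; [left; apply Rinv_0_lt_compat; lra|auto]. }
  specialize (HK0 K ltac:(unfold K; lia)).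
  assert (HqK : 0 < q ^ K) by (apply pow_lt; auto). rewrite Rabs_pos_eq in HK0 by lra.
  assert (Hrem : 2 * (M * (Cmod z / r) ^ K * / (1 - Cmod z / r)) <= eps / 4).
  { apply Rle_trans with (2 * (M * q ^ K * / (1 - q))).
    - apply Rmult_le_compat_l; [lra|].
      assert (Hp : 0 <= (Cmod z / r) ^ K <= q ^ K) by (split; [apply pow_le; lra|apply pow_incr; lra]).
      apply Rmult_le_compat.
      + apply Rmult_le_pos; lra.
      + left; apply Rinv_0_lt_compat; lra.
      + apply Rmult_le_compat_l; lra.
      + apply Rinv_le_contravar; lra.
    - apply Rle_trans with (2 * (M * (eps * (1 - q) / (8 * M)) * / (1 - q))).
      + apply Rmult_le_compat_l; [lra|]. apply Rmult_le_compat_r; [left; apply Rinv_0_lt_compat; lra|].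
        apply Rmult_le_compat_l; lra.
      + right. field. lra. }
  replace (h n z) with (h n z - s + s)%C by ring.
  eapply Rle_lt_trans; [apply Cmod_triangle|]. lra.
Qed.

(** * Size of the normalized mapping *)

Lemma radial_ode_of_nehari (f : C -> C) (c : C) (T : R) : nehari f -> Cmod c = 1 -> T < 1 ->
  radial_ode T (fun t => Cmod (normalized_derivative f (c * t)%C))
    (fun t => Re (c * normalized_preschwarzian f (c * t))%C)
    (fun t => Im (c * normalized_preschwarzian f (c * t))%C)
    (fun t => Re (c ^ 2 * schwarzian f (c * t))%C) /\
  forall t, 0 <= t <= T ->
    rder (fun s => normalized_derivative f (c * s)%C) t
     (c * normalized_preschwarzian f (c * t) * normalized_derivative f (c * t))%C /\
    rder (fun s => c * normalized_preschwarzian f (c * s))%C t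
      (c ^ 2 * schwarzian f (c * t) + / 2 * (c * normalized_preschwarzian f (c * t)) ^ 2)%C.
Proof.
  intros Hf Hc HT. apply normalized_radial_ode; auto.
  intros t Ht. apply denominator_neq_0; auto. apply disk_ray; auto; lra.
Qed.

Lemma normalized_derivative_le (f : C -> C) (z : C) : nehari f -> disk z ->
  Cmod (normalized_derivative f z) <= / (1 - Cmod z ^ 2).
Proof.
  intros Hf Hz. destruct (polar z) as [c [Hc Ez]].
  unfold disk in Hz. assert (H0 := Cmod_ge_0 z).
  destruct (radial_ode_of_nehari f c (Cmod z) Hf Hc Hz) as [HO _].
  assert (H := modulus_le _ _ _ _ _ (Cmod z) HO ltac:(lra)). cbv beta in H.
  rewrite <- Ez in H. assert (H1 : 0 < 1 - Cmod z ^ 2) by nra.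
  apply Rmult_le_reg_r with (1 - Cmod z ^ 2); auto. rewrite Rinv_l by lra. exact H.
Qed.

Lemma normalized_0 (f : C -> C) : nehari f -> normalized f 0%C = 0%C.
Proof.
  intros Hf. assert (H0 : f 0%C = 0%C) by apply Hf. unfold normalized. rewrite H0.
  unfold Cdiv. ring.
Qed.

Lemma normalized_derivative_0 (f : C -> C) : nehari f -> normalized_derivative f 0%C = 1%C.
Proof.
  intros Hf. assert (H0 : f 0%C = 0%C) by apply Hf. assert (H1 : C_derive f 0%C = 1%C) by apply Hf.
  unfold normalized_derivative, denominator. rewrite H0, H1.
  replace (1 + a2 f * 0)%C with (RtoC 1) by ring. field.
Qed.

Lemma rder_normalized_ray (f : C -> C) (c : C) (t : R) : nehari f -> Cmod c = 1 -> 0 <= t < 1 ->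
  rder (fun s => normalized f (c * s)%C) t (c * normalized_derivative f (c * t))%C.
Proof.
  intros Hf Hc Ht. assert (Hd := disk_ray c t Hc Ht).
  apply rder_ray, cder_normalized; auto. apply denominator_neq_0; auto.
Qed.

Lemma C1_denominator (f : C -> C) : nehari f ->
  C1_on_disk (denominator f) (fun z => a2 f * C_derive f z)%C.
Proof.
  intros Hf z Hz. split; [apply cder_denominator; auto|].
  apply ccont_mult; [apply ccont_const|]. eapply cder_ccont, analytic_cder; auto.
  apply analytic_C_derive, Hf.
Qed.

(** Hence [1 + a2 f] and [1 - a2 g] are reciprocal, which carries estimates of [g] over to [f], both
    for the bound on [a2] and for [delta]. *)
Lemma denominator_normalized (f : C -> C) (z : C) : denominator f z <> 0%C ->
  (denominator f z * (1 - a2 f * normalized f z))%C = 1%C.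
Proof.
  unfold denominator, normalized. intros H. field. exact H.
Qed.

(** A Koebe-type bound from generous constants: for [t <= 1/10] the Schwarzian is at most 3, so the
    energy bound gives [|P| <= 3]; then [|A'| <= 4] and [|A - 1| <= 4/10], hence
    [|g(z) - z| <= 1/25]. *)
Lemma Cmod_normalized_ge (f : C -> C) (z : C) : nehari f -> Cmod z = 1 / 10 ->
  1 / 20 <= Cmod (normalized f z).
Proof.
  intros Hf Hz. destruct (polar z) as [c [Hc Ez]]. rewrite Hz in Ez.
  destruct (radial_ode_of_nehari f c (1 / 10) Hf Hc ltac:(lra)) as [HO HR].
  set (A := fun t : R => normalized_derivative f (c * t)%C) in *.
  set (P := fun t : R => (c * normalized_preschwarzian f (c * t))%C) in *.
  assert (HA : forall t, 0 <= t <= 1 / 10 -> Cmod (A t) <= 100 / 99).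
  { intros t Ht. assert (H := modulus_le _ _ _ _ _ t HO Ht).
    change (Cmod (A t) * (1 - t ^ 2) <= 1) in H.
    assert (H1 : 0 <= t ^ 2 <= 1 / 100) by nra. generalize (Cmod_ge_0 (A t)). nra. }
  assert (HE : forall t, 0 <= t <= 1 / 10 -> Cmod (P t) <= 3).
  { intros t Ht.
    assert (E := energy_bound (1 / 10) 3 A P (fun s => c ^ 2 * schwarzian f (c * s))%C ltac:(lra)).
    lapply E; [clear E; intros E; specialize (E t Ht)|].
    - replace (P 0) with (RtoC 0) in E.
      2:{ destruct HO as [_ [_ [Hp _]]]. unfold P. rewrite Cmult_0_r.
          unfold normalized_preschwarzian, preschwarzian, denominator.
          replace (f 0%C) with (RtoC 0) by (symmetry; apply Hf).
          replace (C_derive f 0%C) with (RtoC 1) by (symmetry; apply Hf).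
          replace (1 + a2 f * 0)%C with (RtoC 1) by ring. unfold a2. field. }
      replace (A 0) with (RtoC 1) in E.
      2:{ unfold A. rewrite Cmult_0_r. symmetry. apply normalized_derivative_0; auto. }
      rewrite Cmod_0, Cmod_1 in E.
      replace ((1 + 0 ^ 2 / 4) / 1) with 1 in E by field.
      assert (Hexp : exp ((1 + 3 / 2) * t) <= 3).
      { eapply Rle_trans; [|apply exp_le_3]. left. apply exp_increasing. lra. }
      assert (Hn : 0 < Cmod (A t)) by (apply HO; auto).
      assert (HAt := HA t Ht).
      assert (X : 1 + Cmod (P t) ^ 2 / 4 <= 3 * Cmod (A t)).
      { apply Rmult_le_reg_r with (/ Cmod (A t)); [apply Rinv_0_lt_compat; auto|].
        rewrite Rmult_assoc, Rinv_r by lra. unfold Rdiv in E at 1. lra. }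
      generalize (Cmod_ge_0 (P t)). nra.
    - intros s Hs. destruct (HR s Hs) as [D1 D2].
      split; [apply neq_0_of_Cmod; apply HO; auto|]. split; [exact D1|]. split; [exact D2|].
      eapply Rle_trans; [apply nehari_schwarzian_le; auto; lra|].
      assert (0 <= s ^ 2 <= 1 / 100) by nra.
      assert (98 / 100 <= (1 - s ^ 2) ^ 2) by nra.
      apply Rle_trans with (2 / (98 / 100)); [|lra].
      apply Rmult_le_compat_l; [lra|]. apply Rinv_le_contravar; lra. }
  assert (HA1 : forall t, 0 <= t <= 1 / 10 -> Cmod (A t - 1)%C <= 4 / 10).
  { intros t Ht. replace (RtoC 1) with (A 0).
    2:{ unfold A. rewrite Cmult_0_r. apply normalized_derivative_0; auto. }
    apply Rle_trans with (4 * t - 4 * 0); [|lra].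
    apply mean_value_ineq with (dF := fun t => (P t * A t)%C) (dB := fun _ => 4)
      (B := fun s => 4 * s); [lra| | |].
    - intros s Hs. apply HR. lra.
    - intros s Hs. auto_derive; auto. ring.
    - intros s Hs. rewrite Cmod_mult. assert (H1 := HA s ltac:(lra)). assert (H2 := HE s ltac:(lra)).
      generalize (Cmod_ge_0 (A s)) (Cmod_ge_0 (P s)). nra. }
  assert (HF : Cmod ((normalized f (c * (1 / 10)%R) - c * (1 / 10)%R) -
     (normalized f (c * 0%R) - c * 0%R))%C <= 4 / 10 * (1 / 10) - 4 / 10 * 0).
  { apply mean_value_ineq with
      (F := fun t : R => (normalized f (c * t) - c * t)%C)
      (dF := fun t => (c * (A t - 1))%C) (dB := fun _ => 4 / 10)
      (B := fun s => 4 / 10 * s); [lra| | |].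
    - intros s Hs. assert (Hd : disk (c * s)%C) by (apply disk_ray; auto; lra).
      apply (rder_ray (fun z => normalized f z - z)%C).
      apply (cder_ext_loc (fun w => normalized f w + - (1) * w)%C _ 1); [lra|intros; ring|].
      eapply cder_eq; [|exact (cder_plus _ _ _ _ _ (cder_normalized f _ Hf Hd
        (denominator_neq_0 f _ Hf Hd)) (cder_mult _ _ _ _ _ (cder_const (- (1))%C _) (cder_id _)))].
      unfold A. ring.
    - intros s Hs. auto_derive; auto. ring.
    - intros s Hs. rewrite Cmod_mult, Hc. assert (H1 := HA1 s ltac:(lra)). lra. }
  rewrite <- Ez in HF. rewrite Cmult_0_r, (normalized_0 f Hf) in HF.
  replace (normalized f z - z - (0 - 0))%C with (normalized f z - z)%C in HF by ring.
  rewrite Cmod_minus_sym in HF. assert (H := Cmod_sub_ge z (normalized f z)). lra.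
Qed.

(** If [|a2| > 40], then [|1 - a2 g| >= |a2|/20 - 1 > 1] on the circle of radius 1/10, so its
    reciprocal [1 + a2 f] is smaller than 1 there although it equals 1 at the centre. *)
Lemma a2_le (f : C -> C) : nehari f -> Cmod (a2 f) <= 40.
Proof.
  intros Hf. apply Rnot_lt_le. intros Ha.
  set (a := Cmod (a2 f)) in *.
  assert (H : Cmod (denominator f 0%C) <= / (a / 20 - 1)).
  { apply (center_le_circle _ _ (1 / 10) _ (C1_denominator f Hf)); [lra|].
    intros w Hw. assert (Hd : disk w) by (unfold disk; lra).
    assert (Hn := denominator_neq_0 f w Hf Hd).
    assert (E := denominator_normalized f w Hn).
    assert (HF := Cmod_normalized_ge f w Hf Hw).
    assert (H1 : a / 20 - 1 <= Cmod (1 - a2 f * normalized f w)%C).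
    { rewrite Cmod_minus_sym. assert (X := Cmod_sub_ge (a2 f * normalized f w)%C 1%C).
      rewrite Cmod_mult, Cmod_1 in X. fold a in X. nra. }
    assert (E2 : Cmod (denominator f w) * Cmod (1 - a2 f * normalized f w)%C = 1)
      by (rewrite <- Cmod_mult, E; apply Cmod_1).
    assert (Hp := Cmod_neq_0 _ Hn).
    apply Rmult_le_reg_r with (a / 20 - 1); [lra|]. rewrite Rinv_l by lra. nra. }
  replace (denominator f 0%C) with (RtoC 1) in H.
  2:{ unfold denominator. replace (f 0%C) with (RtoC 0) by (symmetry; apply Hf). ring. }
  rewrite Cmod_1 in H. assert (/ (a / 20 - 1) < / 1) by (apply Rinv_lt_contravar; lra). lra.
Qed.

(** [real] sends both infinities to 0. Nonemptiness excludes plus infinity, and the lower bound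
    [eps] obtained from the absence of a witness excludes minus infinity. *)
Lemma Glb_Rbar_lt_witness (E : R -> Prop) (eps : R) :
  (exists d, E d) -> real (Glb_Rbar E) < eps -> exists d, E d /\ d < eps.
Proof.
  intros [d0 Hd0] Hlt. destruct (Classical_Prop.classic (exists d, E d /\ d < eps)) as [|Hno]; auto.
  exfalso. destruct (Glb_Rbar_correct E) as [Hlb Hgl].
  assert (H1 : Rbar_le eps (Glb_Rbar E)).
  { apply Hgl. intros d Hd. simpl. apply Rnot_lt_le. intros Hlt'. apply Hno. exists d; auto. }
  assert (H2 := Hlb d0 Hd0).
  destruct (Glb_Rbar E); simpl in *; lra.
Qed.

Lemma asin_ge (x : R) : 0 <= x <= 1 -> x <= asin x.
Proof.
  intros Hx. assert (Hb := asin_bound x). assert (Hs := sin_asin x ltac:(lra)).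
  destruct (Rle_lt_dec (asin x) 0) as [H|H].
  - destruct (Req_dec (asin x) 0) as [E|Hne]; [rewrite E, sin_0 in Hs; lra|].
    assert (sin (asin x) < 0); [|lra]. apply sin_lt_0_var; lra.
  - assert (H1 := sin_lt_x _ H). lra.
Qed.

(* In terms of [g = normalized f] one has [f + 1/a2 = 1/(a2 (1 - a2 g))], so a
   small [delta] forces [g] to be large. *)
Lemma normalized_large (K : R) : 0 < K -> exists eps, 0 < eps /\
  forall f, nehari f -> delta f < eps -> exists z, disk z /\ K < Cmod (normalized f z).
Proof.
  (* Suppose [|g z| <= K]. If [a2 <> 0], then [|a2| |f + 1/a2| |1 - a2 g| = 1] with [|a2| <= 40]
     gives distance at least [e1]. If [a2 = 0], then [g = f], and the spherical distance to infinity
     is at least the chordal one, hence at least [e2]. *)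
  intros HK. set (e1 := / (40 * (1 + 40 * K))). set (e2 := 2 / sqrt (1 + K ^ 2)).
  assert (He1 : 0 < e1) by (apply Rinv_0_lt_compat; lra).
  assert (HsK : 0 < sqrt (1 + K ^ 2)) by (apply sqrt_lt_R0; nra).
  assert (He2 : 0 < e2) by (apply Rdiv_lt_0_compat; lra).
  exists (Rmin e1 e2). split; [apply Rmin_glb_lt; auto|]. intros f Hf Hd.
  unfold delta in Hd. destruct (Ceq_dec (a2 f) 0%C) as [E0|Hn].
  - apply Glb_Rbar_lt_witness in Hd; [|exists (spherical_dist (Some (f 0%C)) None), 0%C;
      split; [apply disk_0|reflexivity]].
    destruct Hd as [d [[z [Hz ->]] Hd]]. exists z. split; auto.
    replace (normalized f z) with (f z).
    2:{ unfold normalized. rewrite E0. replace (1 + 0 * f z)%C with (RtoC 1) by ring. field. }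
    assert (Hd2 := Rlt_le_trans _ _ _ Hd (Rmin_r _ _)).
    unfold spherical_dist, chordal_dist in Hd2. set (m := Cmod (f z)) in *.
    assert (Hm : 0 <= m) by apply Cmod_ge_0.
    assert (Hs1 : 1 <= sqrt (1 + m ^ 2)).
    { rewrite <- sqrt_1 at 1. apply sqrt_le_1_alt. nra. }
    assert (Hi : 0 < / sqrt (1 + m ^ 2) <= 1).
    { split; [apply Rinv_0_lt_compat; lra|]. apply Rle_trans with (/ 1); [apply Rinv_le_contravar; lra|rewrite Rinv_1; lra]. }
    replace (2 / sqrt (1 + m ^ 2) / 2) with (/ sqrt (1 + m ^ 2)) in Hd2 by (field; lra).
    assert (Ha := asin_ge (/ sqrt (1 + m ^ 2)) ltac:(lra)).
    apply Rnot_le_lt. intros Hle.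
    assert (sqrt (1 + m ^ 2) <= sqrt (1 + K ^ 2)) by (apply sqrt_le_1_alt; nra).
    assert (/ sqrt (1 + K ^ 2) <= / sqrt (1 + m ^ 2)) by (apply Rinv_le_contravar; lra).
    unfold e2, Rdiv in Hd2. lra.
  - apply Glb_Rbar_lt_witness in Hd; [|exists (Cmod (f 0 + 1 / a2 f)%C), 0%C;
      split; [apply disk_0|reflexivity]].
    destruct Hd as [d [[z [Hz ->]] Hd]]. exists z. split; auto.
    assert (Hd1 := Rlt_le_trans _ _ _ Hd (Rmin_l _ _)).
    assert (Hdn := denominator_neq_0 f z Hf Hz).
    assert (E := denominator_normalized f z Hdn).
    assert (E2 : (a2 f * (f z + 1 / a2 f) * (1 - a2 f * normalized f z))%C = 1%C).
    { etransitivity; [|exact E]. unfold denominator. field. auto. }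
    apply (f_equal Cmod) in E2. rewrite !Cmod_mult, Cmod_1 in E2.
    assert (Ha := a2_le f Hf). assert (Ha0 := Cmod_ge_0 (a2 f)).
    assert (Hm0 := Cmod_ge_0 (normalized f z)).
    assert (H1 : Cmod (1 - a2 f * normalized f z)%C <= 1 + 40 * Cmod (normalized f z)).
    { eapply Rle_trans; [apply Cmod_sub_le|]. rewrite Cmod_1, Cmod_mult. nra. }
    apply Rnot_le_lt. intros Hle.
    set (x := Cmod (f z + 1 / a2 f)%C) in *.
    assert (Hx := Cmod_ge_0 (f z + 1 / a2 f)%C). fold x in Hx.
    set (y := Cmod (1 - a2 f * normalized f z)%C) in *.
    assert (Hy : 0 <= y) by apply Cmod_ge_0.
    assert (H2 : Cmod (a2 f) * x * y <= 40 * x * (1 + 40 * K)).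
    { apply Rmult_le_compat; try lra; [apply Rmult_le_pos; auto|].
      apply Rmult_le_compat_r; lra. }
    assert (H3 : x * (40 * (1 + 40 * K)) < 1).
    { replace 1 with (e1 * (40 * (1 + 40 * K))) at 2 by (unfold e1; field; lra).
      apply Rmult_lt_compat_r; lra. }
    lra.
Qed.

(** By [primitive_le] on [[0, |z|]], so large a value at [z] is incompatible with a slope of at
    least [e] at [r0]. The slope being smaller, [near_extremal] applies on [[0, r0]]; no comparison
    of [|z|] with [r0] is required. *)
Lemma near_extremal_ray (f : C -> C) (z c : C) (r0 e al : R) :
  nehari f -> disk z -> Cmod c = 1 -> z = (c * Cmod z)%C -> 0 <= r0 < 1 -> 0 < e -> 0 < al ->
  atanh r0 + / e < Cmod (normalized f z) ->
  forall t, 0 <= t <= r0 ->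
  Cmod (normalized_derivative f (c * t) * RtoC (1 - t ^ 2) - 1)%C <=
    2 * e / (1 - r0 ^ 2) + al + e / (al * (1 - r0 ^ 2)).
Proof.
  intros Hf Hz Hc Ez Hr0 He Hal Hlarge t Ht.
  set (T := Cmod z) in *. assert (HT0 : 0 <= T) by apply Cmod_ge_0.
  unfold disk in Hz. fold T in Hz.
  destruct (radial_ode_of_nehari f c T Hf Hc Hz) as [HO _].
  set (n := fun t : R => Cmod (normalized_derivative f (c * t)%C)) in *.
  set (p := fun t : R => Re (c * normalized_preschwarzian f (c * t))%C) in *.
  assert (Hsl : slope n p r0 < e).
  { apply Rnot_le_lt. intros Hle.
    assert (HP := primitive_le T n p _ _ (fun t => normalized f (c * t)%C)
      (fun t => c * normalized_derivative f (c * t))%C r0 e HO Hr0 HT0 He).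
    cbv beta in HP. rewrite Cmult_0_r, <- Ez in HP.
    assert (Cmod (normalized f z) <= atanh r0 + / e); [|lra]. apply HP.
    - apply normalized_0; auto.
    - intros s Hs. apply rder_normalized_ray; auto; lra.
    - intros s Hs. rewrite Cmod_mult, Hc, Rmult_1_l. apply Rle_refl.
    - auto. }
  destruct (radial_ode_of_nehari f c r0 Hf Hc (proj2 Hr0)) as [HO' HR].
  assert (Hr : 0 < 1 - r0 ^ 2) by nra.
  eapply Rle_trans.
  - apply (near_extremal r0 n p _ _ (fun t => normalized_derivative f (c * t)%C)
      (fun t => c * normalized_preschwarzian f (c * t))%C al HO' Hal); [| |exact Ht].
    + rewrite Cmult_0_r. apply normalized_derivative_0; auto.
    + intros s Hs. split; [apply HR; auto|]. split; [reflexivity|]. split; reflexivity.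
  - fold n p. assert (Hi : 0 < / (1 - r0 ^ 2)) by (apply Rinv_0_lt_compat; auto).
    assert (Hj : 0 < / (al * (1 - r0 ^ 2))) by (apply Rinv_0_lt_compat, Rmult_lt_0_compat; auto).
    unfold Rdiv. nra.
Qed.

(** * The map L *)

(** The map [(1 + z)/(1 - z)] takes the disk into the right half-plane, where this form of the
    principal argument can be differentiated. *)
Lemma Carg_right (w : C) : 0 < Re w -> Carg w = atan (Im w / Re w).
Proof.
  intros Hr. assert (Hn : w <> 0%C) by (intros ->; simpl in Hr; lra).
  assert (Hm := Cmod_neq_0 _ Hn).
  set (al := atan (Im w / Re w)). assert (Hb := atan_bound (Im w / Re w)). fold al in Hb.
  assert (Hcos : Re w / Cmod w = cos al).
  { unfold al. rewrite cos_atan. rewrite Cmod_sqrt.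
    replace (Re w * Re w + Im w * Im w) with (Re w * Re w * (1 + Rsqr (Im w / Re w)))
      by (unfold Rsqr; field; lra).
    rewrite sqrt_mult_alt by nra. rewrite sqrt_square by lra.
    assert (0 < sqrt (1 + (Im w / Re w)²)).
    { apply sqrt_lt_R0. generalize (Rle_0_sqr (Im w / Re w)). lra. }
    field. lra. }
  unfold Carg. rewrite Hcos. destruct (Rlt_dec (Im w) 0) as [Hi|Hi].
  - assert (al < 0).
    { unfold al. rewrite <- atan_0. apply atan_increasing.
      apply Rmult_lt_reg_r with (Re w); auto. unfold Rdiv. rewrite Rmult_assoc, Rinv_l; lra. }
    rewrite <- cos_neg, acos_cos by lra. ring.
  - assert (0 <= al).
    { unfold al. rewrite <- atan_0.
      destruct (Req_dec (Im w) 0) as [->|]; [unfold Rdiv; rewrite Rmult_0_l; lra|].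
      left. apply atan_increasing. apply Rdiv_lt_0_compat; lra. }
    apply acos_cos. generalize PI_RGT_0. lra.
Qed.

Definition L_re (x y : R) : R :=
  / 4 * ln (((1 + x) ^ 2 + y ^ 2) / ((1 - x) ^ 2 + y ^ 2)).
Definition L_im (x y : R) : R := / 2 * atan (2 * y / (1 - x ^ 2 - y ^ 2)).

Lemma disk_parts (x y : R) : disk (x, y) -> 0 < 1 - x ^ 2 - y ^ 2.
Proof.
  unfold disk. intros H. assert (H0 := Cmod_ge_0 (x, y)). assert (H1 := Cmod2_alt (x, y)).
  simpl in H1. nra.
Qed.

Lemma disk_factors_pos (x y : R) : 0 < 1 - x ^ 2 - y ^ 2 ->
  0 < (1 + x) ^ 2 + y ^ 2 /\ 0 < (1 - x) ^ 2 + y ^ 2.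
Proof. intros H. split; nra. Qed.

Lemma L_parts (x y : R) : disk (x, y) -> L (x, y) = (L_re x y, L_im x y).
Proof.
  intros Hd. assert (HN := disk_parts x y Hd).
  destruct (disk_factors_pos x y HN) as [H1 H2].
  set (w := ((1 + (x, y)) / (1 - (x, y)))%C).
  assert (Ew : w = ((1 - x ^ 2 - y ^ 2) / ((1 - x) ^ 2 + y ^ 2), 2 * y / ((1 - x) ^ 2 + y ^ 2))).
  { unfold w. apply injective_projections; simpl; field; simpl in *; lra. }
  assert (Hre : 0 < Re w).
  { rewrite Ew. simpl. apply Rdiv_lt_0_compat; simpl in *; lra. }
  assert (Hm : Cmod w = sqrt (((1 + x) ^ 2 + y ^ 2) / ((1 - x) ^ 2 + y ^ 2))).
  { rewrite Cmod_sqrt, Ew. f_equal. unfold Re, Im. simpl fst. simpl snd. field. lra. }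
  unfold L. fold w. unfold Clog. rewrite Carg_right by auto. rewrite Hm.
  assert (Hp : 0 < ((1 + x) ^ 2 + y ^ 2) / ((1 - x) ^ 2 + y ^ 2)) by (apply Rdiv_lt_0_compat; auto).
  rewrite <- Rpower_sqrt by auto. unfold Rpower. rewrite ln_exp.
  replace (Im w / Re w) with (2 * y / (1 - x ^ 2 - y ^ 2)).
  2:{ rewrite Ew. unfold Re, Im. simpl fst. simpl snd. field. lra. }
  unfold L_re, L_im.
  set (u := ln (((1 + x) ^ 2 + y ^ 2) / ((1 - x) ^ 2 + y ^ 2))).
  set (v := atan (2 * y / (1 - x ^ 2 - y ^ 2))).
  replace (/ 2)%C with (RtoC (/ 2)) by (rewrite RtoC_inv; [reflexivity|lra]).
  apply injective_projections; simpl; field.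
Qed.

(** [L' = 1/(1 - z^2)], established along lines from the explicit real formulas; this is all that
    [mean_value_ineq] uses. *)
Lemma rder_L (z w : C) (t : R) : disk (z + t * w)%C ->
  rder (fun s => L (z + s * w)%C) t (w / (1 - (z + t * w) ^ 2))%C.
Proof.
  intros Hd. destruct z as [z1 z2]. destruct w as [w1 w2].
  set (X := fun s => z1 + s * w1). set (Y := fun s => z2 + s * w2).
  assert (EXY : forall s : R, ((z1, z2) + s * (w1, w2))%C = (X s, Y s)).
  { intros s. unfold X, Y. apply injective_projections; simpl; ring. }
  rewrite EXY in *.
  assert (Hloc : locally t (fun s => (L_re (X s) (Y s), L_im (X s) (Y s)) =
     L ((z1, z2) + s * (w1, w2))%C)).
  { destruct (rder_cont (fun s : R => ((z1, z2) + s * (w1, w2))%C) t (w1, w2)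
      (rder_affine _ _ t) (1 - Cmod (X t, Y t))) as [d [Hd0 K]].
    { unfold disk in Hd. lra. }
    exists (mkposreal d Hd0). intros s Hs. rewrite EXY. symmetry. apply L_parts.
    apply (disk_ball (X t, Y t)); auto. rewrite <- !EXY. rewrite <- EXY in K. apply K. exact Hs. }
  assert (HN := disk_parts _ _ Hd).
  destruct (disk_factors_pos _ _ HN) as [H1 H2].
  assert (H3 : 0 < ((1 + X t) ^ 2 + Y t ^ 2) / ((1 - X t) ^ 2 + Y t ^ 2))
    by (apply Rdiv_lt_0_compat; auto).
  assert (H4 : 0 < ((1 + X t) ^ 2 + Y t ^ 2) * ((1 - X t) ^ 2 + Y t ^ 2))
    by (apply Rmult_lt_0_compat; auto).
  set (x := X t) in *. set (y := Y t) in *.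
  (* [D] is [|1 + z|^2 |1 - z|^2 = |1 - z^2|^2]; the two factored forms match the logarithm and the
     quotient. *)
  set (D := ((1 + x) ^ 2 + y ^ 2) * ((1 - x) ^ 2 + y ^ 2)) in *.
  assert (ED : (1 - x ^ 2 + y ^ 2) ^ 2 + (2 * x * y) ^ 2 = D) by (unfold D; ring).
  assert (EV : ((w1, w2) / (1 - (x, y) ^ 2))%C =
    ((w1 * (1 - x ^ 2 + y ^ 2) - w2 * (2 * x * y)) / D,
     (w2 * (1 - x ^ 2 + y ^ 2) + w1 * (2 * x * y)) / D)).
  { rewrite <- ED in H4 |- *. apply injective_projections; simpl; field; apply Rgt_not_eq; lra. }
  rewrite EV. split.
  - apply (is_derive_ext_loc (fun s => L_re (X s) (Y s))).
    { eapply filter_imp; [|exact Hloc]. intros s Hs. cbv beta. rewrite <- Hs. reflexivity. }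
    unfold L_re, X, Y. auto_derive.
    + fold (X t) (Y t). fold x y. unfold Rminus, Rdiv in *. simpl in *.
      repeat split; lra.
    + fold (X t) (Y t). fold x y. unfold D, Re. simpl fst. field. simpl in *. repeat split; apply Rgt_not_eq; lra.
  - apply (is_derive_ext_loc (fun s => L_im (X s) (Y s))).
    { eapply filter_imp; [|exact Hloc]. intros s Hs. cbv beta. rewrite <- Hs. reflexivity. }
    unfold L_im, X, Y. auto_derive.
    + fold (X t) (Y t). fold x y. simpl in *. repeat split; lra.
    + fold (X t) (Y t). fold x y. unfold Im. simpl snd.
      assert (E5 : (1 - x ^ 2 - y ^ 2) ^ 2 + (2 * y) ^ 2 = D) by (unfold D; ring).
      rewrite <- E5 in H4 |- *. field. simpl in *. repeat split; apply Rgt_not_eq; lra.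
Qed.

Lemma L_0 : L 0%C = 0%C.
Proof.
  change (RtoC 0) with ((0, 0) : C). rewrite L_parts.
  - unfold L_re, L_im. replace (((1 + 0) ^ 2 + 0 ^ 2) / ((1 - 0) ^ 2 + 0 ^ 2)) with 1 by field.
    replace (2 * 0 / (1 - 0 ^ 2 - 0 ^ 2)) with 0 by field.
    rewrite ln_1, atan_0. f_equal; ring.
  - apply disk_0.
Qed.

Lemma Cmod_segment_le (z w : C) (rho t : R) : Cmod z <= rho -> Cmod w <= rho -> 0 <= t <= 1 ->
  Cmod (z + t * (w - z))%C <= rho.
Proof.
  intros Hz Hw Ht.
  replace (z + t * (w - z))%C with (RtoC (1 - t) * z + t * w)%C by (rewrite RtoC_minus; ring).
  eapply Rle_trans; [apply Cmod_triangle|].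
  rewrite !Cmod_mult, !Cmod_R, !Rabs_pos_eq by lra. nra.
Qed.

Lemma Cmod_one_minus_sq_ge (z : C) (rho : R) : Cmod z <= rho ->
  1 - rho ^ 2 <= Cmod (1 - z ^ 2)%C.
Proof.
  intros Hz. assert (H := Cmod_sub_ge 1%C (z ^ 2)%C). rewrite Cmod_1, Cmod_pow in H.
  assert (Cmod z ^ 2 <= rho ^ 2) by (apply pow_incr; split; auto; apply Cmod_ge_0). lra.
Qed.

(** Used twice at the end: to replace the directions by their limit, and with [z = 0] to bound [L]
    itself. *)
Lemma L_lipschitz (z w : C) (rho : R) : 0 <= rho < 1 -> Cmod z <= rho -> Cmod w <= rho ->
  Cmod (L w - L z)%C <= Cmod (w - z)%C / (1 - rho ^ 2).
Proof.
  intros Hr Hz Hw. assert (Hr2 : 0 < 1 - rho ^ 2) by nra.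
  set (B := Cmod (w - z)%C / (1 - rho ^ 2)).
  replace w with (z + 1%R * (w - z))%C at 1 by ring.
  replace (L z) with (L (z + 0%R * (w - z))%C) by (f_equal; ring).
  apply Rle_trans with (B * 1 - B * 0); [|lra].
  apply mean_value_ineq with (F := fun t : R => L (z + t * (w - z))%C)
    (dF := fun t : R => ((w - z) / (1 - (z + t * (w - z)) ^ 2))%C)
    (B := fun t => B * t) (dB := fun _ => B); [lra| | |].
  - intros t Ht. apply rder_L. unfold disk.
    assert (H := Cmod_segment_le z w rho t Hz Hw Ht). lra.
  - intros t _. auto_derive; auto. ring.
  - intros t Ht. assert (H := Cmod_segment_le z w rho t Hz Hw Ht).
    assert (H1 := Cmod_one_minus_sq_ge _ rho H).
    rewrite Cmod_div by (apply neq_0_of_Cmod; lra).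
    unfold B. apply Rmult_le_compat_l; [apply Cmod_ge_0|]. apply Rinv_le_contravar; lra.
Qed.

(** * Extraction of the limit *)

Definition strictly_increasing (phi : nat -> nat) : Prop :=
  forall i j : nat, (i < j)%nat -> (phi i < phi j)%nat.

Lemma strictly_increasing_ge (phi : nat -> nat) (k : nat) :
  strictly_increasing phi -> (k <= phi k)%nat.
Proof.
  intros H. induction k as [|k IH]; [lia|]. specialize (H k (S k) ltac:(lia)). lia.
Qed.

Lemma strictly_increasing_comp (phi psi : nat -> nat) :
  strictly_increasing phi -> strictly_increasing psi ->
  strictly_increasing (fun k => phi (psi k)).
Proof. intros H1 H2 i j Hij. apply H1, H2, Hij. Qed.

Lemma subsequence_selection (Q : nat -> nat -> Prop) :
  (forall k N, exists n, (N <= n)%nat /\ Q k n) ->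
  exists phi, strictly_increasing phi /\ forall k, Q k (phi k).
Proof.
  intros H.
  destruct (functional_choice (fun kN n => (snd kN <= n)%nat /\ Q (fst kN) n)) as [s Hs].
  { intros [k N]. apply H. }
  (* Requesting an index at least [S p] makes the selection strictly increasing. *)
  set (phi := nat_rec (fun _ => nat) (s (O, O)) (fun k p => s (S k, S p))).
  assert (Hstep : forall k, (phi k < phi (S k))%nat).
  { intros k. destruct (Hs (S k, S (phi k))) as [H1 _]. exact H1. }
  exists phi. split.
  - intros i j Hij. induction Hij as [|j Hij IH]; [apply Hstep|].
    eapply Nat.lt_trans; [exact IH|apply Hstep].
  - intros [|k]; apply (Hs (_, _)).
Qed.

Lemma bounded_subsequence (u : nat -> R) (a b : R) : (forall n, a <= u n <= b) ->
  exists phi, strictly_increasing phi /\ exists l : R, is_lim_seq (fun k => u (phi k)) l.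
Proof.
  intros Hu.
  destruct (Bolzano_Weierstrass u (fun x => a <= x <= b) (compact_P3 a b) Hu) as [l Hl].
  destruct (subsequence_selection (fun k n => Rabs (u n - l) < / INR (S k))) as [phi [Hphi HQ]].
  - intros k N. assert (Hk : 0 < / INR (S k)) by (apply Rinv_0_lt_compat, lt_0_INR; lia).
    destruct (Hl (fun x => Rabs (x - l) < / INR (S k)) N) as [n [Hn Hq]].
    + exists (mkposreal _ Hk). intros x Hx. exact Hx.
    + exists n. auto.
  - exists phi. split; auto. exists l. apply is_lim_seq_spec. intros e.
    destruct (archimed_cor1 e (cond_pos e)) as [N [HN HN0]].
    exists N. intros n Hn. eapply Rlt_trans; [apply HQ|].
    eapply Rle_lt_trans; [|exact HN]. apply Rinv_le_contravar; [apply lt_0_INR; lia|].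
    apply le_INR. lia.
Qed.

Lemma unit_subsequence (c : nat -> C) : (forall n, Cmod (c n) = 1) ->
  exists phi, strictly_increasing phi /\ exists l, Cmod l = 1 /\
    forall eps, 0 < eps -> exists N, forall n, (N <= n)%nat -> Cmod (c (phi n) - l)%C < eps.
Proof.
  intros Hc.
  destruct (bounded_subsequence (fun n => Re (c n)) (-1) 1) as [phi1 [H1 [a Ha]]].
  { intros n. apply Rabs_le_between. rewrite <- (Hc n). apply re_le_Cmod. }
  destruct (bounded_subsequence (fun n => Im (c (phi1 n))) (-1) 1) as [phi2 [H2 [b Hb]]].
  { intros n. apply Rabs_le_between. rewrite <- (Hc (phi1 n)). apply im_le_Cmod. }
  exists (fun k => phi1 (phi2 k)). split; [apply strictly_increasing_comp; auto|].
  assert (Hlim : forall eps, 0 < eps -> exists N, forall n, (N <= n)%nat ->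
     Cmod (c (phi1 (phi2 n)) - (a, b))%C < eps).
  { intros eps He. assert (He2 : 0 < eps / 2) by lra.
    destruct (proj2 (is_lim_seq_spec _ _) Ha (mkposreal _ He2)) as [N1 K1].
    destruct (proj2 (is_lim_seq_spec _ _) Hb (mkposreal _ He2)) as [N2 K2].
    exists (max N1 N2). intros n Hn. replace eps with (2 * (eps / 2)) by field.
    apply Cmod_lt_of_parts.
    - apply (K1 (phi2 n)). assert (X := strictly_increasing_ge phi2 n H2). lia.
    - apply K2. lia. }
  exists (a, b). split; auto.
  apply Rle_antisym; apply Rnot_lt_le; intros Hlt.
  - destruct (Hlim (Cmod (a, b) - 1)) as [N K]; [lra|]. specialize (K N (le_n N)).
    rewrite Cmod_minus_sym in K. assert (X := Cmod_sub_ge (a, b) (c (phi1 (phi2 N)))).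
    rewrite Hc in X. lra.
  - destruct (Hlim (1 - Cmod (a, b))) as [N K]; [lra|]. specialize (K N (le_n N)).
    assert (X := Cmod_sub_ge (c (phi1 (phi2 N))) (a, b)).
    rewrite Hc in X. lra.
Qed.

(* The difference of [g'(c z)], for [g = normalized f], and [L'(z) = 1/(1 - z^2)]. *)
Definition derivative_gap (f : C -> C) (c z : C) : C :=
  (normalized_derivative f (c * z) - / (1 - z * z))%C.

Lemma one_minus_sq_neq_0 (z : C) : disk z -> (1 - z * z)%C <> 0%C.
Proof.
  intros Hz. apply neq_0_of_Cmod. unfold disk in Hz. assert (H := Cmod_ge_0 z).
  assert (X := Cmod_one_minus_sq_ge z (Cmod z) (Rle_refl _)).
  replace (z ^ 2)%C with (z * z)%C in X by ring. nra.
Qed.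

Lemma disk_unit_mult (c z : C) : Cmod c = 1 -> disk z -> disk (c * z)%C.
Proof. intros Hc. unfold disk. rewrite Cmod_mult, Hc, Rmult_1_l. auto. Qed.

Lemma C1_derivative_gap (f : C -> C) (c : C) : nehari f -> Cmod c = 1 ->
  C1_on_disk (derivative_gap f c) (fun z =>
    c * (normalized_preschwarzian f (c * z) * normalized_derivative f (c * z)) +
    - (1) * ((z + z) * (/ (1 - z * z) * / (1 - z * z))))%C.
Proof.
  intros Hf Hc z Hz. assert (Hd := disk_unit_mult c z Hc Hz).
  assert (Hn := denominator_neq_0 f _ Hf Hd). assert (H1 := one_minus_sq_neq_0 z Hz).
  assert (Dq : cder (fun w => 1 + - (1) * (w * w))%C z (- (1) * (z + z))%C).
  { eapply cder_eq; [|exact (cder_plus _ _ _ _ _ (cder_const 1%C z) (cder_mult _ _ _ _ _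
      (cder_const (- (1))%C z) (cder_mult _ _ _ _ _ (cder_id z) (cder_id z))))]. cbv beta. ring. }
  assert (Dq' : cder (fun w => 1 - w * w)%C z (- (1) * (z + z))%C).
  { apply (cder_ext_loc (fun w => 1 + - (1) * (w * w))%C _ 1); [lra|intros; ring|exact Dq]. }
  assert (Cs : ccont (fun w => c * w)%C z)
    by (apply ccont_mult; [apply ccont_const|apply ccont_id]).
  assert (Ci : ccont (fun w => / (1 - w * w))%C z)
    by (apply ccont_inv; [exact (cder_ccont _ _ _ Dq')|exact H1]).
  split.
  - apply (cder_ext_loc (fun w => normalized_derivative f (c * w) + - (1) * / (1 - w * w))%C _ 1);
      [lra|intros; unfold derivative_gap; ring|].
    eapply cder_eq; [|exact (cder_plus _ _ _ _ _
      (cder_scale _ c z _ (cder_normalized_derivative f _ Hf Hd Hn))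
      (cder_mult _ _ _ _ _ (cder_const (- (1))%C z) (cder_inv _ _ _ Dq' H1)))].
    cbv beta. field. exact H1.
  - apply ccont_plus.
    + apply ccont_mult; [apply ccont_const|]. apply ccont_mult.
      * apply (ccont_comp (fun w => c * w)%C); auto.
        eapply cder_ccont, cder_normalized_preschwarzian; auto.
      * apply (ccont_comp (fun w => c * w)%C); auto.
        eapply cder_ccont, cder_normalized_derivative; auto.
    + apply ccont_mult; [apply ccont_const|]. apply ccont_mult; [|apply ccont_mult; exact Ci].
      apply ccont_plus; apply ccont_id.
Qed.

Lemma derivative_gap_le (f : C -> C) (c z : C) (r : R) : nehari f -> Cmod c = 1 ->
  0 < r < 1 -> Cmod z <= r -> Cmod (derivative_gap f c z) <= 2 / (1 - r ^ 2).
Proof.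
  intros Hf Hc Hr Hz. assert (Hd : disk z) by (unfold disk; lra).
  assert (Hr2 : 0 < 1 - r ^ 2) by nra. assert (H0 := Cmod_ge_0 z).
  unfold derivative_gap. eapply Rle_trans; [apply Cmod_sub_le|].
  assert (H1 := normalized_derivative_le f _ Hf (disk_unit_mult c z Hc Hd)).
  rewrite Cmod_mult, Hc, Rmult_1_l in H1.
  assert (H2 : / (1 - Cmod z ^ 2) <= / (1 - r ^ 2)) by (apply Rinv_le_contravar; nra).
  assert (H3 := Cmod_one_minus_sq_ge z r Hz).
  replace (z ^ 2)%C with (z * z)%C in H3 by ring.
  rewrite Cmod_inv by (apply one_minus_sq_neq_0; auto).
  assert (H4 : / Cmod (1 - z * z)%C <= / (1 - r ^ 2)) by (apply Rinv_le_contravar; lra).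
  unfold Rdiv. lra.
Qed.

Lemma normalized_sub_L_le (f : C -> C) (c z : C) (rho eps : R) : nehari f -> Cmod c = 1 ->
  0 < rho < 1 -> Cmod z <= rho ->
  (forall w, Cmod w <= rho -> Cmod (derivative_gap f c w) <= eps) ->
  Cmod (normalized f (c * z) - c * L z)%C <= eps.
Proof.
  intros Hf Hc Hrho Hz Hgap.
  assert (Hseg : forall t, 0 <= t <= 1 -> Cmod (0 + t * z)%C <= rho).
  { intros t Ht. replace (0 + t * z)%C with (0 + t * (z - 0))%C by ring.
    apply Cmod_segment_le; auto. rewrite Cmod_0; lra. }
  assert (H := mean_value_ineq (fun t : R => normalized f (c * z * t) + - c * L (0 + t * z))%C
    (fun t : R => c * z * normalized_derivative f (c * z * t)
       + - c * (z / (1 - (0 + t * z) ^ 2)))%C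
    (fun t => eps * t) (fun _ => eps) 0 1 ltac:(lra)).
  replace (normalized f (c * z) - c * L z)%C with
    (normalized f (c * z * 1%R) + - c * L (0 + 1%R * z) -
     (normalized f (c * z * 0%R) + - c * L (0 + 0%R * z)))%C.
  - replace eps with (eps * 1 - eps * 0) by ring. apply H.
    + intros t Ht. assert (Hd : disk (0 + t * z)%C) by (unfold disk; specialize (Hseg t Ht); lra).
      assert (Hd' : disk (c * z * t)%C).
      { replace (c * z * t)%C with (c * (0 + t * z))%C by ring. apply disk_unit_mult; auto. }
      assert (D1 := rder_ray _ _ _ _ (cder_normalized f _ Hf Hd' (denominator_neq_0 f _ Hf Hd'))).
      assert (D2 := rder_scal (- c)%C _ _ _ (rder_L 0%C z t Hd)).
      split; [apply (is_derive_plus (V := R_NormedModule) _ _ _ _ _ (proj1 D1) (proj1 D2))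
             |apply (is_derive_plus (V := R_NormedModule) _ _ _ _ _ (proj2 D1) (proj2 D2))].
    + intros t _. auto_derive; auto. ring.
    + intros t Ht. assert (Hd : disk (0 + t * z)%C) by (unfold disk; specialize (Hseg t Ht); lra).
      assert (H1 := one_minus_sq_neq_0 _ Hd).
      replace (c * z * normalized_derivative f (c * z * t) + - c * (z / (1 - (0 + t * z) ^ 2)))%C
        with (c * z * derivative_gap f c (0 + t * z))%C.
      * rewrite !Cmod_mult, Hc, Rmult_1_l. specialize (Hgap _ (Hseg t Ht)).
        generalize (Cmod_ge_0 z) (Cmod_ge_0 (derivative_gap f c (0 + t * z)%C)). nra.
      * unfold derivative_gap. replace (c * (0 + t * z))%C with (c * z * t)%C by ring.
        replace ((0 + t * z) ^ 2)%C with ((0 + t * z) * (0 + t * z))%C by ring.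
        unfold Cdiv. ring.
  - replace (c * z * 1%R)%C with (c * z)%C by ring. replace (c * z * 0%R)%C with (RtoC 0) by ring.
    replace (0 + 1%R * z)%C with z by ring. replace (0 + 0%R * z)%C with (RtoC 0) by ring.
    rewrite L_0, normalized_0 by auto. ring.
Qed.

Lemma derivative_gap_ray (g : nat -> C -> C) (c : nat -> C) :
  (forall n, nehari (g n)) -> (forall n, Cmod (c n) = 1) ->
  (forall n, exists z, disk z /\ z = (c n * Cmod z)%C /\ INR n < Cmod (normalized (g n) z)) ->
  forall t eps, 0 < t < 1 -> 0 < eps ->
  exists N, forall n, (N <= n)%nat -> Cmod (derivative_gap (g n) (c n) (RtoC t)) < eps.
Proof.
  intros Hg Hc Hz t eps0 Ht He0. assert (Ht2 : 0 < 1 - t ^ 2) by nra.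
  (* [near_extremal_ray] estimates the gap multiplied by [1 - t^2]. *)
  set (eps := eps0 * (1 - t ^ 2)). assert (He : 0 < eps) by (apply Rmult_lt_0_compat; auto).
  set (al := eps / 4). assert (Hal : 0 < al) by (unfold al; lra).
  (* Each of the three terms of the estimate is then at most [eps/4]. *)
  set (e := Rmin (eps * (1 - t ^ 2) / 8) (al * (1 - t ^ 2) * (eps / 4))).
  assert (Hee : 0 < e).
  { apply Rmin_glb_lt.
    - apply Rdiv_lt_0_compat; [apply Rmult_lt_0_compat; auto|lra].
    - apply Rmult_lt_0_compat; [apply Rmult_lt_0_compat; auto|lra]. }
  destruct (nfloor_ex (Rmax 0 (atanh t + / e))) as [N [_ HN]]; [apply Rmax_l|].
  exists (S N). intros n Hn. destruct (Hz n) as [z [Hd [Ez HK]]].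
  assert (H := near_extremal_ray (g n) z (c n) t e al (Hg n) Hd (Hc n) Ez ltac:(lra) Hee Hal).
  assert (Hlarge : atanh t + / e < Cmod (normalized (g n) z)).
  { eapply Rle_lt_trans; [apply (Rmax_r 0)|]. eapply Rlt_trans; [exact HN|].
    eapply Rle_lt_trans; [|exact HK]. rewrite <- S_INR. apply le_INR. exact Hn. }
  specialize (H Hlarge t ltac:(lra)).
  assert (H1 : 2 * e / (1 - t ^ 2) <= eps / 4).
  { apply Rmult_le_reg_r with (1 - t ^ 2); auto.
    replace (2 * e / (1 - t ^ 2) * (1 - t ^ 2)) with (2 * e) by (field; lra).
    assert (e <= eps * (1 - t ^ 2) / 8) by apply Rmin_l. lra. }
  assert (H2 : e / (al * (1 - t ^ 2)) <= eps / 4).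
  { assert (X : 0 < al * (1 - t ^ 2)) by (apply Rmult_lt_0_compat; auto).
    apply Rmult_le_reg_r with (al * (1 - t ^ 2)); auto.
    replace (e / (al * (1 - t ^ 2)) * (al * (1 - t ^ 2))) with e by (field; lra).
    assert (e <= al * (1 - t ^ 2) * (eps / 4)) by apply Rmin_r. lra. }
  assert (Hm : Cmod (RtoC (1 - t ^ 2)) = 1 - t ^ 2) by (rewrite Cmod_R; apply Rabs_pos_eq; lra).
  apply Rmult_lt_reg_r with (1 - t ^ 2); auto. fold eps.
  rewrite <- Hm at 1. rewrite <- Cmod_mult.
  replace (derivative_gap (g n) (c n) t * RtoC (1 - t ^ 2))%C
    with (normalized_derivative (g n) (c n * t) * RtoC (1 - t ^ 2) - 1)%C.
  - unfold al in *. lra.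
  - unfold derivative_gap.
    assert (E : RtoC (1 - t ^ 2) = (1 - t * t)%C) by (rewrite RtoC_minus, RtoC_pow; ring).
    assert (Hn0 : (1 - t * t)%C <> 0%C) by (rewrite <- E; apply neq_0_of_Cmod; lra).
    rewrite E. field. exact Hn0.
Qed.

Theorem lemma3p2 (f : nat -> C -> C)
    (hf : forall n : nat, nehari_star (f n))
    (hdelta : is_lim_seq (fun n : nat => delta (f n)) 0) :
  exists phi : nat -> nat,
    (forall i j : nat, (i < j)%nat -> (phi i < phi j)%nat) /\
    exists c : C, Cmod c = 1 /\
      locally_uniformly_on_disk (fun k : nat => normalized (f (phi k))) (rotation c L).
Proof.
  assert (Hf : forall n, nehari (f n)) by (intros n; apply hf).
  destruct (subsequence_selection (fun k n =>
    exists z, disk z /\ INR k < Cmod (normalized (f n) z))) as [phi1 [H1 HQ]].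
  (* [S k], because the bound given to [normalized_large] must be positive. *)
  { intros k N. destruct (normalized_large (INR (S k))) as [eps [He H]].
    { apply lt_0_INR; lia. }
    destruct (proj2 (is_lim_seq_spec _ _) hdelta (mkposreal _ He)) as [N1 K1].
    exists (max N N1). split; [lia|]. specialize (K1 (max N N1) ltac:(lia)).
    simpl in K1. rewrite Rminus_0_r in K1.
    destruct (H (f (max N N1)) (Hf _)) as [z [Hz Hlt]].
    { eapply Rle_lt_trans; [apply Rle_abs|exact K1]. }
    exists z. split; auto. rewrite S_INR in Hlt. lra. }
  destruct (functional_choice (fun k c => Cmod c = 1 /\ exists z, disk z /\
    z = (c * Cmod z)%C /\ INR k < Cmod (normalized (f (phi1 k)) z))) as [c Hc].
  { intros k. destruct (HQ k) as [z [Hz Hlt]]. destruct (polar z) as [c [Hc Ez]].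
    exists c. split; auto. exists z. auto. }
  destruct (unit_subsequence c) as [psi [H2 [l [Hl Hlim]]]]; [intros n; apply Hc|].
  exists (fun k => phi1 (psi k)). split; [apply strictly_increasing_comp; auto|].
  (* The limit found is [l L(conj l * z)], which is [rotation] by [conj l]. *)
  exists (Cconj l). split; [rewrite Cmod_conj; exact Hl|].
  set (g := fun k => f (phi1 (psi k))). set (d := fun k => c (psi k)).
  assert (Hd : forall k, Cmod (d k) = 1) by (intros k; apply Hc).
  assert (Hray := derivative_gap_ray g d (fun k => Hf _) Hd).
  assert (Hz : forall n, exists z, disk z /\ z = (d n * Cmod z)%C /\
     INR n < Cmod (normalized (g n) z)).
  { intros n. destruct (proj2 (Hc (psi n))) as [z [Hz [Ez Hlt]]]. exists z.
    split; auto. split; auto. eapply Rle_lt_trans; [|exact Hlt].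
    apply le_INR, strictly_increasing_ge; auto. }
  specialize (Hray Hz).
  intros z0 Hz0. unfold disk in Hz0. assert (Hz00 := Cmod_ge_0 z0).
  (* The neighbourhood of [z0] lies in the disk of radius [rho], and [r] leaves room between [rho]
     and 1 for [vitali]. *)
  set (rho := (1 + Cmod z0) / 2). assert (Hrho : 0 < rho < 1) by (unfold rho; lra).
  set (r := (1 + rho) / 2). assert (Hr : rho < r < 1) by (unfold r; lra).
  assert (Hr2 : 0 < 1 - r ^ 2) by nra. assert (Hrho2 : 0 < 1 - rho ^ 2) by nra.
  exists ((1 - Cmod z0) / 2). split; [lra|]. intros eps He.
  destruct (vitali (fun n => derivative_gap (g n) (d n)) _ r (2 / (1 - r ^ 2))
    (fun n => C1_derivative_gap (g n) (d n) (Hf _) (Hd n)) ltac:(lra)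
    ltac:(apply Rdiv_lt_0_compat; lra)
    (fun n w Hw => derivative_gap_le (g n) (d n) w r (Hf _) (Hd n) ltac:(lra) Hw)
    (fun t e Ht He => Hray t e ltac:(lra) He) rho (eps / 2) ltac:(lra) ltac:(lra)) as [N1 K1].
  (* Replacing [d n] by [l] costs [|d n - l| / (1 - rho^2)] twice: once inside the argument of [L]
     and once in the factor in front. *)
  set (B := 2 * / (1 - rho ^ 2)).
  assert (HB : 0 < B) by (unfold B; generalize (Rinv_0_lt_compat _ Hrho2); lra).
  destruct (Hlim (eps / 2 / B)) as [N2 K2]; [apply Rdiv_lt_0_compat; lra|].
  exists (max N1 N2). intros n Hn z _ Hzz.
  specialize (K1 n ltac:(lia)). specialize (K2 n ltac:(lia)). fold (d n) in K2. fold (g n).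
  assert (Hzr : Cmod z <= rho).
  { replace z with ((z - z0) + z0)%C by ring. eapply Rle_trans; [apply Cmod_triangle|].
    unfold rho. lra. }
  unfold rotation. rewrite Cconj_conj.
  assert (Hunit : forall u : C, Cmod u = 1 -> (u * Cconj u)%C = 1%C).
  { intros u Hu. rewrite <- Cmod2_conj, Hu. f_equal. ring. }
  set (w := (Cconj (d n) * z)%C). set (w' := (Cconj l * z)%C).
  assert (Hw : Cmod w <= rho) by (unfold w; rewrite Cmod_mult, Cmod_conj, Hd; lra).
  assert (Hw' : Cmod w' <= rho) by (unfold w'; rewrite Cmod_mult, Cmod_conj, Hl; lra).
  assert (Ew : (d n * w)%C = z).
  { unfold w. rewrite Cmult_assoc, (Hunit _ (Hd n)). ring. }
  assert (X1 := normalized_sub_L_le (g n) (d n) w rho (eps / 2) (Hf _) (Hd n) Hrho Hw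
    (fun v Hv => Rlt_le _ _ (K1 v Hv))).
  rewrite Ew in X1.
  assert (X2 := L_lipschitz w' w rho ltac:(lra) Hw' Hw).
  assert (X3 := L_lipschitz 0%C w' rho ltac:(lra) ltac:(rewrite Cmod_0; lra) Hw').
  rewrite L_0 in X3. replace (L w' - 0)%C with (L w') in X3 by ring.
  replace (w' - 0)%C with w' in X3 by ring.
  set (m := Cmod (d n - l)%C) in *. assert (Hm : 0 <= m) by apply Cmod_ge_0.
  assert (X4 : Cmod (w - w')%C <= m).
  { unfold w, w'. replace (Cconj (d n) * z - Cconj l * z)%C with (Cconj (d n - l) * z)%C
      by (rewrite Cminus_conj; ring).
    rewrite Cmod_mult, Cmod_conj. fold m. nra. }
  assert (Hi := Rinv_0_lt_compat _ Hrho2).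
  replace (normalized (g n) z - l * L w')%C with
    ((normalized (g n) z - d n * L w) + (d n * (L w - L w') + (d n - l) * L w'))%C by ring.
  eapply Rle_lt_trans; [apply Cmod_triangle|].
  assert (X5 : Cmod (d n * (L w - L w') + (d n - l) * L w')%C <= B * m).
  { eapply Rle_trans; [apply Cmod_triangle|]. rewrite !Cmod_mult, Hd. fold m.
    unfold Rdiv in X2, X3. unfold B.
    assert (Y1 : Cmod (w - w')%C * / (1 - rho ^ 2) <= m * / (1 - rho ^ 2))
      by (apply Rmult_le_compat_r; lra).
    assert (Y2 : Cmod w' * / (1 - rho ^ 2) <= 1 * / (1 - rho ^ 2))
      by (apply Rmult_le_compat_r; lra).
    assert (Y3 : m * Cmod (L w') <= m * (1 * / (1 - rho ^ 2)))
      by (apply Rmult_le_compat_l; lra).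
    lra. }
  assert (X6 : B * m < eps / 2).
  { replace (eps / 2) with (B * (eps / 2 / B)) by (field; lra).
    apply Rmult_lt_compat_l; auto. }
  lra.
Qed.
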